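(* Let $B:[0,T]\to\mathrm{Sym}(2n)$ be continuous, let $\phi:[0,T]\to\mathrm{Sp}(2n)$ be the fundamental solution of $z'(t)=J_0B(t)z(t)$ (i.e. $\phi'=J_0B\phi$, $\phi(0)=\mathrm{Id}$), let $L,L_1,L_2\in\Lambda(n)$ and $\ell(t)=\phi(t)L$. Define $$\epsilon_1=L\cap\ell(T)+\ell(T)\cap L_1,\quad \epsilon_2=L\cap\ell(T)+\ell(T)\cap L_2,\quad \delta_1=L\cap L_1+L_1\cap L_2,\quad \delta_2=\ell(T)\cap L_1+L_1\cap L_2,$$ $k_1=\min\{\dim\epsilon_1,\dim\epsilon_2\}$, $k_2=\min\{\dim\delta_1,\dim\delta_2\}$, $k=\max\{k_1,k_2\}$. Then $$\Big|\iota^{\mathrm{CLM}}\big(L_2,\ell(t);t\in[0,T]\big)-\iota^{\mathrm{CLM}}\big(L_1,\ell(t);t\in[0,T]\big)\Big|\le n-k.$$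
   Context: The standard symplectic space is $\mathbb R^{2n}=\mathbb R^n\oplus\mathbb R^n$ with coordinates $z=(p,q)$, symplectic form $\omega_0((p_1,q_1),(p_2,q_2))=\langle p_1,q_2\rangle-\langle q_1,p_2\rangle$ and complex structure $J_0(p,q)=(-q,p)$, so $\omega_0(z_1,z_2)=\langle J_0z_1,z_2\rangle$; $\mathrm{Sp}(2n)$ is its symplectic group, $\Lambda(n)$ its Lagrangian Grassmannian, $\mathrm{Sym}(2n)$ the real symmetric $2n\times 2n$ matrices. For a $2n$-dimensional real symplectic space $(V,\omega)$ with Lagrangian Grassmannian $\Lambda(V,\omega)$, $L_0\in\Lambda(V,\omega)$ and a continuous path $\ell:[a,b]\to\Lambda(V,\omega)$, $\iota^{\mathrm{CLM}}(L_0,\ell(t);t\in[a,b])\in\mathbb Z$ denotes the Cappell–Lee–Miller Maslov index: the intersection index of $\ell$ with the Maslov cycle $\Sigma(L_0)=\{L: L\cap L_0\neq\{0\}\}$; it is invariant under fixed-endpoint homotopies, additive under concatenation, and for $\mathscr C^1$ paths with only regular crossings equals $n_+(\Gamma(\ell,L_0,a))+\sum_{a<t<b}\operatorname{sgn}\Gamma(\ell,L_0,t)-n_-(\Gamma(\ell,L_0,b))$, where a crossing is $t_0$ with $\ell(t_0)\cap L_0\ne\{0\}$, the crossing form on $\ell(t_0)\cap L_0$ is $\Gamma(\ell,L_0,t_0)[v]=\frac{d}{dt}|_{t=t_0}\omega(v,w(t))$ with $w(t)\in W$ the unique vector with $v+w(t)\in\ell(t)$ for a fixed Lagrangian $W$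 transversal to $\ell(t_0)$, and regular means nondegenerate. *)

(* Defs.v *)
From HB Require Import structures.
From mathcomp Require Import all_boot all_order all_algebra.
From mathcomp Require Import all_classical all_reals all_analysis.
Set Implicit Arguments. Unset Strict Implicit. Unset Printing Implicit Defensive.
Import Order.TTheory GRing.Theory Num.Theory.
Import numFieldNormedType.Exports.
Local Open Scope classical_set_scope.
Local Open Scope ring_scope.

(* Conventions.  R^{2n} = R^n (+) R^n is represented by row vectors
   'rV[R]_(n + n), z = (p, q) with p = lsubmx z, q = rsubmx z.
   A linear subspace of R^{2n} is represented (mxalgebra style) by the row
   space of a matrix with n + n columns. *)

Section Symplectic.
Variable R : realType.
Variable n : nat.
Local Notation V := 'rV[R]_(n + n).

Definition omega (z1 z2 : V) : R :=
  (lsubmx z1 *m (rsubmx z2)^T) 0 0 - (rsubmx z1 *m (lsubmx z2)^T) 0 0.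

(* J0 (p,q) = (-q,p), as a matrix acting on column vectors (p;q) *)
Definition J0 : 'M[R]_(n + n) := block_mx 0 (- 1%:M) 1%:M 0.

Definition lagrangian m (L : 'M[R]_(m, n + n)) : Prop :=
  \rank L = n /\
  forall u v : V, (u <= L)%MS -> (v <= L)%MS -> omega u v = 0.

(* Crossing form Gamma(ell, L0, t0)[v], literally as in the paper:
   for a fixed Lagrangian W transversal to ell(t0), w(t) in W is the vector
   with v + w(t) in ell(t) (for t near t0), and the form is
   d/dt|_{t0} omega(v, w(t)).  cf_val P t0 v q says q is this value. *)
Definition cf_val m (P : R -> 'M[R]_(m, n + n)) (t0 : R) (v : V) (q : R) : Prop :=
  exists W : 'M[R]_(n + n),
    lagrangian W /\ \rank (W :&: P t0)%MS = 0%N /\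
    exists w : R -> V,
      (\forall t \near t0, (w t <= W)%MS /\ ((v + w t)%R <= P t)%MS) /\
      is_derive t0 (1 : R) (fun t => omega v (w t)) q.

Definition crossing_form m (P : R -> 'M[R]_(m, n + n)) (t0 : R) (v : V) : R :=
  xget 0 [set q | cf_val P t0 v q].

Definition npos (Q : V -> R) (S : 'M[R]_(n + n)) : nat :=
  \max_(k < (n + n).+1 |
     `[< exists U : 'M[R]_(n + n), (U <= S)%MS /\ \rank U = k /\
          forall u : V, (u <= U)%MS -> u != 0 -> 0 < Q u >]) k.

Definition nneg (Q : V -> R) (S : 'M[R]_(n + n)) : nat :=
  \max_(k < (n + n).+1 |
     `[< exists U : 'M[R]_(n + n), (U <= S)%MS /\ \rank U = k /\
          forall u : V, (u <= U)%MS -> u != 0 -> Q u < 0 >]) k.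

Definition sgnQ (Q : V -> R) (S : 'M[R]_(n + n)) : int :=
  (npos Q S)%:Z - (nneg Q S)%:Z.

Definition nondeg (Q : V -> R) (S : 'M[R]_(n + n)) : Prop :=
  forall u : V, (u <= S)%MS ->
    (forall v : V, (v <= S)%MS -> Q (u + v) - Q u - Q v = 0) -> u = 0.

Definition crossing m (P : R -> 'M[R]_(m, n + n)) (L0 : 'M[R]_(n + n)) (t : R) : bool :=
  (\rank (P t :&: L0)%MS != 0%N).

Definition C1_lagr_frame (F : R -> 'M[R]_(n, n + n)) : Prop :=
  (forall t, lagrangian (F t)) /\
  forall i j, (forall t, derivable (fun s => F s i j) t 1) /\
              continuous (fun t => derive (fun s => F s i j) t (1 : R)).

(* F has only regular crossings with Sigma(L0) on [a,b] (finitely many),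
   and the crossing-form formula for the CLM index gives the integer k *)
Definition clm_sum (L0 : 'M[R]_(n + n)) (a b : R) (F : R -> 'M[R]_(n, n + n))
    (k : int) : Prop :=
  exists s : seq R,
    uniq s /\
    (forall t, t \in s <-> (a < t < b /\ crossing F L0 t)) /\
    (forall t, a <= t <= b -> crossing F L0 t ->
        nondeg (crossing_form F t) (F t :&: L0)%MS) /\
    k = (npos (crossing_form F a) (F a :&: L0)%MS)%:Z
        + \sum_(t <- s) sgnQ (crossing_form F t) (F t :&: L0)%MS
        - (nneg (crossing_form F b) (F b :&: L0)%MS)%:Z.

Definition homotopic_rel (a b : R) (P : R -> 'M[R]_(n + n))
    (F : R -> 'M[R]_(n, n + n)) : Prop :=
  exists H : R -> R -> 'M[R]_(n, n + n),
    (forall s t, 0 <= s <= 1 -> a <= t <= b -> lagrangian (H s t)) /\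
    (forall i j, {within [set st : R * R | 0 <= st.1 <= 1 /\ a <= st.2 <= b],
                   continuous (fun st : R * R => H st.1 st.2 i j)}) /\
    (forall t, a <= t <= b -> (H 0 t == P t)%MS /\ (H 1 t == F t)%MS) /\
    (forall s, 0 <= s <= 1 -> (H s a == P a)%MS /\ (H s b == P b)%MS).

(* Cappell--Lee--Miller Maslov index iota^CLM(L0, P(t); t in [a,b]):
   the value of the crossing formula on any C^1 path with only regular
   crossings that is homotopic to P with fixed endpoints (well defined by
   homotopy invariance; such paths always exist). *)
Definition clm (L0 : 'M[R]_(n + n)) (a b : R) (P : R -> 'M[R]_(n + n)) : int :=
  xget 0 [set k : int | exists F, C1_lagr_frame F /\ homotopic_rel a b P F /\
                                  clm_sum L0 a b F k].

End Symplectic.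

(* Main.v *)
Require Import Defs.
From HB Require Import structures.
From mathcomp Require Import all_boot all_order all_algebra.
From mathcomp Require Import all_classical all_reals all_analysis.
From mathcomp Require Import zify ring lra.
(* Fix a Lagrangian Y. Lagrangians transversal to Y are symmetric matrices A_F, and
   along a path in this chart the crossing formula with G is the increment of
   hi_Y(F, G), the positive index of A_F - A_G: when the crossing form on ker (A_F - A_G)
   is nondegenerate, its positive part becomes positive just after the crossing and
   its negative part was positive just before.
   The positive index of Kashiwara's form of three Lagrangians F, G, H, which does not
   mention Y, is hi_Y(F,G) + hi_Y(G,H) + hi_Y(H,F). Hence the increments of hi_Y(., G)
   along a path do not depend on Y, which gives homotopy invariance on a fine grid of
   the homotopy rectangle; moreover the difference of the increments for two Lagrangians
   L1, L2 depends on the end points of the path only. In a chart Y that contains L,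
   ell(T), L1 and L2 it equals both i(L,ell(T),L2) - i(L,ell(T),L1) and
   i(L,L1,L2) - i(ell(T),L1,L2) with i(A,B,C) = hi(A,B) + hi(B,C) - hi(A,C), and
   0 <= i(A,B,C) <= n - dim (A n B + B n C).
   A C^1 path with regular crossings homotopic to ell exists: reparametrize ell so that
   it rests near T/2 and rotate it by e^{J g}, where g goes up and down so fast
   that all crossing forms are definite. *)
Set Implicit Arguments. Unset Strict Implicit. Unset Printing Implicit Defensive.
Import Order.TTheory GRing.Theory Num.Theory.
Import numFieldNormedType.Exports.
Local Open Scope classical_set_scope.
Local Open Scope ring_scope.

(** * Positive index of a symmetric matrix *)

Section Inertia.
Variable R : realType.

(** The obstacle is that [clm] is a choice among regular C^1 representatives, so the two indices may
    come from different paths, joined to ell by unrelated homotopies. Both are therefore pulled back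
    to frames of the one continuous path ell, over a common subdivision of [0, T], and are compared
    there interval by interval. Charts change from interval to interval because no single chart need
    contain the whole path; a single one is used only for the four Lagrangians of the final
    estimate. In the construction of a representative the rotation has to undo itself in order to
    keep the end points. Its speed then passes through zero, and no definiteness can be expected at
    that moment. The crossing forms are not controlled there; instead the path is kept away from the
    reference Lagrangian, which requires the flow to be at rest while the angle is close to its
    peak. *)

Definition qf m (S : 'M[R]_m) (x : 'rV[R]_m) : R := (x *m S *m x^T) 0 0.

Definition bf m (S : 'M[R]_m) (x y : 'rV[R]_m) : R := (x *m S *m y^T) 0 0.

Definition posdef m (S : 'M[R]_m) : Prop := forall x, x != 0 -> 0 < qf S x.

(** Sylvester's positive index as the largest size of a positive definite Gram matrix. A lower bound
    is then just a witness, and upper bounds come from a lower bound for [- S] together with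
    [posi_neg_rank]. *)
Definition posi m (S : 'M[R]_m) : nat :=
  \max_(k < m.+1 | `[< exists U : 'M[R]_(k, m), posdef (U *m S *m U^T) >]) k.

Lemma qf_conj r m (S : 'M[R]_m) (U : 'M[R]_(r, m)) x :
  qf (U *m S *m U^T) x = qf S (x *m U).
Proof. by rewrite /qf trmx_mul !mulmxA. Qed.

Lemma qf0 m (S : 'M[R]_m) : qf S 0 = 0.
Proof. by rewrite /qf !mul0mx mxE. Qed.

Lemma qfN m (S : 'M[R]_m) x : qf (- S) x = - qf S x.
Proof. by rewrite /qf mulmxN mulNmx mxE. Qed.

Lemma qfDl m (S T : 'M[R]_m) x : qf (S + T) x = qf S x + qf T x.
Proof. by rewrite /qf mulmxDr mulmxDl mxE. Qed.

Lemma bf_sym m (S : 'M[R]_m) x y : S^T = S -> bf S x y = bf S y x.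
Proof.
move=> sS; rewrite /bf -[in LHS](trmxK (_ *m y^T)) mxE.
by rewrite !trmx_mul trmxK sS mulmxA.
Qed.

Lemma qfD m (S : 'M[R]_m) x y : S^T = S ->
  qf S (x + y) = qf S x + bf S x y *+ 2 + qf S y.
Proof.
move=> sS; have b2 := bf_sym x y sS.
rewrite mulr2n {2}b2 /qf /bf linearD /= !mulmxDl !mulmxDr !mxE.
by rewrite !addrA.
Qed.

Lemma qfZ m (S : 'M[R]_m) a x : qf S (a *: x) = a ^+ 2 * qf S x.
Proof. by rewrite /qf linearZ /= -!scalemxAl -scalemxAr scalerA mxE expr2. Qed.

Lemma posdef_free r m (S : 'M[R]_m) (U : 'M[R]_(r, m)) :
  posdef (U *m S *m U^T) -> row_free U.
Proof.
move=> pU; rewrite -kermx_eq0; apply/eqP/row_matrixP => i.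
rewrite row0; apply/eqP/negP => /negP k0.
have := pU _ k0; rewrite qf_conj.
have -> : row i (kermx U) *m U = 0 by rewrite -row_mul mulmx_ker row0.
by rewrite qf0 ltxx.
Qed.

Lemma posi_ge r m (S : 'M[R]_m) (U : 'M[R]_(r, m)) :
  posdef (U *m S *m U^T) -> (r <= posi S)%N.
Proof.
move=> pU; have rm : (r < m.+1)%N.
  by rewrite ltnS -(eqP (posdef_free pU)) rank_leq_col.
by apply: (@leq_bigmax_cond _ _ (fun k : 'I_m.+1 => k : nat) (Ordinal rm));
  apply/asboolP; exists U.
Qed.

Lemma posi_wit m (S : 'M[R]_m) :
  exists U : 'M[R]_(posi S, m), posdef (U *m S *m U^T).
Proof.
pose P (k : 'I_m.+1) := `[< exists U : 'M[R]_(k, m), posdef (U *m S *m U^T) >].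
have P0 : P ord0.
  apply/asboolP; exists 0 => x h; case/negP: h.
  by apply/eqP/matrixP => i [].
have P_gt0 : (0 < #|P|)%N by apply/card_gt0P; exists ord0.
have [i Pi E] := eq_bigmax_cond (fun k : 'I_m.+1 => k : nat) P_gt0.
by rewrite /posi E; move/asboolP: Pi.
Qed.

Lemma posi_geS r m (S : 'M[R]_m) (E : 'M[R]_(r, m)) :
  (forall u : 'rV_m, (u <= E)%MS -> u != 0 -> 0 < qf S u) ->
  (\rank E <= posi S)%N.
Proof.
move=> pE; apply: (@posi_ge _ _ _ (row_base E)) => x x0.
rewrite qf_conj; apply: pE.
  by rewrite (submx_trans (submxMl _ _)) ?eq_row_base.
by rewrite mulmx_free_eq0 ?row_base_free.
Qed.

Lemma posi_sub m (S : 'M[R]_m) : exists E : 'M[R]_(posi S, m),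
  row_free E /\ forall u : 'rV_m, (u <= E)%MS -> u != 0 -> 0 < qf S u.
Proof.
have [U pU] := posi_wit S; exists U; split; first exact: posdef_free pU.
move=> u /submxP [x ->] x0; rewrite -qf_conj; apply: pU.
by apply: contraNneq x0 => ->; rewrite mul0mx.
Qed.

(** Degenerate case of Cauchy-Schwarz: q(a x + y) is affine in a and never negative, so its slope 2
    b(x, y) vanishes. *)
Lemma qf_ge0_cs m (S : 'M[R]_m) k (C : 'M[R]_(k, m)) x : S^T = S ->
  (forall u : 'rV_m, (u <= C)%MS -> 0 <= qf S u) ->
  (x <= C)%MS -> qf S x = 0 -> forall y : 'rV_m, (y <= C)%MS -> bf S x y = 0.
Proof.
move=> sS pC xC x0 y yC.
have H a : 0 <= a * bf S x y *+ 2 + qf S y.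
  have := pC (a *: x + y) (addmx_sub (scalemx_sub a xC) yC).
  by rewrite qfD // qfZ x0 mulr0 add0r /bf -!scalemxAl mxE.
have qy : 0 <= qf S y by exact: pC.
apply: contrapT => /eqP b0.
(* At this value of a the affine function equals - q(y) - 2, which is negative. *)
have := H (- (qf S y + 1) / bf S x y).
by rewrite divfK // => h; clear -h qy; lra.
Qed.

Lemma rank_kermx_mul m r (S : 'M[R]_m) (U : 'M[R]_(r, m)) :
  (m - r <= \rank (kermx (S *m U^T)))%N.
Proof. by rewrite mxrank_ker leq_sub2l // rank_leq_col. Qed.

Lemma bfDr m (S : 'M[R]_m) x y z : bf S x (y + z) = bf S x y + bf S x z.
Proof. by rewrite /bf linearD mulmxDr mxE. Qed.

Lemma bf_eq0 m (S : 'M[R]_m) x : (forall y, bf S x y = 0) -> x *m S = 0.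
Proof.
move=> H; apply/rowP => j; have := H (delta_mx 0 j).
by rewrite /bf trmx_delta -colE !mxE => ->.
Qed.

(** Sylvester's law of inertia. A relation between a positive and a negative family modulo the
    kernel produces two vectors with the same value of q, one positive and one negative, so both
    vanish. Conversely, the orthogonal complement [C] of a maximal positive [U] is negative
    semidefinite, since a positive vector in it would enlarge [U], and [U + C] is the whole
    space. *)
Lemma posi_neg_rank m (S : 'M[R]_m) : S^T = S ->
  (posi S + posi (- S))%N = \rank S.
Proof.
move=> sS; apply/eqP; rewrite eqn_leq; apply/andP; split.
  have [U pU] := posi_wit S; have [N pN] := posi_wit (- S).
  suff f : row_free (col_mx U N *m S).
    by move/eqP: f => <-; exact: mxrankM_maxr.
  rewrite -kermx_eq0; apply/eqP/row_matrixP => i; rewrite row0.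
  set x := row i _.
  have x0 : x *m (col_mx U N *m S) = 0 by rewrite -row_mul mulmx_ker row0.
  rewrite -(hsubmxK x) mulmxA mul_row_col mulmxDl in x0.
  set u := lsubmx x in x0; set v := rsubmx x in x0.
  have E1 : u *m U *m S = - (v *m N *m S) by apply/eqP; rewrite -addr_eq0 x0.
  have E2 : qf S (u *m U) = qf S (v *m N).
    have h1 : qf S (u *m U) = - bf S (v *m N) (u *m U).
      by rewrite /qf E1 mulNmx mxE.
    have h2 : qf S (v *m N) = - bf S (u *m U) (v *m N).
      by rewrite /bf E1 mulNmx [in RHS]mxE opprK.
    by rewrite h1 h2 bf_sym.
  have u0 : u = 0.
    apply: contrapT => /eqP u0; have := pU _ u0; rewrite qf_conj E2.
    have [v0|v0] := eqVneq v 0; first by rewrite v0 mul0mx qf0 ltxx.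
    by move=> h; have := pN _ v0; rewrite qf_conj qfN oppr_gt0 ltNge ltW.
  have v0 : v = 0.
    apply: contrapT => /eqP v0; have := pN _ v0; rewrite qf_conj qfN -E2 u0.
    by rewrite mul0mx qf0 oppr0 ltxx.
  by rewrite -(hsubmxK x) -/u -/v u0 v0 row_mx0.
have [U pU] := posi_wit S; set p := posi S in U pU *.
have frU := posdef_free pU.
pose C := kermx (S *m U^T).
have CP (x : 'rV_m) : (x <= C)%MS -> x *m S *m U^T = 0.
  by move/sub_kermxP; rewrite mulmxA.
have Cneg x : (x <= C)%MS -> qf S x <= 0.
  move=> xC; rewrite leNgt; apply/negP => xp.
  suff : (p + 1 <= posi S)%N by rewrite -/p addn1 ltnn.
  apply: (@posi_ge _ _ _ (col_mx U x)) => z z0.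
  rewrite qf_conj -(hsubmxK z) mul_row_col; set u := lsubmx z; set a := rsubmx z.
  have -> : a *m x = a 0 0 *: x.
    by apply/rowP => j; rewrite mxE big_ord1 [RHS]mxE.
  rewrite qfD // qfZ bf_sym // /bf -scalemxAl -scalemxAl trmx_mul mulmxA CP //.
  rewrite mul0mx scaler0 mxE mul0rn addr0 -qf_conj.
  have [u0|u0] := eqVneq u 0; last first.
    by apply: ltr_wpDr; [rewrite mulr_ge0 ?sqr_ge0 ?ltW|exact: pU].
  rewrite u0 qf0 add0r mulr_gt0 // exprn_even_gt0 //=.
  apply: contra z0 => /eqP a0; rewrite -(hsubmxK z) -/u -/a u0.
  by apply/eqP; rewrite [a]mx11_scalar a0 -scalemx1 scale0r row_mx0.
have UC : (U + C :=: 1%:M)%MS.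
  apply/eqmxP/andP; split; first exact: submx1.
  have d : (U :&: C)%MS = 0.
    apply/eqP/rowV0P => v; rewrite sub_capmx => /andP [/submxP [y ->] /CP h].
    have [->|y0] := eqVneq y 0; first by rewrite mul0mx.
    have := pU _ y0; rewrite qf_conj /qf trmx_mul mulmxA h mul0mx mxE ltxx //.
  rewrite sub1mx /row_full eqn_leq rank_leq_col mxrank_disjoint_sum //.
  by rewrite (eqP frU); have := rank_kermx_mul S U; rewrite -/C -/p; clear; lia.
pose K := kermx S.
have KC : (K <= C)%MS by apply/sub_kermxP; rewrite mulmxA mulmx_ker mul0mx.
(* On a complement of the kernel in [C] the form is negative definite: an isotropic vector of [C] is
   orthogonal to [C] by semidefiniteness and to [U] by construction, hence lies in the kernel. *)
have D : (\rank (C :\: K)%MS <= posi (- S))%N.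
  apply: posi_geS => x xD x0.
  have xC : (x <= C)%MS by apply: submx_trans xD (diffmxSl _ _).
  rewrite qfN oppr_gt0 lt_neqAle Cneg // andbT.
  apply: contra x0 => /eqP q0.
  suff xS : x *m S = 0.
    have : (x <= (C :\: K) :&: K)%MS by rewrite sub_capmx xD; apply/sub_kermxP.
    by rewrite capmx_diff submx0.
  apply: bf_eq0 => y; have : (y <= U + C)%MS by rewrite UC submx1.
  case/sub_addsmxP => -[a b] /= ->; rewrite bfDr.
  have -> : bf S x (a *m U) = 0 by rewrite /bf trmx_mul mulmxA CP // mul0mx mxE.
  rewrite add0r; apply/eqP; rewrite -oppr_eq0; apply/eqP.
  have -> : - bf S x (b *m C) = bf (- S) x (b *m C).
    by rewrite /bf mulmxN mulNmx [in RHS]mxE.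
  apply: (@qf_ge0_cs _ _ _ C); rewrite ?submxMl //.
  - by rewrite linearN /= sS.
  - by move=> u uC; rewrite qfN oppr_ge0 Cneg.
  - by rewrite qfN q0 oppr0.
have := mxrank_cap_compl C K; rewrite (capmx_idPr KC) mxrank_ker.
have := rank_kermx_mul S U; rewrite -/C.
have := rank_leq_row S; lia.
Qed.

Lemma posi_conj_le m r (S : 'M[R]_m) (E : 'M[R]_(r, m)) :
  (posi (E *m S *m E^T) <= posi S)%N.
Proof.
have [U pU] := posi_wit (E *m S *m E^T).
by apply: (@posi_ge _ _ _ (U *m E)); rewrite trmx_mul !mulmxA in pU *.
Qed.

Lemma posi_conj m (S E : 'M[R]_m) : E \in unitmx -> posi (E *m S *m E^T) = posi S.
Proof.
move=> uE; apply/eqP; rewrite eqn_leq posi_conj_le /=.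
have := posi_conj_le (E *m S *m E^T) (invmx E).
by rewrite trmx_inv !mulmxA mulVmx // mul1mx mulmxK ?unitmx_tr.
Qed.

(** Stacking witnesses gives one inequality, for [S], [T] and also for their negatives; since ranks
    add, neither inequality can be strict. *)
Lemma posi_block m1 m2 (S : 'M[R]_m1) (T : 'M[R]_m2) : S^T = S -> T^T = T ->
  posi (block_mx S 0 0 T) = (posi S + posi T)%N.
Proof.
move=> sS sT.
have H (S' : 'M[R]_m1) (T' : 'M[R]_m2) :
    (posi S' + posi T' <= posi (block_mx S' 0 0 T'))%N.
  have [U pU] := posi_wit S'; have [V pV] := posi_wit T'.
  apply: (@posi_ge _ _ _ (block_mx U 0 0 V)) => x x0.
  rewrite qf_conj -(hsubmxK x) mul_row_block !mulmx0 addr0 add0r.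
  rewrite /qf mul_row_block !mulmx0 addr0 add0r tr_row_mx mul_row_col mxE.
  rewrite -/(qf S' (lsubmx x *m U)) -/(qf T' (rsubmx x *m V)) -!qf_conj.
  have [u0|u0] := eqVneq (lsubmx x) 0; have [v0|v0] := eqVneq (rsubmx x) 0.
  - by case/negP: x0; rewrite -(hsubmxK x) u0 v0 row_mx0.
  - by rewrite u0 qf0 add0r pV.
  - by rewrite v0 qf0 addr0 pU.
  - by rewrite addr_gt0 ?pU ?pV.
have sB : (block_mx S 0 0 T)^T = block_mx S 0 0 T.
  by rewrite tr_block_mx sS sT !trmx0.
have := posi_neg_rank sB; rewrite opp_block_mx !oppr0 rank_diag_block_mx.
rewrite -(posi_neg_rank sS) -(posi_neg_rank sT).
have := H S T; have := H (- S) (- T).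
set A := posi (block_mx (- S) _ _ _); set B := posi (block_mx S _ _ _).
clear; lia.
Qed.

(** A maximal positive space of a plus the kernel of a is a space on which a is nonnegative and
    vanishes only on its kernel; likewise for b. On the intersection of these two spaces a + b is
    nonnegative and vanishes only on the common kernel, so a complement of that kernel is positive
    for a + b. The rest is counting dimensions. *)
Lemma posi_add_ub m (a b : 'M[R]_m) : a^T = a -> b^T = b ->
  (posi a + posi b + \rank (kermx a + kermx b)%MS <= m + posi (a + b)%R)%N.
Proof.
move=> sa sb.
have H (S : 'M[R]_m) : S^T = S -> exists E : 'M[R]_m,
    [/\ \rank E = (posi S + \rank (kermx S))%N, (kermx S <= E)%MS,
        forall u : 'rV_m, (u <= E)%MS -> 0 <= qf S u &
        forall u : 'rV_m, (u <= E)%MS -> qf S u = 0 -> (u <= kermx S)%MS].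
  move=> sS; have [P [frP pP]] := posi_sub S.
  have dec (u : 'rV_m) : (u <= P + kermx S)%MS -> exists v k : 'rV_m,
      [/\ u = v + k, (v <= P)%MS, (k <= kermx S)%MS & qf S u = qf S v].
    case/sub_addsmxP => -[x y] /= ->; exists (x *m P), (y *m kermx S).
    have k0 : y *m kermx S *m S = 0 by rewrite -mulmxA mulmx_ker mulmx0.
    split => //; rewrite ?submxMl // qfD // bf_sym //.
    have -> : bf S (y *m kermx S) (x *m P) = 0 by rewrite /bf k0 mul0mx mxE.
    have -> : qf S (y *m kermx S) = 0 by rewrite /qf k0 mul0mx mxE.
    by rewrite mul0rn !addr0.
  exists (P + kermx S)%MS; split.
  - rewrite mxrank_disjoint_sum ?(eqP frP) //.
    apply/eqP/rowV0P => v; rewrite sub_capmx => /andP [vP /sub_kermxP vK].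
    apply: contrapT => /eqP v0; have := pP _ vP v0.
    by rewrite /qf vK mul0mx mxE ltxx.
  - exact: addsmxSr.
  - move=> u /dec [v [k [_ vP _ ->]]].
    have [->|v0] := eqVneq v 0; first by rewrite qf0.
    exact/ltW/pP.
  - move=> u /dec [v [k [-> vP kK ->]]] q0.
    have [->|v0] := eqVneq v 0; first by rewrite add0r.
    by have := pP _ vP v0; rewrite q0 ltxx.
have [Ea [ra ka pa za]] := H a sa; have [Eb [rb kb pb zb]] := H b sb.
pose K := (kermx a :&: kermx b)%MS; pose E := (Ea :&: Eb)%MS.
have KE : (K <= E)%MS by rewrite capmxS.
have D : (\rank (E :\: K)%MS <= posi (a + b)%R)%N.
  apply: posi_geS => x xD x0.
  have : (x <= E)%MS by apply: submx_trans xD (diffmxSl _ _).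
  rewrite sub_capmx => /andP [xa xb]; rewrite qfDl.
  have := pa _ xa; have := pb _ xb.
  have [qa|qa] := eqVneq (qf a x) 0; last first.
    by move=> qb0 qa0; apply: ltr_wpDr => //; rewrite lt_neqAle eq_sym qa.
  have [qb|qb] := eqVneq (qf b x) 0; last first.
    by move=> qb0 qa0; apply: ltr_wpDl => //; rewrite lt_neqAle eq_sym qb.
  case/negP: x0; rewrite -submx0 -(capmx_diff E K) sub_capmx xD /=.
  by rewrite sub_capmx za ?zb.
have := mxrank_cap_compl E K; rewrite (capmx_idPr KE).
have := mxrank_sum_cap Ea Eb; have := mxrank_sum_cap (kermx a) (kermx b).
rewrite -/K -/E; have := rank_leq_col (Ea + Eb)%MS; lia.
Qed.

(** The preceding bound for the decomposition a = (a + b) + (- b), where only the kernel of b is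
    kept from the sum of kernels and [posi (- b)] plus its dimension is m - [posi b]. *)
Lemma posi_add m (a b : 'M[R]_m) : a^T = a -> b^T = b ->
  (posi (a + b)%R <= posi a + posi b)%N.
Proof.
move=> sa sb.
have sN : (- b)^T = - b by rewrite linearN /= sb.
have sD : (a + b)^T = a + b by rewrite linearD /= sa sb.
have := posi_add_ub sD sN; rewrite addrK.
have := posi_neg_rank sb.
have : (\rank (kermx (- b)) <= \rank (kermx (a + b) + kermx (- b)))%N.
  exact/mxrankS/addsmxSr.
rewrite mxrank_ker mxrank_opp; have := rank_leq_row b; lia.
Qed.

End Inertia.

Lemma near_impl (T : Type) (F : set_system T) {FF : Filter F} (P Q : set T) :
  F P -> (forall x, P x -> Q x) -> F Q.
Proof. by move=> FP PQ; apply: filterS FP. Qed.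

(** * Entrywise limits of matrices along a filter *)

Section MatrixLimits.
Variable R : realType.

(** Entrywise, as are the regularity conditions in [C1_lagr_frame] and [homotopic_rel]; products,
    determinants and inverses then reduce to limits of sums, products and quotients of scalars. *)
Definition mcvg (T : Type) (F : set_system T) m n (A : T -> 'M[R]_(m, n))
  (A0 : 'M[R]_(m, n)) : Prop := forall i j, A x i j @[x --> F] --> A0 i j.

Context (T : Type) (F : set_system T) {FF : Filter F}.

Lemma cvg_bigsum (I : Type) (r : seq I) (f : I -> T -> R) (l : I -> R) :
  (forall i, f i x @[x --> F] --> l i) ->
  (\sum_(i <- r) f i x) @[x --> F] --> \sum_(i <- r) l i.
Proof.
move=> H; elim: r => [|a r IH].
  rewrite big_nil; under eq_fun do rewrite big_nil; exact: cvg_cst.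
rewrite big_cons; under eq_fun do rewrite big_cons; exact: cvgD.
Qed.

Lemma cvg_bigprod (I : Type) (r : seq I) (f : I -> T -> R) (l : I -> R) :
  (forall i, f i x @[x --> F] --> l i) ->
  (\prod_(i <- r) f i x) @[x --> F] --> \prod_(i <- r) l i.
Proof.
move=> H; elim: r => [|a r IH].
  rewrite big_nil; under eq_fun do rewrite big_nil; exact: cvg_cst.
rewrite big_cons; under eq_fun do rewrite big_cons; exact: cvgM.
Qed.

Lemma mcvg_cst m n (A : 'M[R]_(m, n)) : mcvg F (fun=> A) A.
Proof. by move=> i j; exact: cvg_cst. Qed.

Lemma mcvg_mul m n p (A : T -> 'M[R]_(m, n)) (B : T -> 'M[R]_(n, p)) A0 B0 :
  mcvg F A A0 -> mcvg F B B0 -> mcvg F (fun x => A x *m B x) (A0 *m B0).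
Proof.
move=> hA hB i j; rewrite mxE; under eq_fun do rewrite mxE.
by apply: cvg_bigsum => k; apply: cvgM.
Qed.

Lemma mcvg_tr m n (A : T -> 'M[R]_(m, n)) A0 :
  mcvg F A A0 -> mcvg F (fun x => (A x)^T) A0^T.
Proof. by move=> hA i j; rewrite mxE; under eq_fun do rewrite mxE; exact: hA. Qed.

Lemma mcvg_add m n (A B : T -> 'M[R]_(m, n)) A0 B0 :
  mcvg F A A0 -> mcvg F B B0 -> mcvg F (fun x => A x + B x) (A0 + B0).
Proof.
by move=> hA hB i j; rewrite mxE; under eq_fun do rewrite mxE; exact: cvgD.
Qed.

Lemma mcvg_opp m n (A : T -> 'M[R]_(m, n)) A0 :
  mcvg F A A0 -> mcvg F (fun x => - A x) (- A0).
Proof.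
by move=> hA i j; rewrite mxE; under eq_fun do rewrite mxE; exact: cvgN.
Qed.

Lemma mcvg_scale m n (a : T -> R) (A : T -> 'M[R]_(m, n)) (a0 : R) A0 :
  a x @[x --> F] --> a0 -> mcvg F A A0 -> mcvg F (fun x => a x *: A x) (a0 *: A0).
Proof.
by move=> ha hA i j; rewrite mxE; under eq_fun do rewrite mxE; exact: cvgM.
Qed.

Lemma mcvg_block m1 m2 n1 n2 (A : T -> 'M[R]_(m1, n1)) (B : T -> 'M[R]_(m1, n2))
    (C : T -> 'M[R]_(m2, n1)) (D : T -> 'M[R]_(m2, n2)) A0 B0 C0 D0 :
  mcvg F A A0 -> mcvg F B B0 -> mcvg F C C0 -> mcvg F D D0 ->
  mcvg F (fun x => block_mx (A x) (B x) (C x) (D x)) (block_mx A0 B0 C0 D0).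
Proof.
move=> hA hB hC hD i j; case: (split_ordP i) => k ->; case: (split_ordP j) => l ->;
 rewrite ?(block_mxEul, block_mxEur, block_mxEdl, block_mxEdr);
 under eq_fun do rewrite ?(block_mxEul, block_mxEur, block_mxEdl, block_mxEdr);
 [exact: hA|exact: hB|exact: hC|exact: hD].
Qed.

Lemma cvg_det n (A : T -> 'M[R]_n) A0 :
  mcvg F A A0 -> \det (A x) @[x --> F] --> \det A0.
Proof.
move=> hA; rewrite /determinant; apply: cvg_bigsum => s.
by apply: cvgM; [exact: cvg_cst|apply: cvg_bigprod => i; exact: hA].
Qed.

Lemma unitmx_near n (A : T -> 'M[R]_n) A0 : mcvg F A A0 -> A0 \in unitmx ->
  \forall x \near F, A x \in unitmx.
Proof.
move=> hA; rewrite unitmxE unitfE => d0.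
apply: near_impl (cvgr_neq0 _ (cvg_det hA) d0) _ => x dx.
by rewrite unitmxE unitfE.
Qed.

Lemma mcvg_inv n (A : T -> 'M[R]_n) A0 : mcvg F A A0 -> A0 \in unitmx ->
  mcvg F (fun x => invmx (A x)) (invmx A0).
Proof.
move=> hA uA i j.
have E : (fun x => (\det (A x))^-1 * (\adj (A x)) i j) @ F --> invmx A0 i j.
  rewrite /invmx uA mxE; apply: cvgM.
    by apply: cvgV; [rewrite -unitfE -unitmxE|exact: cvg_det].
  rewrite mxE; under eq_fun do rewrite mxE.
  apply: cvgM; first exact: cvg_cst.
  apply: cvg_det => k l; rewrite !mxE; under eq_fun do rewrite !mxE.
  exact: hA.
(* [invmx] returns its argument off the invertible matrices, so the adjugate formula is only an
   eventual equality. *)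
apply: cvg_trans E; apply: near_eq_cvg; near=> x.
have ux : A x \in unitmx by near: x; exact: unitmx_near hA uA.
by rewrite /invmx ux [RHS]mxE.
Unshelve. all: by end_near.
Qed.

End MatrixLimits.

(** * Openness of positive definiteness *)

Section Semicontinuity.
Variable R : realType.
Context (T : Type) (F : set_system T) {FF : Filter F}.

(** Each unit vector has a neighbourhood on which q stays positive for all matrices near the limit;
    compactness of the sphere makes this uniform, and homogeneity carries it to all nonzero
    vectors. *)
Lemma posdef_near r (S : T -> 'M[R]_r) S0 :
  mcvg F S S0 -> posdef S0 ->
  \forall x \near F, posdef (S x).
Proof.
move=> hS pS; pose K : set 'rV[R]_r := [set x | `|x| = 1].
have cK : compact K.
  apply: bounded_closed_compact.
    exists 1; split => // M M1 x /= ->; exact: ltW.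
  have -> : K = (fun x : 'rV[R]_r => `|x|) @^-1` [set 1] by [].
  apply: preimage_closed; last exact: closed_eq.
  by move=> x _; exact: norm_continuous.
have H := (compact_near_coveringP K).1 cK.
have := H T F (fun i x => 0 < qf (S i) x) FF; move=> /(_ _)/wrap[].
  move=> x /= xK; have x0 : x != 0.
    by apply: contra_eq_neq xK => ->; rewrite normr0 eq_sym oner_neq0.
  have C : (fun y : 'rV[R]_r * T => qf (S y.2) y.1) @ (filter_prod (nbhs x) F)
      --> qf S0 x.
    have cx : mcvg (filter_prod (nbhs x) F) (fun y : 'rV[R]_r * T => y.1) x.
      move=> i j; apply: (@cvg_comp _ _ _ fst (fun M : 'rV[R]_r => M i j)).
        exact: cvg_fst.
      exact: coord_continuous.
    have cS : mcvg (filter_prod (nbhs x) F) (fun y : 'rV[R]_r * T => S y.2) S0.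
      move=> i j; apply: (@cvg_comp _ _ _ snd (fun y => S y i j)).
        exact: cvg_snd.
      exact: hS.
    exact: (mcvg_mul (mcvg_mul cx cS) (mcvg_tr cx)).
  exact: cvgr_gt C _ (pS _ x0).
move=> H'; apply: near_impl H' _ => i Hi x x0.
have n0 : `|x| != 0 by rewrite normr_eq0.
have := Hi (`|x|^-1 *: x); rewrite qfZ => /(_ _)/wrap[].
  by rewrite /K /= normrZ normfV normr_id mulVf.
by rewrite pmulr_rgt0 // exprn_even_gt0 //= invr_eq0.
Qed.

End Semicontinuity.

(** * Semicontinuity and jumps of the positive index *)

Section Jumps.
Variable R : realType.

Lemma posi_near (T : Type) (F : set_system T) {FF : Filter F} m
  (S : T -> 'M[R]_m) S0 :
  mcvg F S S0 -> \forall x \near F, (posi S0 <= posi (S x))%N.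
Proof.
move=> hS; have [U pU] := posi_wit S0.
have h : mcvg F (fun x => U *m S x *m U^T) (U *m S0 *m U^T).
  by apply: mcvg_mul; [apply: mcvg_mul => //|]; exact: mcvg_cst.
by apply: near_impl (posdef_near h pU) _ => x; exact: posi_ge.
Qed.

(** Neither [posi S] nor [posi (- S)] can drop in the limit neighbourhood, and their sum is the
    rank, which is constant there. *)
Lemma posi_near_eq (T : Type) (F : set_system T) {FF : Filter F} m
  (S : T -> 'M[R]_m) S0 : mcvg F S S0 -> S0^T = S0 ->
  (\forall x \near F, (S x)^T = S x /\ \rank (S x) = \rank S0) ->
  \forall x \near F, posi (S x) = posi S0.
Proof.
move=> hS s0 H; near=> x.
have [sx rx] : (S x)^T = S x /\ \rank (S x) = \rank S0 by near: x.
have h1 : (posi S0 <= posi (S x))%N by near: x; exact: posi_near.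
have h2 : (posi (- S0)%R <= posi (- S x)%R)%N.
  by near: x; apply: posi_near; exact: mcvg_opp.
have := posi_neg_rank sx; have := posi_neg_rank s0; rewrite rx.
by clear -h1 h2; lia.
Unshelve. all: by end_near.
Qed.

Lemma posi_crossing_ge m r (S : R -> 'M[R]_m) S0 D (k : 'M[R]_(r, m)) :
  S0^T = S0 -> mcvg 0^'+ S S0 ->
  mcvg 0^'+ (fun s => s^-1 *: (S s - S0)) D -> k *m S0 = 0 ->
  \forall s \near 0^'+, (posi S0 + posi (k *m D *m k^T) <= posi (S s))%N.
Proof.
move=> s0 hS hD k0; have [U pU] := posi_wit S0.
have [V pV] := posi_wit (k *m D *m k^T).
set p := posi S0 in U pU *; set q := posi _ in V pV *.
pose W := V *m k.
have W0 : W *m S0 = 0 by rewrite /W -mulmxA k0 mulmx0.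
have W0' : S0 *m W^T = 0.
  by apply: trmx_inj; rewrite trmx_mul trmxK s0 W0 trmx0.
(* Scaling the kernel directions by s^(-1/2) makes the Gram matrix converge. *)
pose a (s : R) := (Num.sqrt s)^-1.
pose G s := block_mx (U *m S s *m U^T) (a s *: (U *m S s *m W^T))
                (a s *: (W *m S s *m U^T)) (W *m (s^-1 *: (S s - S0)) *m W^T).
have sq0 : (Num.sqrt s : R) @[s --> 0^'+] --> (0 : R).
  rewrite -[X in _ --> X]sqrtr0; apply: cvg_at_right_filter.
  exact: sqrt_continuous.
have hG : mcvg 0^'+ G (block_mx (U *m S0 *m U^T) 0 0 (W *m D *m W^T)).
  (* Because [W *m S0 = 0], each mixed block is sqrt s times a convergent difference quotient and
     tends to zero. *)
  have E : forall s, 0 < s -> a s = Num.sqrt s * s^-1.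
    move=> s s_gt0; have n0 : Num.sqrt s != 0 by rewrite sqrtr_eq0 -ltNge.
    apply: (mulIf n0); rewrite /a mulVf // mulrAC -expr2 sqr_sqrtr ?ltW //.
    by rewrite mulfV // gt_eqF.
  apply: mcvg_block.
  - by apply: mcvg_mul; [apply: mcvg_mul => //|]; exact: mcvg_cst.
  - have h : mcvg 0^'+ (fun s => Num.sqrt s *: (U *m (s^-1 *: (S s - S0)) *m W^T)) 0.
      rewrite -(scale0r (U *m D *m W^T)); apply: mcvg_scale => //.
      by apply: mcvg_mul; [apply: mcvg_mul => //|]; exact: mcvg_cst.
    move=> i j; apply: cvg_trans (h i j); apply: near_eq_cvg; near=> s.
    have s_gt0 : 0 < s by near: s; exact: nbhs_right_gt.
    rewrite E // -scalemxAr -scalemxAl scalerA mulmxBr mulmxBl -(mulmxA U S0).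
    by rewrite W0' mulmx0 subr0.
  - have h : mcvg 0^'+ (fun s => Num.sqrt s *: (W *m (s^-1 *: (S s - S0)) *m U^T)) 0.
      rewrite -(scale0r (W *m D *m U^T)); apply: mcvg_scale => //.
      by apply: mcvg_mul; [apply: mcvg_mul => //|]; exact: mcvg_cst.
    move=> i j; apply: cvg_trans (h i j); apply: near_eq_cvg; near=> s.
    have s_gt0 : 0 < s by near: s; exact: nbhs_right_gt.
    by rewrite E // -scalemxAr -scalemxAl scalerA mulmxBr mulmxBl W0 mul0mx subr0.
  - by apply: mcvg_mul; [apply: mcvg_mul => //|]; exact: mcvg_cst.
have pG : posdef (block_mx (U *m S0 *m U^T) 0 0 (W *m D *m W^T)).
  move=> x x0; rewrite /qf -(hsubmxK x) mul_row_block !mulmx0 addr0 add0r.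
  rewrite tr_row_mx mul_row_col mxE.
  rewrite -/(qf (U *m S0 *m U^T) _) -/(qf (W *m D *m W^T) _).
  have -> : W *m D *m W^T = V *m (k *m D *m k^T) *m V^T.
    by rewrite /W trmx_mul !mulmxA.
  have [u0|u0] := eqVneq (lsubmx x) 0; have [v0|v0] := eqVneq (rsubmx x) 0.
  - by case/negP: x0; rewrite -(hsubmxK x) u0 v0 row_mx0.
  - by rewrite u0 qf0 add0r pV.
  - by rewrite v0 qf0 addr0 pU.
  - by rewrite addr_gt0 ?pU ?pV.
near=> s; have s_gt0 : 0 < s by near: s; exact: nbhs_right_gt.
have as2 : a s * a s = s^-1 by rewrite /a -invfM -expr2 sqr_sqrtr ?ltW.
apply: (@posi_ge _ _ _ _ (col_mx U (a s *: W))).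
suff -> : col_mx U (a s *: W) *m S s *m (col_mx U (a s *: W))^T = G s.
  by near: s; exact: posdef_near hG pG.
rewrite tr_col_mx mul_col_mx mul_col_row /G linearZ /= -!scalemxAr -!scalemxAl.
by rewrite scalerA as2 mulmxBr mulmxBl W0 mul0mx subr0.
Unshelve. all: by end_near.
Qed.

(** The lower bounds for [S] and for [- S] add up to rank S0 + r = m when the form on the kernel is
    invertible. The rank cannot exceed m, so both bounds are attained and the rank is full. *)
Lemma posi_crossing m r (S : R -> 'M[R]_m) S0 D (k : 'M[R]_(r, m)) :
  S0^T = S0 -> (\forall s \near 0^'+, (S s)^T = S s) -> D^T = D ->
  mcvg 0^'+ S S0 -> mcvg 0^'+ (fun s => s^-1 *: (S s - S0)) D ->
  k *m S0 = 0 -> (r + \rank S0)%N = m -> k *m D *m k^T \in unitmx ->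
  \forall s \near 0^'+,
    posi (S s) = (posi S0 + posi (k *m D *m k^T)%R)%N /\ \rank (S s) = m.
Proof.
move=> s0 sS sD hS hD k0 rm uk.
have hD' : mcvg 0^'+ (fun s => s^-1 *: (- S s - - S0)) (- D).
  have h : mcvg 0^'+ (fun s => - (s^-1 *: (S s - S0))) (- D) by exact: mcvg_opp.
  move=> i j; apply: cvg_trans (h i j); apply: near_eq_cvg; near=> s.
  by rewrite -opprD scalerN.
have hS' : mcvg 0^'+ (fun s => - S s) (- S0) by exact: mcvg_opp.
have sN : (- S0)^T = - S0 by rewrite linearN /= s0.
have kN : k *m (- S0) = 0 by rewrite mulmxN k0 oppr0.
near=> s.
have h1 : (posi S0 + posi (k *m D *m k^T) <= posi (S s))%N.
  by near: s; exact: posi_crossing_ge.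
have h2 : (posi (- S0)%R + posi (k *m (- D) *m k^T)%R <= posi (- S s)%R)%N.
  by near: s; exact: posi_crossing_ge sN hS' hD' kN.
have ss : (S s)^T = S s by near: s.
rewrite mulmxN mulNmx in h2.
have sk : (k *m D *m k^T)^T = k *m D *m k^T by rewrite !trmx_mul trmxK sD mulmxA.
have A (p q p0 q0 pk qk r0 rs : nat) : (p0 + pk <= p)%N -> (q0 + qk <= q)%N ->
    (p0 + q0)%N = r0 -> (p + q)%N = rs -> (pk + qk)%N = r -> (rs <= m)%N ->
    (r + r0)%N = m -> p = (p0 + pk)%N /\ rs = m by clear; lia.
apply: A h1 h2 (posi_neg_rank s0) (posi_neg_rank ss) _ (rank_leq_row _) rm.
by rewrite (posi_neg_rank sk) mxrank_unit.
Unshelve. all: by end_near.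
Qed.

End Jumps.

(** * Lagrangian frames and charts *)

Section LagrangianFrames.
Variables (R : realType) (n : nat).
Local Notation frame := 'M[R]_(n, n + n).

(** Gram matrix of [omega] on row vectors; it equals [- J0]. *)
Definition Om : 'M[R]_(n + n) := block_mx 0 1%:M (- 1%:M) 0.

Lemma tr_Om : Om^T = - Om.
Proof. by rewrite tr_block_mx opp_block_mx linearN /= !trmx0 trmx1 opprK oppr0. Qed.

Lemma Om_Om : Om *m Om = - 1%:M.
Proof.
rewrite mulmx_block !mul0mx !mulmx0 !add0r !addr0 mulmx1 mul1mx.
rewrite (@scalar_mx_block _ n n 1) opp_block_mx.
by rewrite !oppr0.
Qed.

Lemma Om_unit : Om \in unitmx.
Proof.
by apply: (proj1 (@mulmx1_unit _ _ Om (- Om) _)); rewrite mulmxN Om_Om opprK.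
Qed.

Lemma omegaE (u v : 'rV[R]_(n + n)) : omega u v = (u *m Om *m v^T) 0 0.
Proof.
rewrite /omega -[in RHS](hsubmxK u) -[in RHS](hsubmxK v) /Om mul_row_block.
rewrite !mulmx0 !add0r addr0 mulmx1 mulmxN mulmx1 tr_row_mx mul_row_col mulNmx.
by rewrite addrC [RHS]mxE [X in _ = X + _]mxE.
Qed.

(** Frames with exactly n independent rows, so that the pairing of two Lagrangians is a square
    matrix and transversality is its invertibility. *)
Definition lagr (F : frame) : Prop := row_free F /\ F *m Om *m F^T = 0.

Lemma lagrangian_frame m (L : 'M[R]_(m, n + n)) : lagrangian L ->
  exists F : frame, lagr F /\ (F :=: L)%MS.
Proof.
case=> rL oL; pose F : frame := castmx (rL, erefl _) (row_base L).
have FL : (F :=: L)%MS by apply: eqmx_trans (eqmx_cast _ _) (eq_row_base _).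
exists F; split => //; split; first by rewrite /row_free FL rL.
apply/matrixP => i j; rewrite [RHS]mxE.
have /oL : (row i F <= L)%MS by rewrite -FL row_sub.
move=> /(_ (row j F)) H; have {}H : omega (row i F) (row j F) = 0.
  by apply: H; rewrite -FL row_sub.
rewrite -H omegaE tr_row -!row_mul.
by rewrite !mxE; apply: eq_bigr => k _; rewrite !mxE.
Qed.

Lemma lagr_lagrangian (F : frame) : lagr F -> lagrangian F.
Proof.
case=> fF oF; split; first exact/eqP.
move=> u v /submxP [x ->] /submxP [y ->]; rewrite omegaE trmx_mul.
by rewrite mulmxA -(mulmxA x) -(mulmxA x) oF mulmx0 mul0mx mxE.
Qed.

(** A Lagrangian is contained in its omega-orthogonal, which also has dimension n. *)
Lemma lagr_ortho (F : frame) k (u : 'M[R]_(k, n + n)) : lagr F ->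
  u *m Om *m F^T = 0 -> (u <= F)%MS.
Proof.
move=> [fF oF] /eqP u0.
have FK : (F <= kermx (Om *m F^T))%MS by apply/sub_kermxP; rewrite mulmxA.
have rK : \rank (kermx (Om *m F^T)) = n.
  rewrite mxrank_ker -mxrank_tr trmx_mul trmxK mxrankMfree ?(eqP fF) ?addnK //.
  by rewrite row_free_unit unitmx_tr Om_unit.
have /eqmxP E : (F == kermx (Om *m F^T))%MS.
  by rewrite -(geq_leqif (mxrank_leqif_eq FK)) rK (eqP fF).
by rewrite E; apply/sub_kermxP; rewrite mulmxA; apply/eqP.
Qed.

End LagrangianFrames.

(** * Affine charts of the Lagrangian Grassmannian *)

Section Charts.
Variables (R : realType) (n : nat).
Local Notation frame := 'M[R]_(n, n + n).
Local Notation Om := (Om R n).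
Implicit Types F G H Y : frame.

Lemma row_sq_eq0 m (z : 'rV[R]_m) : (z *m z^T) 0 0 = 0 -> z = 0.
Proof.
move=> /eqP; rewrite mxE psumr_eq0 => [/allP H|j _].
  apply/rowP => j; have := H j (mem_index_enum _).
  by rewrite [z^T _ _]mxE -expr2 sqrf_eq0 [RHS]mxE => /eqP.
by rewrite [z^T _ _]mxE -expr2 sqr_ge0.
Qed.

Definition trans F Y : bool := F *m Om *m Y^T \in unitmx.

Lemma trOmM k l (A : 'M[R]_(k, n + n)) (B : 'M[R]_(l, n + n)) :
  (A *m Om *m B^T)^T = - (B *m Om *m A^T).
Proof. by rewrite !trmx_mul trmxK tr_Om mulNmx mulmxN mulmxA. Qed.

Lemma trans_sym F Y : trans F Y = trans Y F.
Proof. by rewrite /trans -unitmx_tr trOmM -scaleN1r unitmxZ // unitrN1. Qed.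

Lemma trans_capP F Y : lagr F -> lagr Y -> reflect (\rank (F :&: Y)%MS = 0%N) (trans F Y).
Proof.
move=> lF lY; apply: (iffP idP) => [uFY|r0].
  apply/eqP; rewrite mxrank_eq0; apply/rowV0P => v.
  rewrite sub_capmx => /andP [/submxP [x ->] /submxP [y xy]].
  have : x *m (F *m Om *m Y^T) = 0.
    by rewrite !mulmxA xy -(mulmxA _ _ Y^T) -mulmxA (mulmxA Y) lY.2 mulmx0.
  by move/(congr1 (mulmx^~ (invmx (F *m Om *m Y^T)))); rewrite mulmxK // mul0mx
    => ->; rewrite mul0mx.
rewrite /trans -row_free_unit -kermx_eq0; apply/eqP/row_matrixP => i.
rewrite row0; set x := row i _.
have x0 : x *m F *m Om *m Y^T = 0.
  by rewrite -2!(mulmxA x) -row_mul mulmx_ker row0.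
have xY := lagr_ortho lY x0.
have : (x *m F <= F :&: Y)%MS by rewrite sub_capmx submxMl.
move/eqP: r0; rewrite mxrank_eq0 => /eqP ->; rewrite submx0.
by rewrite mulmx_free_eq0 ?lF.1 // => /eqP.
Qed.

(* The frame of F whose omega-pairing with Y is the identity. In the affine chart
   of Lagrangians transversal to Y, F is a symmetric matrix A_F, and pr Y F G below
   is A_F - A_G. *)
Definition nf Y F : frame := invmx (F *m Om *m Y^T) *m F.

Lemma nf_eqmx Y F : trans F Y -> (nf Y F :=: F)%MS.
Proof. by move=> u; apply: eqmxMfull; rewrite row_full_unit unitmx_inv. Qed.

Lemma lagr_eqmx F G : lagr F -> (G :=: F)%MS -> lagr G.
Proof.
move=> [fF oF] e; split; first by rewrite /row_free e.
have /submxP [D ->] : (G <= F)%MS by rewrite e.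
by rewrite trmx_mul mulmxA -(mulmxA D) -(mulmxA D) oF mulmx0 mul0mx.
Qed.

Lemma nf_lagr Y F : trans F Y -> lagr F -> lagr (nf Y F).
Proof. by move=> u lF; apply: lagr_eqmx lF (nf_eqmx u). Qed.

Lemma nf_norm Y F : trans F Y -> nf Y F *m Om *m Y^T = 1%:M.
Proof. by move=> u; rewrite /nf -!mulmxA (mulmxA F) mulVmx. Qed.

Lemma nf_mull Y F (g : 'M[R]_n) : g \in unitmx -> trans F Y -> nf Y (g *m F) = nf Y F.
Proof.
move=> ug u; rewrite /nf mulmxA; congr (_ *m F).
have ugP : g *m F *m Om *m Y^T \in unitmx by rewrite -!mulmxA unitmx_mul ug mulmxA.
apply: (can_inj (mulmxK u)); rewrite mulVmx // -!mulmxA -[RHS](mulVmx ugP).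
by rewrite -!mulmxA.
Qed.

Lemma eqmx_mull F G : row_free F -> (G :=: F)%MS ->
  exists2 g : 'M[R]_n, g \in unitmx & G = g *m F.
Proof.
move=> fF e; have /submxP [D E] : (G <= F)%MS by rewrite e.
exists D => //; rewrite -row_free_unit /row_free eqn_leq rank_leq_row /=.
by rewrite -{1}(eqP fF) -e E mxrankM_maxl.
Qed.

Lemma nf_eq Y F G : trans F Y -> row_free F -> (G :=: F)%MS -> nf Y G = nf Y F.
Proof. by move=> u fF e; have [g ug ->] := eqmx_mull fF e; rewrite nf_mull. Qed.

Lemma trans_eqmx F G Y : row_free F -> (G :=: F)%MS -> trans G Y = trans F Y.
Proof.
move=> fF e; have [g ug ->] := eqmx_mull fF e.
by rewrite /trans -!mulmxA unitmx_mul ug.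
Qed.

Definition pr Y F G : 'M[R]_n := nf Y G *m Om *m (nf Y F)^T.

(* Two vectors orthogonal to the Lagrangian Y both lie in Y. *)
Lemma lagr_ortho2 Y (A B : frame) : lagr Y ->
  A *m Om *m Y^T = 0 -> B *m Om *m Y^T = 0 -> A *m Om *m B^T = 0.
Proof.
move=> lY /(lagr_ortho lY) /submxP [a ->] /(lagr_ortho lY) /submxP [b ->].
by rewrite trmx_mul mulmxA -(mulmxA a) -(mulmxA a) lY.2 mulmx0 mul0mx.
Qed.

Lemma pr_id Y F : lagr F -> trans F Y -> pr Y F F = 0.
Proof. by move=> lF u; case: (nf_lagr u lF). Qed.

(** Normalized frames agree modulo Y, so the differences of two of them lie in Y and pair to zero;
    expanding this pairing gives the cocycle identity. *)
Lemma pr_add Y F G H : lagr Y -> lagr G -> trans F Y -> trans G Y -> trans H Y ->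
  pr Y F G + pr Y G H = pr Y F H.
Proof.
move=> lY lG uF uG uH.
have A : (nf Y H - nf Y G) *m Om *m Y^T = 0 by rewrite !mulmxBl !nf_norm // subrr.
have B : (nf Y F - nf Y G) *m Om *m Y^T = 0 by rewrite !mulmxBl !nf_norm // subrr.
have := lagr_ortho2 lY A B.
rewrite linearB /= !mulmxBl !mulmxBr -/(pr Y F H) -/(pr Y G H) -/(pr Y F G).
rewrite -/(pr Y G G) pr_id // subr0 => /eqP; rewrite subr_eq0 subr_eq => /eqP ->.
by [].
Qed.

Lemma pr_opp Y F G : lagr Y -> lagr F -> lagr G -> trans F Y -> trans G Y ->
  pr Y G F = - pr Y F G.
Proof.
move=> lY lF lG uF uG; apply/eqP; rewrite -addr_eq0 addrC pr_add //.
by rewrite pr_id.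
Qed.

Lemma pr_sym Y F G : lagr Y -> lagr F -> lagr G -> trans F Y -> trans G Y ->
  (pr Y F G)^T = pr Y F G.
Proof. by move=> lY lF lG uF uG; rewrite trOmM -/(pr Y G F) pr_opp ?opprK. Qed.

(** A combination of rows of [nf Y G] that pairs to zero with F lies in F by maximality; conversely
    a common vector, written in the frame of F, pairs to zero with F. *)
Lemma ker_pr Y F G : lagr F -> lagr G -> trans F Y -> trans G Y ->
  (kermx (pr Y F G) *m nf Y G :=: F :&: G)%MS.
Proof.
move=> lF lG uF uG; have lF' := nf_lagr uF lF; have lG' := nf_lagr uG lG.
apply/eqmxP/andP; split.
  rewrite sub_capmx -{1}(nf_eqmx uF) -(nf_eqmx uG) submxMl andbT.
  by apply: lagr_ortho => //; rewrite -2!(mulmxA (kermx _)) mulmx_ker.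
apply/row_subP => i; set v := row i _.
have : (v <= F :&: G)%MS by exact: row_sub.
rewrite sub_capmx -{1}(nf_eqmx uF) -(nf_eqmx uG) => /andP [/submxP [y vy]].
move=> /submxP [x vx]; rewrite vx; apply: submxMr; apply/sub_kermxP.
by rewrite /pr 2!(mulmxA x) -vx vy -2!(mulmxA y) lF'.2 mulmx0.
Qed.

Lemma rank_pr Y F G : lagr F -> lagr G -> trans F Y -> trans G Y ->
  (\rank (pr Y F G) + \rank (F :&: G)%MS)%N = n.
Proof.
move=> lF lG uF uG; rewrite -(ker_pr lF lG uF uG).
rewrite mxrankMfree ?(nf_lagr uG lG).1 // mxrank_ker subnKC //.
exact: rank_leq_row.
Qed.

(* While F moves in the chart of Y, the crossings of F with G are counted by the
   increment of hi Y F G. *)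
Definition hi Y F G : nat := posi (pr Y F G).

Lemma hi_eq Y F F' G G' : trans F Y -> trans G Y -> row_free F -> row_free G ->
  (F' :=: F)%MS -> (G' :=: G)%MS -> hi Y F' G' = hi Y F G.
Proof. by move=> uF uG fF fG eF eG; rewrite /hi /pr (nf_eq uF fF eF) (nf_eq uG fG eG). Qed.

Lemma hi_opp Y F G : lagr Y -> lagr F -> lagr G -> trans F Y -> trans G Y ->
  (hi Y F G + hi Y G F + \rank (F :&: G)%MS)%N = n.
Proof.
move=> lY lF lG uF uG; rewrite /hi (pr_opp lY lF lG) // posi_neg_rank ?pr_sym //.
exact: rank_pr.
Qed.

(** [posi_add_ub] for A_F - A_G and A_G - A_H: read through the frame of the middle Lagrangian G,
    the two kernels become the two intersections with G. *)
Lemma hi_ub Y F G H : lagr Y -> lagr F -> lagr G -> lagr H ->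
  trans F Y -> trans G Y -> trans H Y ->
  (hi Y F G + hi Y G H + \rank (F :&: G + G :&: H)%MS <= n + hi Y F H)%N.
Proof.
move=> lY lF lG lH uF uG uH.
have <- : \rank (kermx (pr Y F G) + kermx (pr Y G H))%MS
        = \rank (F :&: G + G :&: H)%MS.
  rewrite -(mxrankMfree _ (nf_lagr uG lG).1) addsmxMr.
  apply: eqmx_rank; apply/eqmxP; apply: adds_eqmx; first exact: ker_pr.
  (* [ker_pr] reads a kernel through the frame of its second Lagrangian; the change of sign makes G
     the second one here as well. *)
  rewrite (pr_opp lY lH lG uH uG) capmxC.
  apply: eqmx_trans _ (ker_pr lH lG uH uG); apply: eqmxMr.
  apply/eqmxP/andP; split; apply/sub_kermxP.
    by rewrite -[X in _ *m X]opprK mulmxN mulmx_ker oppr0.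
  by rewrite mulmxN mulmx_ker oppr0.
rewrite /hi -(pr_add lY lG uF uG uH); apply: posi_add_ub; exact: pr_sym.
Qed.

Lemma hi_add Y F G H : lagr Y -> lagr F -> lagr G -> lagr H ->
  trans F Y -> trans G Y -> trans H Y -> (hi Y F H <= hi Y F G + hi Y G H)%N.
Proof.
move=> lY lF lG lH uF uG uH.
by rewrite /hi -(pr_add lY lG uF uG uH); apply: posi_add; exact: pr_sym.
Qed.

(* For small positive tau the rotated subspace Lam (1 + tau Om) leaves L: a
   vector x of coordinates of an intersection is orthogonal to the coordinates
   of Lam :&: L, and on that complement transversality is an open condition. *)
Lemma rot_trans (Lam L : frame) : lagr Lam -> lagr L ->
  \forall tau \near 0^'+, trans (Lam + tau *: (Lam *m Om)) L.
Proof.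
move=> lA lL; pose S := Lam *m Om *m L^T; pose K := kermx S.
have KL : (K *m Lam <= L)%MS.
  by apply: lagr_ortho => //; rewrite -2!(mulmxA K); exact: mulmx_ker.
pose Q := Lam *m Lam^T.
have pQ (x : 'rV[R]_n) : qf Q x = 0 -> x = 0.
  rewrite /qf /Q mulmxA -mulmxA -trmx_mul => /row_sq_eq0 /eqP.
  by rewrite mulmx_free_eq0 ?lA.1 // => /eqP.
pose C := kermx (Q *m K^T); pose B := row_base C.
have fB : row_free (B *m S).
  rewrite -kermx_eq0; apply/eqP/row_matrixP => i; rewrite row0.
  set y := row i _; have yS : y *m B *m S = 0.
    by rewrite -(mulmxA y) -row_mul mulmx_ker row0.
  have yK : (y *m B <= K)%MS by apply/sub_kermxP.
  have yC : (y *m B <= C)%MS by rewrite (submx_trans (submxMl _ _)) ?eq_row_base.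
  have y0 : y *m B = 0.
    apply: pQ; case/submxP: yK => z e.
    rewrite /qf {2}e trmx_mul mulmxA.
    by move/sub_kermxP: yC; rewrite mulmxA => ->; rewrite mul0mx mxE.
  by apply/eqP; rewrite -(mulmx_free_eq0 _ (row_base_free C)) -/B y0.
(* [B *m S] has independent rows but need not be square; its Gram matrix is square and invertible,
   and this survives a small perturbation. *)
pose M := (B *m S)^T.
have uM : B *m S *m M \in unitmx.
  rewrite -row_free_unit -kermx_eq0; apply/eqP/row_matrixP => i; rewrite row0.
  set y := row i _; have : y *m (B *m S *m M) = 0 by rewrite -row_mul mulmx_ker row0.
  rewrite /M => /(congr1 (fun X => X *m y^T)); rewrite mul0mx mulmxA -mulmxA -trmx_mul.
  move=> /(congr1 (fun X : 'M[R]_1 => X 0 0)); rewrite [RHS]mxE => /row_sq_eq0 /eqP.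
  by rewrite mulmx_free_eq0 // => /eqP.
have hM : mcvg 0^'+ (fun tau : R => B *m ((Lam + tau *: (Lam *m Om)) *m Om *m L^T) *m M)
    (B *m S *m M).
  apply: mcvg_mul; last exact: mcvg_cst.
  apply: mcvg_mul; first exact: mcvg_cst.
  rewrite /S; apply: mcvg_mul; last exact: mcvg_cst.
  apply: mcvg_mul; last exact: mcvg_cst.
  rewrite -[X in mcvg _ _ X]addr0 -(scale0r (Lam *m Om)).
  apply: mcvg_add; first exact: mcvg_cst.
  apply: mcvg_scale; last exact: mcvg_cst.
  apply: cvg_at_right_filter; exact: cvg_id.
near=> tau; have tau0 : tau != 0 by rewrite gt_eqF //; near: tau; exact: nbhs_right_gt.
rewrite /trans; set N := Lam + _.
rewrite -row_free_unit -kermx_eq0; apply/eqP/row_matrixP => i; rewrite row0.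
set x := row i _.
have xN : x *m N *m Om *m L^T = 0.
  by rewrite -2!(mulmxA x) -row_mul mulmx_ker row0.
(* [K *m Lam] lies in L, so [x *m N] pairs to zero with it. The constant term of this pairing
   vanishes because [Lam] is Lagrangian; up to sign, what remains is tau times the Euclidean product
   of [x *m Lam] and [K *m Lam]. *)
have xC : (x <= C)%MS.
  apply/sub_kermxP; case/submxP: KL => D E.
  have : x *m N *m Om *m (K *m Lam)^T = 0.
    by rewrite E trmx_mul mulmxA xN mul0mx.
  rewrite /N mulmxDr !mulmxDl -scalemxAr -!scalemxAl trmx_mul.
  have -> : x *m Lam *m Om *m (Lam^T *m K^T) = 0.
    by rewrite mulmxA -2!(mulmxA x) lA.2 mulmx0 mul0mx.
  have -> : x *m (Lam *m Om) *m Om = - (x *m Lam).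
    by rewrite -!mulmxA Om_Om !mulmxN mulmx1.
  rewrite add0r mulNmx => /eqP.
  by rewrite scaler_eq0 (negPf tau0) oppr_eq0 /= /Q !mulmxA => /eqP.
have /submxP [z xz] : (x <= B)%MS by rewrite eq_row_base.
have uz : B *m (N *m Om *m L^T) *m M \in unitmx.
  by rewrite /N; near: tau; exact: unitmx_near hM uM.
have : z *m (B *m (N *m Om *m L^T) *m M) = 0.
  by rewrite 2!(mulmxA z) -xz 2!(mulmxA x) xN mul0mx.
move/(congr1 (mulmx^~ (invmx (B *m (N *m Om *m L^T) *m M)))).
by rewrite mulmxK // mul0mx xz => ->; rewrite mul0mx.
Unshelve. all: by end_near.
Qed.

(** 1 + tau [Om] multiplies the symplectic form by the nonzero factor 1 + tau^2. *)
Lemma rot_lagr (Lam : frame) (tau : R) : lagr Lam -> lagr (Lam + tau *: (Lam *m Om)).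
Proof.
move=> lA.
have E : (1%:M + tau *: Om) *m Om *m (1%:M + tau *: Om)^T = (1 + tau ^+ 2) *: Om.
  have -> : (1%:M + tau *: Om)^T = 1%:M - tau *: Om.
    by rewrite linearD linearZ /= tr_Om trmx1 scalerN.
  rewrite mulmxDl mul1mx -scalemxAl Om_Om mulmxBr mulmx1 mulmxDl.
  rewrite -!scalemxAr -!scalemxAl Om_Om mulNmx mul1mx.
  by apply/matrixP => i j; rewrite !mxE; ring.
have -> : Lam + tau *: (Lam *m Om) = Lam *m (1%:M + tau *: Om).
  by rewrite mulmxDr mulmx1 scalemxAr.
have t0 : 1 + tau ^+ 2 != 0 by rewrite gt_eqF // ltr_pwDl // sqr_ge0.
split; last first.
  rewrite trmx_mul mulmxA -2!(mulmxA Lam) E -scalemxAr -scalemxAl lA.2.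
  by rewrite scaler0.
have u : (1%:M + tau *: Om) \in unitmx.
  have : (1 + tau ^+ 2) *: Om \in unitmx by rewrite unitmxZ ?unitfE ?Om_unit.
  by rewrite -E -mulmxA unitmx_mul => /andP [].
by rewrite /row_free mxrankMfree ?row_free_unit // (eqP lA.1).
Qed.

(** The fixed Lagrangian with q = 0 leaves each given one when rotated by a small tau, and finitely
    many such conditions hold together. *)
Lemma common_trans (s : seq frame) : (forall G, G \in s -> lagr G) ->
  exists W, lagr W /\ forall G, G \in s -> trans G W.
Proof.
move=> ls; pose Lam : frame := row_mx 1%:M 0.
have lA : lagr Lam.
  split; first by apply/row_freeP; exists (col_mx 1%:M 0);
    rewrite mul_row_col mulmx1 mul0mx addr0.
  rewrite /Lam /Om mul_row_block tr_row_mx mul_row_col !mulmx0 !mul0mx.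
  by rewrite trmx0 mulmx0 !addr0 mul0mx.
have : \forall tau \near (0 : R)^'+, forall G, G \in s ->
    trans (Lam + tau *: (Lam *m Om)) G.
  elim: s ls => [|G s IH] ls; first by near=> tau.
  have lG : lagr G by apply: ls; rewrite mem_head.
  have ls' H : H \in s -> lagr H by move=> Hs; apply: ls; rewrite inE Hs orbT.
  near=> tau => H; rewrite inE => /orP [/eqP ->|].
    by near: tau; exact: rot_trans.
  by move: H; near: tau; exact: IH ls'.
move=> /filter_ex [tau H]; exists (Lam + tau *: (Lam *m Om)); split.
  exact: rot_lagr.
by move=> G Gs; rewrite trans_sym; exact: H.
Unshelve. all: by end_near.
Qed.

End Charts.

(** * Kashiwara's form *)

Section Kashiwara.
Variables (R : realType) (n : nat).
Local Notation frame := 'M[R]_(n, n + n).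
Local Notation Om := (Om R n).

Lemma posi_scale m (S : 'M[R]_m) c : 0 < c -> posi (c *: S) = posi S.
Proof.
have H (T : 'M[R]_m) d : 0 < d -> (posi T <= posi (d *: T))%N.
  move=> d0; have [U pU] := posi_wit T; apply: (@posi_ge _ _ _ _ U) => x x0.
  rewrite qf_conj /qf -scalemxAr -scalemxAl mxE mulr_gt0 //.
  by have := pU x x0; rewrite qf_conj.
move=> c0; apply/eqP; rewrite eqn_leq H // andbT.
by have := H (c *: S) c^-1; rewrite scalerA mulVf ?gt_eqF // scale1r invr_gt0; apply.
Qed.

(** Gram matrix, on triples (x, y, z), of 2 (a(x,y) + c(x,z) + b(y,z)); the arguments follow the
    block layout, so c precedes b. *)
Definition tri (a c b : 'M[R]_n) : 'M[R]_(n + (n + n)) :=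
  block_mx 0 (row_mx a c) (col_mx a^T c^T) (block_mx 0 b b^T 0).

(* For a + b + c = 0, 4 (a(x,y) + b(y,z) + c(z,x))
   = a(x+y-z,x+y-z) + b(-x+y+z,-x+y+z) + c(x-y+z,x-y+z). *)
Lemma posi_tri (a b c : 'M[R]_n) : a^T = a -> b^T = b -> c^T = c ->
  a + b + c = 0 -> posi (tri a c b) = (posi a + posi b + posi c)%N.
Proof.
move=> sa sb sc /eqP; rewrite addr_eq0 => /eqP abc.
(* (x, y, z) [E] = (-x+y+z, x-y+z, x+y-z), matched in [D] by b, c, a. As [E] is J - 2 and [E'] is J
   - 1, with J the 3 by 3 matrix of identity blocks, [E *m E'] is 2. *)
pose E : 'M[R]_(n + (n + n)) := block_mx (- 1%:M) (row_mx 1%:M 1%:M)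
   (col_mx 1%:M 1%:M) (block_mx (- 1%:M) 1%:M 1%:M (- 1%:M)).
pose D : 'M[R]_(n + (n + n)) := block_mx b 0 0 (block_mx c 0 0 a).
have sE : E^T = E.
  by rewrite /E tr_block_mx tr_row_mx tr_col_mx tr_block_mx !linearN /= !trmx1.
pose E' : 'M[R]_(n + (n + n)) := block_mx 0 (row_mx 1%:M 1%:M)
   (col_mx 1%:M 1%:M) (block_mx 0 1%:M 1%:M 0).
have uE : E \in unitmx.
  apply: (proj1 (@mulmx1_unit _ _ E (2^-1 *: E') _)).
  rewrite -scalemxAr /E /E' !(mulmx_block, mul_row_block, mul_block_col, mul_row_col,
    mul_col_row, mul_mx_row, mul_col_mx).
  rewrite !(mulmx0, mul0mx, mulmx1, mul1mx, mulmxN, mulNmx, addr0, add0r).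
  rewrite !(opprK, oppr0, add_block_mx, opp_block_mx, add_row_mx, add_col_mx,
    opp_row_mx, opp_col_mx).
  rewrite !(addNr, subrr) !addr0 !row_mx0 !col_mx0 !(@scalar_mx_block _ n (n + n) 1).
  rewrite (@scalar_mx_block _ n n 1) scale_block_mx scale_block_mx !scaler0.
  have -> : 2^-1 *: (1%:M + 1%:M) = 1%:M :> 'M[R]_n.
    by apply/matrixP => i j; rewrite !mxE; clear; field.
  by [].
have ED : E *m D *m E^T = 2 *: tri a c b.
  rewrite sE /E /D /tri !(mulmx_block, mul_row_block, mul_block_col, mul_row_col, mul_col_row).
  rewrite !(mulmx0, mul0mx, mulmx1, mul1mx, mulmxN, mulNmx, addr0, add0r).
  rewrite !(mulmx_block, mul_row_block, mul_block_col, mul_row_col, mul_col_row).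
  rewrite !(mulmx0, mul0mx, mulmx1, mul1mx, mulmxN, mulNmx, addr0, add0r).
  rewrite ?mul_mx_row ?mul_col_mx ?mul_mx_row !(mulmx1, mul1mx).
  rewrite !(opprK, add_block_mx, opp_row_mx, opp_col_mx, add_row_mx, add_col_mx).
  rewrite -block_mxEh add_block_mx.
  have ec : c = - (a + b) by rewrite abc opprK.
  rewrite !scale_block_mx scale_row_mx scale_col_mx sa sb sc !scaler0 ec.
  apply: f_equal4; [|apply: f_equal2|apply: f_equal2|apply: f_equal4];
    by apply/matrixP => i j; rewrite !mxE; ring.
rewrite -(@posi_scale _ _ 2) // -ED posi_conj // /D !posi_block //; first lia.
by rewrite tr_block_mx sc sa !trmx0.
Qed.

Lemma posi_tri_conj (a b c g1 g2 g3 : 'M[R]_n) :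
  g1 \in unitmx -> g2 \in unitmx -> g3 \in unitmx ->
  posi (tri (g1 *m a *m g2^T) (g1 *m c *m g3^T) (g2 *m b *m g3^T))
  = posi (tri a c b).
Proof.
move=> u1 u2 u3.
pose E : 'M[R]_(n + (n + n)) := block_mx g1 0 0 (block_mx g2 0 0 g3).
have uE : E \in unitmx by rewrite unitmxE !det_ublock !unitrM -!unitmxE u1 u2.
rewrite -[RHS](posi_conj _ uE) /E /tri; congr posi.
rewrite !tr_block_mx !trmx0 !mulmx_block.
rewrite !(mul_row_block, mul_block_col) !(mulmx0, mul0mx, addr0, add0r).
rewrite !(mulmx_block, mul_mx_row) !(mulmx0, mul0mx, addr0, add0r).
rewrite !(mul_row_block, mul_col_mx) !(mulmx0, mul0mx, addr0, add0r).
rewrite !trmx_mul !trmxK.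
by apply: f_equal4; [|apply: f_equal2|apply: f_equal2|apply: f_equal4];
  rewrite ?mulmxA.
Qed.

(** On triples (x, y, z) from F, G, H this is - 2 (omega(x,y) + omega(y,z) + omega(z,x)),
    Kashiwara's form up to normalization. *)
Definition kash (F G H : frame) :=
  tri (- (F *m Om *m G^T)) (F *m Om *m H^T) (- (G *m Om *m H^T)).

(* kash does not involve Y: this is where the Maslov index becomes
   independent of the auxiliary Lagrangian. *)
Lemma hi_kash Y F G H : lagr Y -> lagr F -> lagr G -> lagr H ->
  trans F Y -> trans G Y -> trans H Y ->
  (hi Y F G + hi Y G H + hi Y H F)%N = posi (kash F G H).
Proof.
move=> lY lF lG lH uF uG uH.
have iF : invmx (F *m Om *m Y^T) \in unitmx by rewrite unitmx_inv.
have iG : invmx (G *m Om *m Y^T) \in unitmx by rewrite unitmx_inv.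
have iH : invmx (H *m Om *m Y^T) \in unitmx by rewrite unitmx_inv.
rewrite -(posi_tri_conj _ _ _ iF iG iH).
have E (A B : frame) : invmx (A *m Om *m Y^T) *m (A *m Om *m B^T)
    *m (invmx (B *m Om *m Y^T))^T = pr Y B A.
  by rewrite /pr /nf trmx_mul !mulmxA.
rewrite !mulmxN !mulNmx !E -(pr_opp lY lG lF) // -(pr_opp lY lH lG) //.
rewrite posi_tri ?pr_sym //.
by rewrite pr_add // pr_add // pr_id.
Qed.

End Kashiwara.

(** * Increments along paths *)

Section Paths.
Variables (R : realType).

(** Continuous induction by a supremum. The local hypothesis concerns only intervals that begin or
    end at t, which suits quantities that jump at t; it is used for constancy, for crossing sums and
    for finiteness of crossings. *)
Lemma interval_chain (P : R -> R -> Prop) (c d : R) : c < d ->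
  (forall x y z, c <= x -> x < y -> y < z -> z <= d -> P x y -> P y z -> P x z) ->
  (forall t, c <= t <= d -> exists2 e, 0 < e &
     (forall x, c <= x -> t - e < x -> x < t -> P x t) /\
     (forall y, y <= d -> t < y -> y < t + e -> P t y)) -> P c d.
Proof.
move=> cd add loc.
pose A : set R := [set x | c < x <= d /\ P c x].
have [e0 e0_gt0 [_ He0]] := loc c (introT andP (conj (lexx c) (ltW cd))).
have A0 : A !=set0.
  pose y := Num.min d (c + e0 / 2).
  have cy : c < y by rewrite lt_min cd ltrDl divr_gt0.
  have yd : y <= d by rewrite ge_min lexx.
  exists y; split; first by rewrite cy.
  apply: He0 => //; rewrite gt_min; apply/orP; right.
  by rewrite ltrD2l gtr_pMr // invf_lt1 // ltr1n.
have ubA : ubound A d by move=> x [/andP []].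
have hsA : has_sup A by split => //; exists d.
set m := sup A.
have md : m <= d by apply: ge_sup.
have cm : c < m.
  have [x Ax] := A0; have [/andP [cx _] _] := Ax.
  by apply: lt_le_trans cx _; apply: sup_upper_bound.
have [e e_gt0 [Hl Hr]] := loc m (introT andP (conj (ltW cm) md)).
have Pcm : P c m.
  have [x Ax mx] := sup_adherent e_gt0 hsA; have [/andP [cx xd] Pcx] := Ax.
  have : x <= m by apply: sup_upper_bound.
  rewrite le_eqVlt => /orP [/eqP <- //|xm].
  by apply: (add c x m) => //; apply: Hl => //; exact: ltW.
have [->//|dm] := eqVneq d m.
have md' : m < d by rewrite lt_neqAle eq_sym dm.
pose y := Num.min d (m + e / 2).
have my : m < y by rewrite lt_min md' ltrDl divr_gt0.
have yd : y <= d by rewrite ge_min lexx.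
have Ay : A y.
  split; first by rewrite yd (lt_trans cm).
  apply: (add c m y) => //; apply: Hr => //; rewrite gt_min; apply/orP; right.
  by rewrite ltrD2l gtr_pMr // invf_lt1 // ltr1n.
have : y <= m by apply: sup_upper_bound.
by rewrite leNgt my.
Qed.

Lemma locally_cst (T : Type) (f : R -> T) (c d : R) : c <= d ->
  (forall t, c <= t <= d -> \forall s \near within `[c, d] (nbhs t), f s = f t) ->
  f d = f c.
Proof.
rewrite le_eqVlt => /orP [/eqP ->//|cd] loc.
apply: (@interval_chain (fun x y => f y = f x)) => // [x y z _ _ _ _ <- //|t tcd].
have /nbhs_ballP [e /= e0 He] := loc t tcd; have /andP [ct td] := tcd.
exists e => //; split=> [x cx xt1 xt2|y yd ty1 ty2].
  apply/esym/He; last by rewrite /= in_itv /= cx (le_trans (ltW xt2)).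
  by rewrite /ball /= gtr0_norm; lra.
apply: He; last by rewrite /= in_itv /= yd (le_trans ct (ltW ty1)).
by rewrite /ball /= ltr0_norm; lra.
Qed.

Variable n : nat.
Local Notation frame := 'M[R]_(n, n + n).
Local Notation Om := (Om R n).
Implicit Types Y F G H Z : frame.

Lemma trans_near (T : Type) (F : set_system T) {FF : Filter F}
    (g : T -> frame) g0 Y : mcvg F g g0 -> trans g0 Y ->
  \forall x \near F, trans (g x) Y.
Proof.
move=> hg u; apply: unitmx_near u; apply: mcvg_mul; last exact: mcvg_cst.
by apply: mcvg_mul => //; exact: mcvg_cst.
Qed.

Lemma mcvg_nf (T : Type) (F : set_system T) {FF : Filter F}
    (g : T -> frame) g0 Y : mcvg F g g0 -> trans g0 Y ->
  mcvg F (fun x => nf Y (g x)) (nf Y g0).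
Proof.
move=> hg u; apply: mcvg_mul => //; apply: mcvg_inv => //.
by apply: mcvg_mul; [apply: mcvg_mul => //|]; exact: mcvg_cst.
Qed.

Lemma hi_indep Y Y' F G H : lagr Y -> lagr Y' -> lagr F -> lagr G -> lagr H ->
  trans F Y -> trans G Y -> trans H Y -> trans F Y' -> trans G Y' -> trans H Y' ->
  (hi Y F G + hi Y G H + hi Y H F)%N = (hi Y' F G + hi Y' G H + hi Y' H F)%N.
Proof.
move=> lY lY' lF lG lH uF uG uH uF' uG' uH'.
exact (etrans (hi_kash lY lF lG lH uF uG uH) (esym (hi_kash lY' lF lG lH uF' uG' uH'))).
Qed.

(** Transversality to Z is open and keeps A_Z - A_g of full rank, so its positive index cannot
    change. *)
Lemma hi_near (T : Type) (F : set_system T) {FF : Filter F}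
    (g : T -> frame) g0 Y Z : lagr Y -> lagr Z -> lagr g0 ->
  trans g0 Y -> trans Z Y -> trans g0 Z -> mcvg F g g0 ->
  (\forall x \near F, lagr (g x)) ->
  \forall x \near F, hi Y Z (g x) = hi Y Z g0.
Proof.
move=> lY lZ l0 u0 uZ uz hg lg.
have rk (A : frame) : lagr A -> trans A Y -> trans A Z -> \rank (pr Y Z A) = n.
  move=> lA uA uAZ; have := rank_pr lZ lA uZ uA.
  by rewrite capmxC (trans_capP lA lZ uAZ) addn0.
apply: posi_near_eq.
- by apply: mcvg_mul; [apply: mcvg_mul; [exact: mcvg_nf|]|]; exact: mcvg_cst.
- exact: pr_sym.
- near=> x; have lx : lagr (g x) by near: x.
  have ux : trans (g x) Y by near: x; exact: trans_near.
  have uxZ : trans (g x) Z by near: x; exact: trans_near.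
  by rewrite pr_sym // !rk.
Unshelve. all: by end_near.
Qed.

Definition dh Y F F' G : int := (hi Y F' G)%:Z - (hi Y F G)%:Z.

(** Near a time t choose Z transversal to g(t), Y and Y'. The cyclic sum of indices of g, G, Z is
    the same in both charts, its terms with Z are constant near t, so the two indices of (g, G)
    differ by a locally constant amount. *)
Lemma dh_edge (g : R -> frame) (c d : R) Y Y' G : c <= d ->
  lagr Y -> lagr Y' -> lagr G -> trans G Y -> trans G Y' ->
  (forall t, c <= t <= d -> [/\ lagr (g t), trans (g t) Y, trans (g t) Y' &
      mcvg (within `[c, d] (nbhs t)) g (g t)]) ->
  dh Y (g c) (g d) G = dh Y' (g c) (g d) G.
Proof.
move=> cd lY lY' lG uY uY' Hg.
pose f t : int := (hi Y (g t) G)%:Z - (hi Y' (g t) G)%:Z.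
suff : f d = f c by rewrite /f /dh; lia.
apply: locally_cst => // t tcd; have [lt ut ut' ct] := Hg t tcd.
have [|Z [lZ HZ]] := @common_trans R n [:: g t; Y; Y'].
  by move=> A; rewrite !inE => /or3P [] /eqP ->.
have uZt : trans (g t) Z by apply: HZ; rewrite !inE eqxx.
have uZ : trans Z Y by rewrite trans_sym HZ ?inE ?eqxx ?orbT.
have uZ' : trans Z Y' by rewrite trans_sym HZ ?inE ?eqxx ?orbT.
have lg : \forall s \near within `[c, d] (nbhs t), lagr (g s).
  near=> s; have : `[c, d]%classic s by near: s; exact: withinT.
  by rewrite /= in_itv /= => /Hg [].
have H1 := hi_near lY lZ lt ut uZ uZt ct lg.
have H2 := hi_near lY' lZ lt ut' uZ' uZt ct lg.
have H12 : within `[c, d] (nbhs t) (fun s => hi Y Z (g s) = hi Y Z (g t) /\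
    hi Y' Z (g s) = hi Y' Z (g t)) by apply: filterI; [exact: H1|exact: H2].
near=> s; have scd : c <= s <= d.
  by have : `[c, d]%classic s by [near: s; exact: withinT]; rewrite /= in_itv /=.
have [h1 h2] : hi Y Z (g s) = hi Y Z (g t) /\ hi Y' Z (g s) = hi Y' Z (g t).
  by near: s; exact: H12.
have [ls us us' _] := Hg s scd.
have := @hi_indep Y Y' (g s) G Z lY lY' ls lG lZ us uY uZ us' uY' uZ'.
have := @hi_indep Y Y' (g t) G Z lY lY' lt lG lZ ut uY uZ ut' uY' uZ'.
rewrite h1 h2 /f; clear; lia.
Unshelve. all: by end_near.
Qed.

End Paths.

(** * Crossing forms *)

Section CrossingForm.
Variables (R : realType) (n : nat).
Local Notation frame := 'M[R]_(n, n + n).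
Local Notation Om := (Om R n).
Implicit Types Y G H Z : frame.

Lemma mcvg_unique (T : Type) (F : set_system T) {FF : ProperFilter F} m k
  (A : T -> 'M[R]_(m, k)) A0 A1 : mcvg F A A0 -> mcvg F A A1 -> A0 = A1.
Proof.
by move=> h0 h1; apply/matrixP => i j; apply: cvg_unique (h0 i j) (h1 i j).
Qed.

Variable F : R -> frame.
Hypothesis lF : forall t, lagr (F t).
Hypothesis dF : forall i j t, derivable (fun s => F s i j) t 1.

Definition Fd t : frame := \matrix_(i, j) ('D_1 (fun s => F s i j) t).

Lemma mcvg_quot t : mcvg (0 : R)^' (fun h : R => h^-1 *: (F (t + h) - F t)) (Fd t).
Proof.
move=> i j; rewrite mxE; have := dF (i:=i) (j:=j) (t:=t).
rewrite /derivable => /cvg_ex [l hl]; rewrite /derive (cvg_lim _ hl) //.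
apply: cvg_trans hl; apply: near_eq_cvg; near=> h.
by rewrite !mxE /GRing.scale /= mulr1 (addrC h).
Unshelve. all: by end_near.
Qed.

Lemma mcvg_F t : mcvg (0 : R)^' (fun h : R => F (t + h)) (F t).
Proof.
have -> : F t = F t + 0 *: Fd t by rewrite scale0r addr0.
have h : mcvg (0 : R)^' (fun h : R => F t + h *: (h^-1 *: (F (t + h) - F t))) (F t + 0 *: Fd t).
  apply: mcvg_add; first exact: mcvg_cst.
  apply: mcvg_scale; last exact: mcvg_quot.
  exact: cvg_within.
move=> i j; apply: cvg_trans (h i j); apply: near_eq_cvg; near=> k.
have k0 : k != 0 by near: k; exact: nbhs_dnbhs_neq.
by rewrite scalerA mulfV // scale1r addrC subrK.
Unshelve. all: by end_near.
Qed.

Lemma mcvg_F_nbhs t : mcvg (nbhs t) F (F t).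
Proof.
move=> i j; apply: differentiable_continuous; apply/derivable1_diffP.
exact: dF.
Qed.

(** The form omega(x F, x F') in coordinates of the frame; by [crossing_formE] it represents the
    crossing form on all of F(t). *)
Definition Gam t : 'M[R]_n := F t *m Om *m (Fd t)^T.

(* The omega-pairing is constant along F, so the difference quotient moves from
   w(t) to F(t), where only the continuity of w is needed. *)
Lemma cf_quot t0 (x : 'rV[R]_n) (y : R -> 'rV[R]_(n + n)) :
  mcvg (0 : R)^' (fun h : R => y (t0 + h)) (x *m F t0) ->
  (\forall h \near (0 : R)^', (y (t0 + h)%R <= F (t0 + h)%R)%MS) ->
  (fun h : R => h^-1 * omega (x *m F t0) (y (t0 + h))) @ (0 : R)^' --> qf (Gam t0) x.
Proof.
move=> hy yF.
have h : mcvg (0 : R)^' (fun h : R => - (x *m (h^-1 *: (F (t0 + h) - F t0)) *m Om *m (y (t0 + h))^T))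
    (- (x *m Fd t0 *m Om *m (x *m F t0)^T)).
  apply: mcvg_opp; apply: mcvg_mul; last exact: mcvg_tr.
  apply: mcvg_mul; last exact: mcvg_cst.
  by apply: mcvg_mul; [exact: mcvg_cst|exact: mcvg_quot].
have -> : qf (Gam t0) x = (- (x *m Fd t0 *m Om *m (x *m F t0)^T)) 0 0.
  by rewrite -trOmM mxE /qf /Gam trmx_mul !mulmxA mxE.
apply: cvg_trans (h 0 0); apply: near_eq_cvg; near=> k.
have : (y (t0 + k)%R <= F (t0 + k)%R)%MS by near: k.
case/submxP => z ->; rewrite omegaE -scalemxAr -!scalemxAl -scalerN mxE.
congr (_ * _); rewrite mulmxBr !mulmxBl opprB mxE [X in _ + X]mxE.
have -> : x *m F (t0 + k) *m Om *m (z *m F (t0 + k))^T = 0.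
  by rewrite trmx_mul mulmxA -2!(mulmxA x) (lF _).2 mulmx0 mul0mx.
by rewrite mxE [X in _ - X]mxE subr0.
Unshelve. all: by end_near.
Qed.

Lemma near_shift (t0 : R) (P : set R) :
  (\forall t \near t0, P t) -> \forall h \near (0 : R)^', P (t0 + h).
Proof.
move=> H; have : (fun h : R => t0 + h) @ (0 : R)^' --> t0.
  rewrite -[X in _ --> X]addr0; apply: cvgD; first exact: cvg_cst.
  exact: cvg_within.
exact.
Qed.

Lemma proj_nf k Y (A : frame) (u : 'M[R]_(k, n + n)) : trans A Y -> (u <= A)%MS ->
  u = u *m Om *m Y^T *m nf Y A.
Proof.
move=> uA /submxP [z ->]; rewrite /nf.
by rewrite -2!(mulmxA z) (mulmxA (z *m _)) mulmxK.
Qed.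

Lemma omegavv (v : 'rV[R]_(n + n)) : omega v v = 0.
Proof.
have := trOmM v v; rewrite omegaE.
move/(congr1 (fun X : 'M[R]_1 => X 0 0)); rewrite mxE [RHS]mxE.
by move: ((v *m Om *m v^T) 0 0) => a; lra.
Qed.

Lemma omegaDr (u v w : 'rV[R]_(n + n)) : omega u (v + w) = omega u v + omega u w.
Proof. by rewrite !omegaE linearD mulmxDr mxE. Qed.

(** v + w(t) is the vector of F(t) with the same pairing with Y as v. This determines it near t0 as
    a projection of v along Y, whence its convergence to v. *)
Lemma cf_val_lim t0 (x : 'rV[R]_n) (w : R -> 'rV[R]_(n + n)) Y :
  lagr Y -> trans (F t0) Y ->
  (\forall t \near t0, (w t <= Y)%MS /\ ((x *m F t0 + w t)%R <= F t)%MS) ->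
  (fun h : R => h^-1 *: (omega (x *m F t0) (w (h *: (1 : R) + t0)) -
      omega (x *m F t0) (w t0))) @ (0 : R)^' --> qf (Gam t0) x.
Proof.
move=> lY u H; set v := x *m F t0; pose y t := v + w t.
have Ey t : (w t <= Y)%MS -> trans (F t) Y -> (y t <= F t)%MS ->
    y t = v *m Om *m Y^T *m nf Y (F t).
  move=> /submxP [z wz] uF yF; rewrite [LHS](proj_nf uF yF) /y !mulmxDl wz.
  have -> : z *m Y *m Om *m Y^T = 0.
    by rewrite -2!(mulmxA z) lY.2 mulmx0.
  by rewrite mul0mx addr0.
have Ev : v *m Om *m Y^T *m nf Y (F t0) = v by rewrite -(proj_nf u) ?submxMl.
have w0 : w t0 = 0.
  have [h1 h2] := nbhs_singleton H; have := Ey t0 h1 u h2; rewrite Ev /y.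
  by move/(congr1 (fun a => a - v)); rewrite addrAC subrr add0r.
have uN : \forall t \near t0, trans (F t) Y by exact: trans_near (@mcvg_F_nbhs t0) u.
have yv : mcvg (0 : R)^' (fun h : R => y (t0 + h)) v.
  have h : mcvg (0 : R)^' (fun h : R => v *m Om *m Y^T *m nf Y (F (t0 + h))) v.
    rewrite -[X in mcvg _ _ X]Ev; apply: mcvg_mul; first exact: mcvg_cst.
    exact: mcvg_nf (@mcvg_F t0) u.
  move=> i j; apply: cvg_trans (h i j); apply: near_eq_cvg.
  near=> k.
  have [h1 h2] : (w (t0 + k)%R <= Y)%MS /\ (y (t0 + k)%R <= F (t0 + k)%R)%MS.
    by near: k; exact: near_shift H.
  have u' : trans (F (t0 + k)) Y by near: k; exact: near_shift uN.
  by rewrite [in RHS]Ey.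
have yF : \forall h \near (0 : R)^', (y (t0 + h)%R <= F (t0 + h)%R)%MS.
  apply: (@near_shift t0 (fun t => (y t <= F t)%MS)).
  by apply: near_impl H _ => t [].
apply: cvg_trans (cf_quot yv yF); apply: near_eq_cvg; near=> k.
rewrite /y omegaDr omegavv add0r w0.
have -> : omega v 0 = 0 by rewrite omegaE trmx0 mulmx0 mxE.
by rewrite subr0 /GRing.scale /= mulr1 (addrC t0).
Unshelve. all: by end_near.
Qed.

(** Every admissible W and w give this value, and one admissible pair exists, so [xget] does not
    fall back on its default. *)
Lemma crossing_formE t0 (x : 'rV[R]_n) :
  crossing_form F t0 (x *m F t0) = qf (Gam t0) x.
Proof.
have uniq q : cf_val F t0 (x *m F t0) q -> q = qf (Gam t0) x.
  case=> W [lW [r0 [w [Hw [dw qw]]]]].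
  have [Y [lY YW]] := lagrangian_frame lW.
  have u : trans (F t0) Y.
    apply/(trans_capP (lF t0) lY); rewrite -r0 capmxC.
    by apply: eqmx_rank; apply/eqmxP; apply: cap_eqmx.
  have H : \forall t \near t0, (w t <= Y)%MS /\ ((x *m F t0 + w t)%R <= F t)%MS.
    by apply: near_impl Hw _ => t; rewrite YW.
  have C := cf_val_lim lY u H.
  rewrite -qw /derive; exact: cvg_lim C.
have ex : exists q, cf_val F t0 (x *m F t0) q.
  exists (qf (Gam t0) x).
  have [|Y [lY HY]] := @common_trans R n [:: F t0].
    by move=> A; rewrite inE => /eqP ->.
  have u : trans (F t0) Y by apply: HY; rewrite inE.
  set v := x *m F t0.
  pose w t := v *m Om *m Y^T *m nf Y (F t) - v.
  have uN : \forall t \near t0, trans (F t) Y.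
    exact: trans_near (@mcvg_F_nbhs t0) u.
  have H : \forall t \near t0, (w t <= Y)%MS /\ ((v + w t)%R <= F t)%MS.
    apply: near_impl uN _ => t ut; split.
      apply: lagr_ortho => //; rewrite /w !mulmxBl.
      by rewrite -2!(mulmxA (v *m Om *m Y^T)) nf_norm // mulmx1 subrr.
    by rewrite /w addrC subrK -(nf_eqmx ut) submxMl.
  (* [cf_val] asks for a square matrix; [<<Y>>] has the same row space as the frame. *)
  exists <<Y>>%MS; split; last split.
  - have [rY oY] := lagr_lagrangian lY; split; first by rewrite mxrank_gen.
    by move=> a b; rewrite !genmxE; exact: oY.
  - have := (trans_capP (lF t0) lY u); rewrite capmxC => <-.
    by apply: eqmx_rank; apply/eqmxP; apply: cap_eqmx => //; exact: genmxE.
  - exists w; split.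
      by apply: near_impl H _ => t; rewrite genmxE.
    have C := cf_val_lim lY u H.
    by apply: DeriveDef; [exact: (cvgP _ C)|exact: (cvg_lim _ C)].
by rewrite /crossing_form; case: xgetP => [q _ /uniq //|]; case: ex => q Hq /(_ q).
Qed.

End CrossingForm.

(** * Jump of the positive index at a regular crossing *)

Section Jump.
Variables (R : realType) (n : nat).
Local Notation frame := 'M[R]_(n, n + n).
Local Notation Om := (Om R n).
Local Notation V := 'rV[R]_(n + n).
Implicit Types Y G H Z : frame.

Lemma tr_conj r m (S : 'M[R]_m) (E : 'M[R]_(r, m)) : S^T = S ->
  (E *m S *m E^T)^T = E *m S *m E^T.
Proof. by move=> sS; rewrite !trmx_mul trmxK sS mulmxA. Qed.

Lemma npos_posi (Q : V -> R) (S : 'M[R]_(n + n)) r (E : 'M[R]_(r, n + n))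
    (Ga : 'M[R]_r) : row_free E -> (E :=: S)%MS ->
  (forall x, Q (x *m E) = qf Ga x) -> npos Q S = posi Ga.
Proof.
move=> fE ES QE; apply/eqP; rewrite eqn_leq; apply/andP; split.
  apply/bigmax_leqP => k /asboolP [U [US [<- pU]]].
  have /submxP [D UD] : (U <= E)%MS by rewrite ES.
  rewrite UD mxrankMfree //; apply: posi_geS => u uD u0.
  rewrite -QE; apply: pU; first by rewrite UD submxMr.
  by rewrite mulmx_free_eq0.
have [P [fP pP]] := posi_sub Ga.
have rP : \rank (P *m E) = posi Ga by rewrite mxrankMfree // (eqP fP).
have lt : (posi Ga < (n + n).+1)%N by rewrite ltnS -rP rank_leq_col.
apply: (@leq_bigmax_cond _ _ (fun k : 'I_(n + n).+1 => k : nat) (Ordinal lt)).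
apply/asboolP; exists <<P *m E>>%MS; split.
  by rewrite genmxE -ES submxMl.
split; first by rewrite mxrank_gen.
move=> u; rewrite genmxE => /submxP [x ->] u0; rewrite mulmxA QE; apply: pP.
  exact: submxMl.
by apply: contraNneq u0 => e; rewrite mulmxA e mul0mx.
Qed.

Lemma nneg_posi (Q : V -> R) (S : 'M[R]_(n + n)) r (E : 'M[R]_(r, n + n))
    (Ga : 'M[R]_r) : row_free E -> (E :=: S)%MS ->
  (forall x, Q (x *m E) = qf Ga x) -> nneg Q S = posi (- Ga).
Proof.
move=> fE ES QE.
rewrite -(@npos_posi (fun u => - Q u) S r E) => // [|x]; last by rewrite QE qfN.
apply: eq_bigl => k; apply: asbool_equiv_eq; split=> -[U [US [rU pU]]];
  by exists U; do 2!split => //; move=> u uU u0; have := pU u uU u0; rewrite oppr_gt0.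
Qed.

Variable F : R -> frame.
Hypothesis lF : forall t, lagr (F t).
Hypothesis dF : forall i j t, derivable (fun s => F s i j) t 1.
Variables (L0 : 'M[R]_(n + n)) (G : frame).
Hypotheses (lG : lagr G) (GL : (G :=: L0)%MS).

(** The excess of [hi] just after t over its value at t; [ljump] is the excess just before t. *)
Definition rjump t : nat := npos (crossing_form F t) (F t :&: L0)%MS.
Definition ljump t : nat := nneg (crossing_form F t) (F t :&: L0)%MS.
Definition regular t : Prop :=
  crossing F L0 t -> nondeg (crossing_form F t) (F t :&: L0)%MS.

Lemma crossingE t : crossing F L0 t = (\rank (F t :&: G)%MS != 0%N).
Proof.
rewrite /crossing; congr (_ != _); apply: eqmx_rank; apply/eqmxP.
by apply: cap_eqmx => //; apply: eqmx_sym.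
Qed.

Lemma rjump0 t : ~~ crossing F L0 t -> rjump t = 0%N.
Proof.
rewrite negbK => /eqP r0; apply/eqP; rewrite -leqn0; apply/bigmax_leqP => k.
by move=> /asboolP [U [/mxrankS US [<- _]]]; rewrite -r0.
Qed.

Lemma ljump0 t : ~~ crossing F L0 t -> ljump t = 0%N.
Proof.
rewrite negbK => /eqP r0; apply/eqP; rewrite -leqn0; apply/bigmax_leqP => k.
by move=> /asboolP [U [/mxrankS US [<- _]]]; rewrite -r0.
Qed.

(** Congruent to [pr Y A G] but quadratic in A, so that it is differentiated without differentiating
    the inverse in [nf]. *)
Definition Sf Y (A : frame) : 'M[R]_n := A *m (Om *m Y^T *m nf Y G *m Om) *m A^T.

Lemma Sf_pr Y (A : frame) : trans A Y ->
  Sf Y A = (A *m Om *m Y^T) *m pr Y A G *m (A *m Om *m Y^T)^T.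
Proof.
move=> u; have e : (nf Y A)^T *m (A *m Om *m Y^T)^T = A^T.
  by rewrite -trmx_mul /nf mulmxA mulmxV // mul1mx.
rewrite /Sf /pr -(mulmxA (A *m Om *m Y^T)) -(mulmxA (nf Y G *m Om)) e.
by rewrite !mulmxA.
Qed.

Lemma Sf_posi Y (A : frame) : trans A Y -> posi (Sf Y A) = hi Y A G.
Proof. by move=> u; rewrite Sf_pr // posi_conj. Qed.

Lemma Sf_sym Y (A : frame) : lagr Y -> lagr A -> trans A Y -> trans G Y ->
  (Sf Y A)^T = Sf Y A.
Proof.
by move=> lY lA uA uG; rewrite Sf_pr // tr_conj // pr_sym.
Qed.

Lemma Sf_rank Y (A : frame) : lagr Y -> lagr A -> trans A Y -> trans G Y ->
  (\rank (Sf Y A) + \rank (A :&: G)%MS)%N = n.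
Proof.
move=> lY lA uA uG; rewrite -[RHS](rank_pr lA lG uA uG); congr (_ + _)%N.
rewrite Sf_pr // mxrankMfree ?row_free_unit ?unitmx_tr //.
by apply: eqmx_rank; apply/eqmxP; apply: eqmxMfull; rewrite row_full_unit.
Qed.

(** Along s -> t + g s, the derivative of [Sf] restricted to its kernel at t is g times the crossing
    form. Regularity makes it invertible, so [posi_crossing] applies; for g = -1 the negative
    directions are the ones that become positive. Full rank beside t means that there is no
    crossing. *)
Lemma jump_one_side t Y (g : R) : g = 1 \/ g = -1 -> lagr Y -> trans (F t) Y ->
  trans G Y -> regular t ->
  \forall s \near 0^'+, hi Y (F (t + g * s)) G =
      (hi Y (F t) G + (if (g == 1)%R then rjump t else ljump t))%N /\
      ~~ crossing F L0 (t + g * s).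
Proof.
move=> g1 lY u uG reg.
have g0 : g != 0 by case: g1 => ->; rewrite ?oppr_eq0 oner_neq0.
pose S s := Sf Y (F (t + g * s)).
pose M := Om *m Y^T *m nf Y G *m Om.
pose D := g *: (Fd F t *m M *m (F t)^T + F t *m M *m (Fd F t)^T).
have c0 : (fun s : R => g * s) @ 0^'+ --> (0 : R)^'.
  move=> A; rewrite /= !nbhs_simpl /= => -[e /= e0 HA]; exists e => // s /= se s0.
  apply: HA; last by rewrite mulf_neq0 // gt_eqF.
  move: se; rewrite /ball /= !sub0r !normrN normrM.
  by case: g1 => ->; rewrite ?normrN1 ?normr1 mul1r.
have cF : mcvg 0^'+ (fun s => F (t + g * s)) (F t).
  move=> i j; have h : (fun h : R => F (t + h) i j) @ (0 : R)^' --> F t i j.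
    exact: mcvg_F.
  exact: (cvg_comp (fun s : R => g * s) (fun h : R => F (t + h) i j) c0 h).
have cQ : mcvg 0^'+ (fun s => s^-1 *: (F (t + g * s) - F t)) (g *: Fd F t).
  have h : mcvg 0^'+ (fun s => g *: ((g * s)^-1 *: (F (t + g * s) - F t))) (g *: Fd F t).
    apply: mcvg_scale; first exact: cvg_cst.
    move=> i j; have h : (fun h : R => (h^-1 *: (F (t + h) - F t)) i j)
        @ (0 : R)^' --> Fd F t i j by exact: mcvg_quot.
    exact: (cvg_comp (fun s : R => g * s)
      (fun h : R => (h^-1 *: (F (t + h) - F t)) i j) c0 h).
  move=> i j; apply: cvg_trans (h i j); apply: near_eq_cvg; near=> s.
  by rewrite scalerA invfM mulrA mulfV // mul1r.
have cS : mcvg 0^'+ S (Sf Y (F t)).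
  apply: mcvg_mul; last exact: mcvg_tr.
  by apply: mcvg_mul; [exact: cF|exact: mcvg_cst].
have cD : mcvg 0^'+ (fun s => s^-1 *: (S s - Sf Y (F t))) D.
  have h : mcvg 0^'+ (fun s => s^-1 *: (F (t + g * s) - F t) *m M *m (F (t + g * s))^T
      + F t *m M *m (s^-1 *: (F (t + g * s) - F t))^T)
      (g *: Fd F t *m M *m (F t)^T + F t *m M *m (g *: Fd F t)^T).
    apply: mcvg_add.
      apply: mcvg_mul; last exact: mcvg_tr.
      by apply: mcvg_mul; [exact: cQ|exact: mcvg_cst].
    by apply: mcvg_mul; [exact: mcvg_cst|exact: mcvg_tr].
  have -> : D = g *: Fd F t *m M *m (F t)^T + F t *m M *m (g *: Fd F t)^T.
    by rewrite /D scalerDr linearZ /= -!scalemxAl -scalemxAr.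
  move=> i j; apply: cvg_trans (h i j); apply: near_eq_cvg; near=> s.
  congr (fun_of_matrix _ i j); rewrite linearZ /= -!scalemxAl -scalemxAr -scalerDr.
  congr (_ *: _); rewrite linearB /= !mulmxBl mulmxBr /S /Sf -/M.
  by rewrite addrA subrK.
have uN : \forall s \near 0^'+, trans (F (t + g * s)) Y by exact: trans_near cF u.
have s0 := Sf_sym lY (lF t) u uG.
have sS : \forall s \near 0^'+, (S s)^T = S s.
  by apply: near_impl uN _ => s us; exact: Sf_sym.
have sD : D^T = D.
  apply: (@mcvg_unique _ _ 0^'+ _ _ _ (fun s => (s^-1 *: (S s - Sf Y (F t)))^T)).
    exact: mcvg_tr.
  move=> i j; apply: cvg_trans (cD i j); apply: near_eq_cvg; near=> s.
  have ss : (S s)^T = S s by near: s.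
  suff -> : (s^-1 *: (S s - Sf Y (F t)))^T = s^-1 *: (S s - Sf Y (F t)) by [].
  by rewrite linearZ /= linearB /= ss; congr (_ *: (_ - _)).
have [r [k [k0 fk rk]]] : exists r (k : 'M[R]_(r, n)),
    [/\ k *m Sf Y (F t) = 0, row_free k & (r + \rank (Sf Y (F t)))%N = n].
  exists (\rank (kermx (Sf Y (F t)))), (row_base (kermx (Sf Y (F t)))); split.
  - by apply/sub_kermxP; rewrite eq_row_base.
  - exact: row_base_free.
  - by rewrite mxrank_ker subnK // rank_leq_row.
have kG : (k *m F t <= G)%MS.
  rewrite -(nf_eqmx uG); apply: lagr_ortho; first exact: nf_lagr.
  have Eu : F t *m Om *m Y^T \in unitmx by [].
  have e : F t *m Om *m Y^T *m nf Y (F t) = F t by rewrite /nf mulmxA mulmxV // mul1mx.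
  have P0 : k *m (F t *m Om *m Y^T) *m pr Y (F t) G = 0.
    move: k0; rewrite Sf_pr // mulmxA mulmxA.
    move/(congr1 (fun X => X *m invmx (F t *m Om *m Y^T)^T)).
    by rewrite mulmxK ?unitmx_tr // mul0mx.
  have PE : nf Y (F t) *m Om *m (nf Y G)^T = - pr Y (F t) G.
    by rewrite -(pr_opp lY (lF t) lG).
  rewrite -{1}e -(mulmxA k) -(mulmxA k) -(mulmxA (F t *m Om *m Y^T)).
  rewrite -(mulmxA (F t *m Om *m Y^T)) (mulmxA k) PE mulmxN P0 oppr0 //.
pose Ga := k *m Gam F t *m k^T.
(* The rows of [k *m F t] lie in G. As a right factor they are annihilated by [M], and as a left
   factor they see [M] as [Om]: one term of the product rule vanishes and the other is the crossing
   form. *)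
have kD : k *m D *m k^T = g *: Ga.
  have z1 : M *m (F t)^T *m k^T = 0.
    have /submxP [z kz] : (k *m F t <= nf Y G)%MS by rewrite (nf_eqmx uG).
    rewrite -mulmxA -trmx_mul kz trmx_mul mulmxA /M -(mulmxA _ _ (nf Y G)^T).
    rewrite -(mulmxA _ _ (Om *m _)) (mulmxA (nf Y G)) (nf_lagr uG lG).2.
    by rewrite mulmx0 mul0mx.
  have z2 : k *m F t *m M = k *m F t *m Om.
    by rewrite /M [in RHS](proj_nf uG kG) !mulmxA.
  rewrite /D -scalemxAr -scalemxAl mulmxDr mulmxDl; congr (_ *: _).
  rewrite -(mulmxA (Fd F t)) (mulmxA k (Fd F t)) -(mulmxA (k *m Fd F t)) z1 mulmx0.
  by rewrite add0r (mulmxA k) (mulmxA k) z2 /Ga /Gam !mulmxA.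
have sGa : Ga^T = Ga.
  have : (g *: Ga)^T = g *: Ga by rewrite -kD tr_conj.
  by rewrite linearZ /= => /(scalerI g0).
have fE : row_free (k *m F t).
  by rewrite /row_free mxrankMfree ?(lF t).1.
have EL : (k *m F t :=: F t :&: L0)%MS.
  apply/eqmxP; rewrite -(geq_leqif (mxrank_leqif_eq _)); last first.
    by rewrite sub_capmx submxMl -GL.
  rewrite (eqP fE); have := Sf_rank lY (lF t) u uG.
  have -> : \rank (F t :&: G)%MS = \rank (F t :&: L0)%MS.
    by apply: eqmx_rank; apply/eqmxP; apply: cap_eqmx.
  by move: rk; clear; lia.
have QE x : crossing_form F t (x *m (k *m F t)) = qf Ga x.
  by rewrite mulmxA crossing_formE // /Ga qf_conj.
have uGa : Ga \in unitmx.
  rewrite -row_free_unit -kermx_eq0; apply/eqP/row_matrixP => i; rewrite row0.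
  set x := row i _; have xG : x *m Ga = 0 by rewrite -row_mul mulmx_ker row0.
  have [nc|/negPn] := boolP (~~ crossing F L0 t).
    have E0 : k *m F t = 0.
      apply/eqP; rewrite -submx0 EL; move: nc; rewrite negbK mxrank_eq0.
      by rewrite submx0.
    by apply/eqP; rewrite -(mulmx_free_eq0 x fE) E0 mulmx0.
  move=> /reg nd; apply/eqP; rewrite -(mulmx_free_eq0 x fE); apply/eqP.
  apply: nd; first by rewrite -EL submxMl.
  move=> v; rewrite -EL => /submxP [y ->].
  rewrite -mulmxDl !QE qfD // /bf xG mul0mx mxE mul0rn addr0.
  by move: (qf Ga x) (qf Ga y) => a b; ring.
have ukD : k *m D *m k^T \in unitmx by rewrite kD unitmxZ // unitfE.
near=> s.
have us : trans (F (t + g * s)) Y by near: s.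
have [h1 h2] : posi (S s) = (posi (Sf Y (F t)) + posi (k *m D *m k^T)%R)%N /\
    \rank (S s) = n.
  by near: s; exact: (posi_crossing s0 sS sD cS cD k0 rk ukD).
split; last first.
  rewrite crossingE negbK; have := Sf_rank lY (lF (t + g * s)) us uG.
  by rewrite -/(S s) h2; clear; lia.
rewrite -!Sf_posi // -/(S s) h1 kD; congr (_ + _)%N.
case: g1 => ->.
  by rewrite eqxx scale1r; apply/esym; apply: npos_posi QE.
rewrite scaleN1r ifF; last by apply/eqP; lra.
by apply/esym; apply: nneg_posi QE.
Unshelve. all: by end_near.
Qed.

End Jump.

(** * Crossing sums over subintervals *)

Section CrossingSum.
Variables (R : realType) (n : nat).
Local Notation frame := 'M[R]_(n, n + n).
Local Notation Om := (Om R n).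
Implicit Types Y : frame.
Variable F : R -> frame.
Hypothesis lF : forall t, lagr (F t).
Hypothesis dF : forall i j t, derivable (fun s => F s i j) t 1.
Variables (L0 : 'M[R]_(n + n)) (G : frame).
Hypotheses (lG : lagr G) (GL : (G :=: L0)%MS).
Variable s : seq R.
Hypothesis us : uniq s.

(** Elements of the list that are not crossings contribute zero, so one fixed list serves all
    subintervals. *)
Definition crossing_sum (c d : R) : int :=
  (rjump F L0 c)%:Z
  + \sum_(t <- s | c < t < d) ((rjump F L0 t)%:Z - (ljump F L0 t)%:Z)
  - (ljump F L0 d)%:Z.

(** The final term at y of the left piece and the initial term at y of the right piece combine to
    the signature at y, an interior term of the whole; hence a crossing at y must be listed. *)
Lemma crossing_sum_add x y z : x < y -> y < z ->
  (crossing F L0 y -> y \in s) ->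
  crossing_sum x z = crossing_sum x y + crossing_sum y z.
Proof.
move=> xy yz ys; set f := fun t => (rjump F L0 t)%:Z - (ljump F L0 t)%:Z.
have E : \sum_(t <- s | x < t < z) f t =
    \sum_(t <- s | x < t < y) f t + f y + \sum_(t <- s | y < t < z) f t.
  have -> : f y = \sum_(t <- s | t == y) f t.
    have [ysin|ynot] := boolP (y \in s).
      rewrite big_mkcond; by rewrite (bigD1_seq y) //= eqxx big1 ?addr0 // => t /negPf ->.
    have nc : ~~ crossing F L0 y by apply: contra ynot.
    rewrite /f (rjump0 nc) (ljump0 nc) subrr big1_seq // => t /andP [/eqP ->].
    by rewrite (negPf ynot).
  rewrite big_mkcond [X in _ = X + _ + _]big_mkcond [X in _ = _ + X + _]big_mkcond.
  rewrite [X in _ = _ + _ + X]big_mkcond -!big_split; apply: eq_bigr => t _ /=.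
  have [->|ty] := eqVneq t y; first by rewrite !ltxx xy yz !andbF add0r addr0.
  have [lt|le] := ltP t y.
    have yt : (y < t) = false by rewrite ltNge (ltW lt).
    by rewrite (lt_trans lt yz) yt !addr0.
  have gt : y < t by rewrite lt_neqAle eq_sym ty.
  by rewrite (lt_trans xy gt) gt andbF !add0r.
rewrite /crossing_sum -/f E /f; lia.
Qed.

(** On a short interval that starts at t the sum is [rjump t], on one that ends at t it is
    [- ljump t]; these are the increments found in [jump_one_side]. The convention of n_+ at the
    start and n_- at the end is what makes the formula the increment of a positive index. *)
Lemma dh_crossing_sum Y (c d : R) : lagr Y -> trans G Y -> c < d ->
  (forall t, c <= t <= d -> trans (F t) Y /\ regular F L0 t) ->
  (forall t, c < t < d -> crossing F L0 t -> t \in s) ->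
  dh Y (F c) (F d) G = crossing_sum c d.
Proof.
move=> lY uG cd reg sP.
apply: (@interval_chain _ (fun x y => dh Y (F x) (F y) G = crossing_sum x y)) => //.
  move=> x y z cx xy yz zd Exy Eyz.
  rewrite (@crossing_sum_add x y z) // -?Exy -?Eyz.
    by rewrite /dh; clear; lia.
  by apply: sP; rewrite (le_lt_trans cx xy) (lt_le_trans yz zd).
move=> t tcd; have [ut rt] := reg t tcd.
have Hr := jump_one_side lF dF lG GL (or_introl (erefl (1 : R))) lY ut uG rt.
have Hl := jump_one_side lF dF lG GL (or_intror (erefl (-1 : R))) lY ut uG rt.
move/nbhs_ballP: Hr => [e1 /= e10 H1]; move/nbhs_ballP: Hl => [e2 /= e20 H2].
have noc (x y : R) : (forall t', x < t' -> t' < y -> ~~ crossing F L0 t') ->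
    \sum_(t' <- s | x < t' < y) ((rjump F L0 t')%:Z - (ljump F L0 t')%:Z) = 0.
  by move=> nc; apply: big1 => t' /andP [a b];
    rewrite (rjump0 (nc _ a b)) (ljump0 (nc _ a b)) subrr.
have K1 y : t < y -> y < t + e1 ->
    hi Y (F y) G = (hi Y (F t) G + rjump F L0 t)%N /\ ~~ crossing F L0 y.
  move=> ty ye; have := H1 (y - t); rewrite mul1r subrKC eqxx; apply.
    by rewrite /ball /= sub0r normrN gtr0_norm ?subr_gt0 // ltrBlDl.
  by rewrite subr_gt0.
have K2 y : y < t -> t - e2 < y ->
    hi Y (F y) G = (hi Y (F t) G + ljump F L0 t)%N /\ ~~ crossing F L0 y.
  move=> ty ye; have := H2 (t - y); rewrite mulN1r opprB subrKC ifF; last first.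
    by apply/eqP; lra.
  apply; last by rewrite subr_gt0.
  by rewrite /ball /= sub0r normrN gtr0_norm ?subr_gt0 // ltrBlDl -ltrBlDr.
exists (Num.min e1 e2); first by rewrite lt_min e10.
split=> [x cx xt1 xt2|y yd ty1 ty2].
  have xe : t - e2 < x.
    by apply: le_lt_trans xt1; rewrite lerD2l lerN2 ge_min lexx orbT.
  have [h nc] := K2 _ xt2 xe.
  rewrite /dh h /crossing_sum (rjump0 nc) noc; first by clear; lia.
  by move=> t' a b; have [] := K2 _ b (lt_trans xe a).
have ye : y < t + e1.
  by apply: lt_le_trans ty2 _; rewrite lerD2l ge_min lexx.
have [h nc] := K1 _ ty1 ye.
rewrite /dh h /crossing_sum (ljump0 nc) noc; first by clear; lia.
by move=> t' a b; have [] := K1 _ a (lt_trans b ye).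
Qed.

End CrossingSum.

(** * Homotopy invariance *)

Section Grid.
Variables (R : realType) (n : nat).
Local Notation frame := 'M[R]_(n, n + n).
Local Notation Om := (Om R n).
Implicit Types Y G W : frame.

Variables (T : R) (H : R -> R -> frame).
Hypothesis T0 : 0 < T.
Definition rect : set (R * R) := [set st | 0 <= st.1 <= 1 /\ 0 <= st.2 <= T].
Hypothesis lH : forall s t : R, 0 <= s <= 1 -> 0 <= t <= T -> lagr (H s t).
Hypothesis cH : forall p, rect p ->
  mcvg (within rect (nbhs p)) (fun q => H q.1 q.2) (H p.1 p.2).

Lemma compact_rect : compact rect.
Proof.
have -> : rect = `[0, 1]%classic `*` `[0, T]%classic.
  by apply/seteqP; split => -[x y] /=; rewrite !in_itv.
by apply: compact_setX; exact: segment_compact.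
Qed.

(** The box reaches one mesh width to both sides of x, so the chart attached to a grid node contains
    H on the closed cell that has this node as its lower left corner. *)
Definition cell_good (Gs : seq frame) (N : nat) (x : R * R) W : Prop :=
  [/\ lagr W, forall G, G \in Gs -> trans G W &
      forall y, rect y -> `|y.1 - x.1| <= N%:R^-1 -> `|y.2 - x.2| <= T / N%:R ->
        trans (H y.1 y.2) W].

(** A Lebesgue number for the cover of the compact rectangle by the domains of charts. *)
Lemma grid_cover (Gs : seq frame) : (forall G, G \in Gs -> lagr G) ->
  \forall N \near \oo, forall x, rect x -> exists W, cell_good Gs N x W.
Proof.
move=> lGs; have cov := (compact_near_coveringP rect).1 compact_rect.
suff : \forall N \near \oo, rect `<=` (fun x => exists W, cell_good Gs N x W) by [].
apply: cov => x xr.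
have [|W [lW HW]] := @common_trans R n (H x.1 x.2 :: Gs).
  move=> G; rewrite inE => /orP [/eqP ->|/lGs //].
  by case: xr => a b; exact: lH.
have uW : trans (H x.1 x.2) W by apply: HW; rewrite inE eqxx.
have uN : nbhs x (fun q => rect q -> trans (H q.1 q.2) W).
  exact: (trans_near (F := within rect (nbhs x)) (cH xr) uW).
have /nbhs_ballP [e /= e0 He] := uN.
have e20 : 0 < e / 2 by rewrite divr_gt0.
exists (ball x (e / 2), [set N | N%:R^-1 < e / 2 /\ T / N%:R < e / 2]).
  split; first exact: nbhsx_ballx.
  near=> N.
  have N1 : 2 / e < N%:R by near: N; exact: nbhs_infty_gtr.
  have N2 : T * 2 / e < N%:R by near: N; exact: nbhs_infty_gtr.
  have N0 : (0 : R) < N%:R by apply: lt_trans N1; rewrite divr_gt0.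
  split.
    by rewrite invf_plt ?posrE // invf_div.
  by rewrite ltr_pdivrMr // mulrC mulrA ltr_pdivlMr // -ltr_pdivrMr.
move=> [y N] /= [[y1 y2] [N1 N2]]; exists W; split => //.
  by move=> G Gs'; apply: HW; rewrite inE Gs' orbT.
move=> z zr z1 z2; apply: He => //; split => /=.
  rewrite (splitr e); apply: ball_triangle y1 _; rewrite /ball /= distrC.
  exact: le_lt_trans z1 N1.
rewrite (splitr e); apply: ball_triangle y2 _; rewrite /ball /= distrC.
exact: le_lt_trans z2 N2.
Unshelve. all: by end_near.
Qed.

Lemma mcvg_hor (s c d t : R) : 0 <= s <= 1 -> 0 <= c -> d <= T -> c <= t <= d ->
  mcvg (within `[c, d] (nbhs t)) (H s) (H s t).
Proof.
move=> s01 c0 dT /andP [ct td] i j.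
have r : rect (s, t) by split => //=; rewrite (le_trans c0 ct) (le_trans td dT).
have C : (fun t' => (s, t')) @ within `[c, d] (nbhs t) --> within rect (nbhs (s, t)).
  move=> A; rewrite /= !nbhs_simpl /= => /nbhs_ballP [e /= e0 He].
  apply/nbhs_ballP; exists e => // t' tt' cd; apply: He.
    by split => //=; exact: ballxx.
  by move: cd; rewrite /= in_itv /= => /andP [a b]; split => //=;
    rewrite (le_trans c0 a) (le_trans b dT).
have h : (fun q => H q.1 q.2 i j) @ within rect (nbhs (s, t)) --> H s t i j.
  exact: (@cH (s, t) r i j).
exact: cvg_comp C h.
Qed.

Lemma mcvg_ver (t c d s : R) : 0 <= t <= T -> 0 <= c -> d <= 1 -> c <= s <= d ->
  mcvg (within `[c, d] (nbhs s)) (H^~ t) (H s t).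
Proof.
move=> t0T c0 d1 /andP [cs sd] i j.
have r : rect (s, t) by split => //=; rewrite (le_trans c0 cs) (le_trans sd d1).
have C : (fun s' => (s', t)) @ within `[c, d] (nbhs s) --> within rect (nbhs (s, t)).
  move=> A; rewrite /= !nbhs_simpl /= => /nbhs_ballP [e /= e0 He].
  apply/nbhs_ballP; exists e => // s' ss' cd; apply: He.
    by split => //=; exact: ballxx.
  by move: cd; rewrite /= in_itv /= => /andP [a b]; split => //=;
    rewrite (le_trans c0 a) (le_trans b d1).
have h : (fun q => H q.1 q.2 i j) @ within rect (nbhs (s, t)) --> H s t i j.
  exact: (@cH (s, t) r i j).
exact: cvg_comp C h.
Qed.

Variable N : nat.
Hypothesis N0 : (0 < N)%N.
Definition sN (i : nat) : R := i%:R / N%:R.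
Definition tN (j : nat) : R := T * sN j.

Let Nr : (0 : R) < N%:R. Proof. by rewrite ltr0n. Qed.

Lemma sN0 : sN 0 = 0. Proof. by rewrite /sN mul0r. Qed.
Lemma sNN : sN N = 1. Proof. by rewrite /sN mulfV // gt_eqF. Qed.
Lemma tN0 : tN 0 = 0. Proof. by rewrite /tN sN0 mulr0. Qed.
Lemma tNN : tN N = T. Proof. by rewrite /tN sNN mulr1. Qed.
Lemma sNS i : sN i.+1 = sN i + N%:R^-1.
Proof. by rewrite /sN -natr1 mulrDl mul1r. Qed.
Lemma tNS j : tN j.+1 = tN j + T / N%:R.
Proof. by rewrite /tN sNS mulrDr. Qed.
Lemma sN_ge0 i : 0 <= sN i. Proof. by rewrite /sN divr_ge0 // ltW. Qed.
Lemma tN_ge0 i : 0 <= tN i. Proof. by rewrite /tN mulr_ge0 ?sN_ge0 // ltW. Qed.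
Lemma sN_le1 i : (i <= N)%N -> sN i <= 1.
Proof. by move=> iN; rewrite /sN ler_pdivrMr // mul1r ler_nat. Qed.
Lemma tN_leT i : (i <= N)%N -> tN i <= T.
Proof. by move=> iN; rewrite /tN ler_piMr ?sN_le1 // ltW. Qed.
Lemma sN_lt i : sN i < sN i.+1.
Proof. by rewrite sNS ltrDl invr_gt0. Qed.
Lemma tN_lt i : tN i < tN i.+1.
Proof. by rewrite tNS ltrDl divr_gt0. Qed.

Variables (Gs : seq frame) (W : nat -> nat -> frame).
Hypothesis HW : forall i j, (i <= N)%N -> (j <= N)%N ->
  cell_good Gs N (sN i, tN j) (W i j).

(** Indices equal to N are allowed: such a cell is cut down to an edge by s <= 1 or t <= T, and
    these charts serve the last row and column. *)
Lemma cell_trans i j (s t : R) : (i <= N)%N -> (j <= N)%N ->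
  sN i <= s <= sN i.+1 -> s <= 1 -> tN j <= t <= tN j.+1 -> t <= T ->
  trans (H s t) (W i j).
Proof.
move=> iN jN /andP [s1 s2] s01 /andP [t1 t2] tT.
have [_ _ /(_ (s, t)) h] := HW iN jN; apply: h => /=.
- by split => /=; rewrite ?(le_trans (sN_ge0 i) s1) ?(le_trans (tN_ge0 j) t1).
- by rewrite ger0_norm ?subr_ge0 // lerBlDl -sNS.
- by rewrite ger0_norm ?subr_ge0 // lerBlDl -tNS.
Qed.

Variable G : frame.
Hypotheses (lG : lagr G) (Gin : G \in Gs).
Hypothesis H0 : forall s : R, 0 <= s <= 1 -> (H s 0 :=: H 0 0)%MS.
Hypothesis HT : forall s : R, 0 <= s <= 1 -> (H s T :=: H 0 T)%MS.

Let lW i j : (i <= N)%N -> (j <= N)%N -> lagr (W i j).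
Proof. by move=> iN jN; have [] := HW iN jN. Qed.
Let uG i j : (i <= N)%N -> (j <= N)%N -> trans G (W i j).
Proof. by move=> iN jN; have [_ h _] := HW iN jN; exact: h. Qed.

Lemma sum_telescope (M : nat) (a b v : nat -> int) :
  (forall j, (j < M)%N -> b j = a j + (v j.+1 - v j)) -> v M = v 0%N ->
  \sum_(j < M) a j = \sum_(j < M) b j.
Proof.
move=> ab v0; have -> : \sum_(j < M) b j = \sum_(j < M) (a j + (v j.+1 - v j)).
  by apply: eq_bigr => j _; exact: ab.
rewrite big_split /= -(big_mkord xpredT (fun j => v j.+1 - v j)).
by rewrite telescope_sumr // v0 subrr addr0.
Qed.

(** In the chart [W i j] the increments around the cell sum to zero. [dh_edge] rereads the edge with
    s = [sN i.+1] in [W i.+1 j] and the edge with t = [tN j.+1] in [W i j.+1], after which the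
    increments in the s direction telescope. *)
Lemma grid_row i : (i < N)%N ->
  \sum_(j < N) dh (W i j) (H (sN i) (tN j)) (H (sN i) (tN j.+1)) G =
  \sum_(j < N) dh (W i.+1 j) (H (sN i.+1) (tN j)) (H (sN i.+1) (tN j.+1)) G.
Proof.
move=> iN; have iN' := ltnW iN.
have s01 : 0 <= sN i <= 1 by rewrite sN_ge0 sN_le1.
have s01' : 0 <= sN i.+1 <= 1 by rewrite sN_ge0 sN_le1.
pose v j := dh (W i j) (H (sN i) (tN j)) (H (sN i.+1) (tN j)) G.
have key j (jN : (j < N)%N) :
    dh (W i.+1 j) (H (sN i.+1) (tN j)) (H (sN i.+1) (tN j.+1)) G =
    dh (W i j) (H (sN i) (tN j)) (H (sN i) (tN j.+1)) G + (v j.+1 - v j).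
  have jN' := ltnW jN.
  have <- : dh (W i j) (H (sN i.+1) (tN j)) (H (sN i.+1) (tN j.+1)) G =
      dh (W i.+1 j) (H (sN i.+1) (tN j)) (H (sN i.+1) (tN j.+1)) G.
    apply: dh_edge; rewrite ?(ltW (tN_lt _)) //; do ?[exact: lW|exact: uG].
    move=> t tj; have /andP [t1 t2] := tj.
    have tT : t <= T := le_trans t2 (tN_leT jN).
    have t00 : 0 <= t := le_trans (tN_ge0 j) t1.
    split.
    - by apply: lH => //; rewrite t00.
    - by apply: cell_trans => //; [rewrite (ltW (sN_lt i)) lexx|exact: sN_le1].
    - by apply: cell_trans => //; [rewrite lexx (ltW (sN_lt _))|exact: sN_le1].
    - by apply: mcvg_hor => //; [exact: tN_ge0|exact: tN_leT].
  have -> : v j.+1 = dh (W i j) (H (sN i) (tN j.+1)) (H (sN i.+1) (tN j.+1)) G.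
    apply: (dh_edge (g := H^~ (tN j.+1)));
      rewrite ?(ltW (sN_lt _)) //; do ?[exact: lW|exact: uG].
    move=> s si; have /andP [s1 s2] := si.
    have s1' : s <= 1 := le_trans s2 (sN_le1 iN).
    have s0 : 0 <= s := le_trans (sN_ge0 i) s1.
    split.
    - by apply: lH; rewrite ?s0 ?tN_ge0 ?tN_leT.
    - by apply: cell_trans => //; [rewrite lexx (ltW (tN_lt _))|exact: tN_leT].
    - by apply: cell_trans => //; [rewrite lexx (ltW (tN_lt _))|exact: tN_leT].
    - by apply: mcvg_ver => //; rewrite ?tN_ge0 ?tN_leT ?sN_ge0 ?sN_le1.
  by rewrite /v /dh; lia.
(* At t = 0 and t = T the frames may change with s but their span does not, and [hi] sees only the
   span. *)
have vz j : (j <= N)%N -> (H (sN i.+1) (tN j) :=: H (sN i) (tN j))%MS -> v j = 0.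
  move=> jN e; rewrite /v /dh (hi_eq (F := H (sN i) (tN j)) (G := G)) ?subrr //.
  - apply: cell_trans => //; rewrite ?lexx ?(ltW (sN_lt _)) ?(ltW (tN_lt _)) //.
      exact: sN_le1.
    exact: tN_leT.
  - exact: uG.
  - by have [] : lagr (H (sN i) (tN j)) by apply: lH; rewrite // tN_ge0 tN_leT.
  - by case: lG.
apply: (sum_telescope key); rewrite !vz // ?tN0 ?tNN.
- exact: eqmx_trans (H0 s01') (eqmx_sym (H0 s01)).
- exact: eqmx_trans (HT s01') (eqmx_sym (HT s01)).
Qed.

Lemma grid_sum :
  \sum_(j < N) dh (W 0 j) (H 0 (tN j)) (H 0 (tN j.+1)) G =
  \sum_(j < N) dh (W N j) (H 1 (tN j)) (H 1 (tN j.+1)) G.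
Proof.
have E i : (i <= N)%N ->
  \sum_(j < N) dh (W 0 j) (H (sN 0) (tN j)) (H (sN 0) (tN j.+1)) G =
  \sum_(j < N) dh (W i j) (H (sN i) (tN j)) (H (sN i) (tN j.+1)) G.
  elim: i => [_|i IH iN]; first by [].
  have h1 := IH (ltnW iN); have h2 := grid_row iN.
  exact (etrans h1 h2).
by have := E N (leqnn N); rewrite sN0 sNN.
Qed.

End Grid.

(** * From crossing sums to increments along the given path *)

Section Comparison.
Variables (R : realType) (n : nat).
Local Notation frame := 'M[R]_(n, n + n).
Local Notation Om := (Om R n).
Implicit Types G : frame.

Lemma lagrangian_lagr (F : frame) : lagrangian F -> lagr F.
Proof. by case/lagrangian_frame => G [lG GF]; exact: lagr_eqmx lG (eqmx_sym GF). Qed.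

Lemma dh_eq Y A A' B B' G : trans A Y -> trans B Y -> trans G Y ->
  row_free A -> row_free B -> row_free G ->
  (A' :=: A)%MS -> (B' :=: B)%MS -> dh Y A' B' G = dh Y A B G.
Proof.
move=> uA uB uG fA fB fG eA eB.
by rewrite /dh (hi_eq uA uG fA fG eA (eqmx_refl _)) (hi_eq uB uG fB fG eB (eqmx_refl _)).
Qed.

Variables (T : R) (P : R -> 'M[R]_(n + n)).
Hypothesis T0 : 0 < T.

Definition good_cells (Gs : seq frame) (E : R -> frame) N (W : nat -> frame) :=
  forall j, (j < N)%N -> [/\ lagr (W j), forall G, G \in Gs -> trans G (W j) &
    forall t, tN T N j <= t <= tN T N j.+1 -> trans (E t) (W j)].

(** [E] is [H 0], a continuous frame of P itself: the row s = 1 of the grid gives the crossing sum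
    of F, and the row s = 0 transfers it to P. N stays free and the charts contain all of [Gs], so
    that two such results can be put on one grid. *)
Lemma clm_sum_grid (Gs : seq frame) (L0 : 'M[R]_(n + n)) G (F : R -> frame) k :
  (forall A, A \in Gs -> lagr A) -> G \in Gs -> (G :=: L0)%MS ->
  C1_lagr_frame F -> homotopic_rel 0 T P F -> clm_sum L0 0 T F k ->
  exists E : R -> frame,
    [/\ forall t, 0 <= t <= T -> lagr (E t) /\ (E t :=: P t)%MS,
        forall c d t, 0 <= c -> d <= T -> c <= t <= d ->
          mcvg (within `[c, d] (nbhs t)) E (E t) &
        \forall N \near \oo, exists W, good_cells Gs E N W /\
          k = \sum_(j < N) dh (W j) (E (tN T N j)) (E (tN T N j.+1)) G].
Proof.
move=> lGs Gin GL [lF' dF'] [H [lH' [cH' [H01 Hab]]]] [s [us [sP [reg kE]]]].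
have lF t : lagr (F t) by exact: lagrangian_lagr.
have dF i j t : derivable (fun s => F s i j) t 1 by have [h _] := dF' i j; exact: h.
have lH (s' t : R) : 0 <= s' <= 1 -> 0 <= t <= T -> lagr (H s' t).
  by move=> a b; apply: lagrangian_lagr; exact: lH'.
have cH p : rect T p -> mcvg (within (rect T) (nbhs p)) (fun q => H q.1 q.2) (H p.1 p.2).
  move=> pr i j; have h := (subspace_continuousP _ _).1 (cH' i j) p pr.
 exact: h.
have z01 : 0 <= (0 : R) <= 1 by rewrite lexx ler01.
have o01 : 0 <= (1 : R) <= 1 by rewrite lexx ler01.
have z0T : 0 <= (0 : R) <= T by rewrite lexx ltW.
have T0T : 0 <= T <= T by rewrite lexx ltW.
have lG := lGs _ Gin.
exists (H 0); split.
- move=> t t0T; split; first exact: lH.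
  by apply/eqmxP; have [] := H01 t t0T.
- by move=> c d t c0 dT tcd; exact: (mcvg_hor cH).
near=> N.
have N0 : (0 < N)%N by near: N; exact: nbhs_infty_gt.
have cov : forall x, rect T x -> exists W, cell_good T H Gs N x W.
  by near: N; exact: grid_cover.
have /choice [W HW] : forall ij : nat * nat, exists W,
    (ij.1 <= N)%N -> (ij.2 <= N)%N -> cell_good T H Gs N (sN R N ij.1, tN T N ij.2) W.
  move=> [i j] /=; have [/andP [iN jN]|nij] := boolP ((i <= N)%N && (j <= N)%N).
    have [|A HA] := cov (sN R N i, tN T N j).
      by split => /=; rewrite ?sN_ge0 ?tN_ge0 ?sN_le1 ?tN_leT.
    by exists A.
  by exists 0 => iN jN; rewrite iN jN in nij.
pose W' i j := W (i, j).
have HW' i j : (i <= N)%N -> (j <= N)%N ->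
    cell_good T H Gs N (sN R N i, tN T N j) (W' i j) by exact: (HW (i, j)).
have eP (s' : R) : 0 <= s' <= 1 -> (H s' 0 :=: H 0 0)%MS /\ (H s' T :=: H 0 T)%MS.
  move=> s01; have [/eqmxP a /eqmxP b] := Hab s' s01.
  have [/eqmxP c /eqmxP d] := Hab 0 z01.
  by split; [exact: eqmx_trans a (eqmx_sym c)|exact: eqmx_trans b (eqmx_sym d)].
have Ew i j : (i <= N)%N -> (j < N)%N -> trans G (W' i j) /\ lagr (W' i j).
  by move=> iN jN; have [a b _] := HW' i j iN (ltnW jN); split => //; exact: b.
have utop j t : (j < N)%N -> tN T N j <= t <= tN T N j.+1 -> trans (H 1 t) (W' N j).
  move=> jN tj; have /andP [_ t2] := tj.
  apply: (cell_trans T0 HW') => //; rewrite ?(ltnW jN) ?sNN ?lexx //=.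
    by rewrite -{1}(sNN R N0) ltW // sN_lt.
  exact: le_trans t2 (tN_leT T0 N0 jN).
exists (W' 0); split.
  move=> j jN; have [a b _] := HW' 0%N j (leq0n _) (ltnW jN).
  split => // t tj; have /andP [_ t2] := tj.
  apply: (cell_trans T0 HW') => //; rewrite ?(ltnW jN) ?sN0 ?lexx ?ler01 //=.
    by rewrite -{1}(sN0 R N) ltW // sN_lt.
  exact: le_trans t2 (tN_leT T0 N0 jN).
rewrite (grid_sum T0 lH cH N0 HW' lG Gin (fun s h => (eP s h).1) (fun s h => (eP s h).2)).
have HF t : 0 <= t <= T -> (F t :=: H 1 t)%MS.
  by move=> t0T; apply: eqmx_sym; apply/eqmxP; have [] := H01 t t0T.
have tj0T j : (j <= N)%N -> 0 <= tN T N j <= T by move=> jN; rewrite tN_ge0 ?tN_leT.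
have -> : \sum_(j < N) dh (W' N j) (H 1 (tN T N j)) (H 1 (tN T N j.+1)) G =
    \sum_(j < N) crossing_sum F L0 s (tN T N j) (tN T N j.+1).
  apply: eq_bigr => j _; have jN := ltn_ord j.
  have [uG lW] := Ew N j (leqnn _) jN.
  have tl := tN_lt T0 N0 j.
  apply: etrans; last (apply: (dh_crossing_sum lF dF lG GL us lW uG); first by []).
  - apply: dh_eq; rewrite ?(lF _).1 ?lG.1 //.
    + rewrite (trans_eqmx _ _ (HF _ _)); last exact: tj0T (ltnW jN).
        by apply: utop; rewrite ?lexx ?ltW.
      by case: (lH 1 (tN T N j) o01 (tj0T _ (ltnW jN))).
    + rewrite (trans_eqmx _ _ (HF _ _)); last exact: tj0T jN.
        by apply: utop; rewrite ?lexx ?ltW.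
      by case: (lH 1 (tN T N j.+1) o01 (tj0T _ jN)).
    + by apply: eqmx_sym; apply: HF; exact: tj0T (ltnW jN).
    + by apply: eqmx_sym; apply: HF; exact: tj0T jN.
  - move=> t tj; have /andP [t1 t2] := tj.
    have t0T : 0 <= t <= T.
      by rewrite (le_trans _ t1) ?tN_ge0 // (le_trans t2) // tN_leT.
    split; last exact: reg.
    rewrite (trans_eqmx _ _ (HF _ t0T)); first exact: utop.
    by case: (lH 1 t o01 t0T).
  - move=> t /andP [t1 t2] ct; apply/sP; split => //.
    by rewrite (le_lt_trans _ t1) ?tN_ge0 // (lt_le_trans t2) // tN_leT.
(* The induction starts with one interval because the crossing sum over a single point, n_+ - n_-
   there, need not vanish. *)
have csum m : (m < N)%N -> \sum_(j < m.+1) crossing_sum F L0 s (tN T N j) (tN T N j.+1)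
    = crossing_sum F L0 s (tN T N 0) (tN T N m.+1).
  elim: m => [|m IH] mN; first by rewrite big_ord1.
  rewrite big_ord_recr /= IH ?(ltnW mN) // -crossing_sum_add //.
  - rewrite tN0; apply: le_lt_trans (tN_lt T0 N0 m); exact: tN_ge0.
  - exact: tN_lt.
  - move=> cm; apply/sP; split => //.
    rewrite (le_lt_trans _ (tN_lt T0 N0 m)) ?tN_ge0 //=.
    by rewrite (lt_le_trans (tN_lt T0 N0 m.+1)) // tN_leT.
have -> : \sum_(j < N) crossing_sum F L0 s (tN T N j) (tN T N j.+1) = crossing_sum F L0 s 0 T.
  by have := csum N.-1; rewrite (prednK N0) leqnn tN0 (tNN T N0); apply.
rewrite kE /crossing_sum; congr (_ + _ - _).
rewrite [RHS]big_seq_cond [LHS]big_seq_cond; apply: eq_bigl => t.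
rewrite andbT; have [ts|//] := boolP (t \in s).
by have [/andP [-> ->]] := (sP t).1 ts.
Unshelve. all: by end_near.
Qed.

End Comparison.

(** * Change of the reference Lagrangian *)

Section Difference.
Variables (R : realType) (n : nat).
Local Notation frame := 'M[R]_(n, n + n).
Implicit Types A G W Y : frame.

(** In every chart that contains A, G1 and G2 this is n + hi(A,G1) + hi(G1,G2) - hi(A,G2), yet no
    chart enters its definition. *)
Definition kash_ind A G1 G2 : nat := (posi (kash A G1 G2) + \rank (A :&: G2)%MS)%N.

Lemma dh_kash Y A B G1 G2 : lagr Y -> lagr A -> lagr B -> lagr G1 -> lagr G2 ->
  trans A Y -> trans B Y -> trans G1 Y -> trans G2 Y ->
  dh Y A B G2 - dh Y A B G1 = (kash_ind A G1 G2)%:Z - (kash_ind B G1 G2)%:Z.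
Proof.
move=> lY lA lB l1 l2 uA uB u1 u2.
have a1 := hi_kash lY lA l1 l2 uA u1 u2; have b1 := hi_kash lY lB l1 l2 uB u1 u2.
have a2 := hi_opp lY lA l2 uA u2; have b2 := hi_opp lY lB l2 uB u2.
rewrite /dh /kash_ind -a1 -b1; clear -a2 b2; lia.
Qed.

Lemma sum_telescope_int (M : nat) (f : nat -> int) (d : nat -> int) :
  (forall j, (j < M)%N -> d j = f j - f j.+1) ->
  \sum_(j < M) d j = f 0%N - f M.
Proof.
elim: M => [|M IH] H; first by rewrite big_ord0 subrr.
rewrite big_ord_recr /= H // IH; last by move=> j jM; apply: H; exact: ltnW.
by rewrite addrA subrK.
Qed.

(** On each interval of a common grid the difference of the increments is a difference of two values
    of [kash_ind], whatever the chart, so the sum telescopes. The end values are then rewritten in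
    W, which contains the end points and both references while the path may leave it. *)
Lemma clm_sum_diff (T : R) (P : R -> 'M[R]_(n + n)) (L1 L2 : 'M[R]_(n + n))
    G1 G2 A B W (F1 F2 : R -> frame) k1 k2 :
  0 < T -> lagr G1 -> lagr G2 -> (G1 :=: L1)%MS -> (G2 :=: L2)%MS ->
  C1_lagr_frame F1 -> homotopic_rel 0 T P F1 -> clm_sum L1 0 T F1 k1 ->
  C1_lagr_frame F2 -> homotopic_rel 0 T P F2 -> clm_sum L2 0 T F2 k2 ->
  (A :=: P 0)%MS -> (B :=: P T)%MS -> lagr A -> lagr B ->
  lagr W -> trans A W -> trans B W -> trans G1 W -> trans G2 W ->
  k2 - k1 = dh W A B G2 - dh W A B G1.
Proof.
move=> T0 l1 l2 GL1 GL2 c1 h1 s1 c2 h2 s2 eA eB lA lB lW uA uB u1 u2.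
pose Gs := [:: G1; G2].
have lGs G : G \in Gs -> lagr G by rewrite !inE => /orP [] /eqP ->.
have G1in : G1 \in Gs by rewrite !inE eqxx.
have G2in : G2 \in Gs by rewrite !inE eqxx orbT.
have [E1 [E1P E1c E1s]] := clm_sum_grid T0 lGs G1in GL1 c1 h1 s1.
have [E2 [E2P E2c E2s]] := clm_sum_grid T0 lGs G2in GL2 c2 h2 s2.
have [N [[[W1 [g1 k1E]] [W2 [g2 k2E]]] N0]] :=
  filter_ex (filterI (filterI E1s E2s) (nbhs_infty_gt 0%N)).
have tj0T j : (j <= N)%N -> 0 <= tN T N j <= T by move=> jN; rewrite tN_ge0 ?tN_leT.
have t0T j t : (j < N)%N -> tN T N j <= t <= tN T N j.+1 -> 0 <= t <= T.
  move=> jN /andP [a b].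
  by rewrite (le_trans _ a) ?tN_ge0 // (le_trans b) // tN_leT.
have E12 t : 0 <= t <= T -> (E2 t :=: E1 t)%MS.
  by move=> tt; apply: eqmx_trans (E2P t tt).2 (eqmx_sym (E1P t tt).2).
have step j : (j < N)%N ->
    dh (W2 j) (E2 (tN T N j)) (E2 (tN T N j.+1)) G2 -
    dh (W1 j) (E1 (tN T N j)) (E1 (tN T N j.+1)) G1 =
    (kash_ind (E1 (tN T N j)) G1 G2)%:Z - (kash_ind (E1 (tN T N j.+1)) G1 G2)%:Z.
  move=> jN; have [lW1 uG1 uE1] := g1 j jN; have [lW2 uG2 uE2] := g2 j jN.
  have tj : tN T N j <= tN T N j <= tN T N j.+1 by rewrite lexx ltW // tN_lt.
  have tj' : tN T N j <= tN T N j.+1 <= tN T N j.+1 by rewrite lexx ltW // tN_lt.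
  have lE1 t : tN T N j <= t <= tN T N j.+1 -> lagr (E1 t).
    by move=> tt; exact: (E1P t (t0T _ _ jN tt)).1.
  have uE2' t : tN T N j <= t <= tN T N j.+1 -> trans (E1 t) (W2 j).
    move=> tt; rewrite -(trans_eqmx _ (lE1 t tt).1 (E12 t (t0T _ _ jN tt))).
    exact: uE2.
  have -> : dh (W2 j) (E2 (tN T N j)) (E2 (tN T N j.+1)) G2 =
            dh (W2 j) (E1 (tN T N j)) (E1 (tN T N j.+1)) G2.
    apply: dh_eq; [exact: uE2'|exact: uE2'|exact: uG2|exact: (lE1 _ tj).1| | | |].
    - exact: (lE1 _ tj').1.
    - exact: l2.1.
    - exact: E12 (tj0T _ (ltnW jN)).
    - exact: E12 (tj0T _ jN).
  have -> : dh (W2 j) (E1 (tN T N j)) (E1 (tN T N j.+1)) G2 =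
            dh (W1 j) (E1 (tN T N j)) (E1 (tN T N j.+1)) G2.
    apply: dh_edge; [by rewrite ltW // tN_lt|exact: lW2|exact: lW1|exact: l2| | |].
    - exact: uG2.
    - exact: uG1.
    - move=> t tt; split; [exact: lE1|exact: uE2'|exact: uE1|].
      by apply: E1c => //; [exact: tN_ge0|exact: tN_leT].
  exact: (dh_kash lW1 (lE1 _ tj) (lE1 _ tj') l1 l2 (uE1 _ tj) (uE1 _ tj')
    (uG1 _ G1in) (uG1 _ G2in)).
have D : k2 - k1 = (kash_ind (E1 0) G1 G2)%:Z - (kash_ind (E1 T) G1 G2)%:Z.
  have S := sum_telescope_int (f := fun j => (kash_ind (E1 (tN T N j)) G1 G2)%:Z) step.
  rewrite /= tN0 (tNN T N0) in S.
  by rewrite k1E k2E -sumrB; exact S.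
have z0T : 0 <= (0 : R) <= T by rewrite lexx ltW.
have T0T : 0 <= T <= T by rewrite lexx ltW.
have eA' : (E1 0 :=: A)%MS by apply: eqmx_trans (E1P 0 z0T).2 (eqmx_sym eA).
have eB' : (E1 T :=: B)%MS by apply: eqmx_trans (E1P T T0T).2 (eqmx_sym eB).
have [fA fB] := (lA.1, lB.1).
have lE0 := (E1P 0 z0T).1; have lET := (E1P T T0T).1.
have uE0 : trans (E1 0) W by rewrite (trans_eqmx _ fA eA').
have uET : trans (E1 T) W by rewrite (trans_eqmx _ fB eB').
rewrite D -(dh_kash lW lE0 lET l1 l2 uE0 uET u1 u2).
by rewrite (dh_eq uA uB u2 fA fB l2.1 eA' eB') (dh_eq uA uB u1 fA fB l1.1 eA' eB').
Qed.

(** Numbers in [0, n - d] and [0, n - d'] differ by at most n - min(d, d'); the outer maximum arises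
    because the same quantity is such a difference in two ways. *)
Lemma dh_bound W A B G1 G2 : lagr W -> lagr A -> lagr B -> lagr G1 -> lagr G2 ->
  trans A W -> trans B W -> trans G1 W -> trans G2 W ->
  `| dh W A B G2 - dh W A B G1 | <= n%:Z -
    (maxn (minn (\rank (A :&: B + B :&: G1)%MS) (\rank (A :&: B + B :&: G2)%MS))
          (minn (\rank (A :&: G1 + G1 :&: G2)%MS) (\rank (B :&: G1 + G1 :&: G2)%MS)))%:Z.
Proof.
move=> lW lA lB l1 l2 uA uB u1 u2.
have e1 := hi_ub lW lA lB l1 uA uB u1; have e1' := hi_add lW lA lB l1 uA uB u1.
have e2 := hi_ub lW lA lB l2 uA uB u2; have e2' := hi_add lW lA lB l2 uA uB u2.
have d1 := hi_ub lW lA l1 l2 uA u1 u2; have d1' := hi_add lW lA l1 l2 uA u1 u2.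
have d2 := hi_ub lW lB l1 l2 uB u1 u2; have d2' := hi_add lW lB l1 l2 uB u1 u2.
rewrite /dh; clear -e1 e1' e2 e2' d1 d1' d2 d2'; lia.
Qed.

End Difference.

(** * Existence of regular representatives *)

Section MatrixDerivatives.
Variable R : realType.

Definition mder m k (F : R -> 'M[R]_(m, k)) (t : R) (D : 'M[R]_(m, k)) : Prop :=
  forall i j, is_derive t (1 : R) (fun s => F s i j) (D i j).

Lemma is_derive_bigsum (m : nat) (h : 'I_m -> R -> R) (t : R) (d : 'I_m -> R) :
  (forall i, is_derive t (1 : R) (h i) (d i)) ->
  is_derive t (1 : R) (fun s => \sum_(i < m) h i s) (\sum_(i < m) d i).
Proof.
move=> H; have -> : (fun s => \sum_(i < m) h i s) = \sum_(i < m) h i.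
  by apply/funext => s; rewrite fct_sumE.
exact: is_derive_sum.
Qed.

Lemma is_derive_mul (f g : R -> R) (t a b : R) : is_derive t (1 : R) f a ->
  is_derive t (1 : R) g b -> is_derive t (1 : R) (fun s => f s * g s) (a * g t + f t * b).
Proof.
move=> fa gb; have H := is_deriveM fa gb.
apply: (@is_derive_eq _ _ _ _ _ _ _ _ H).
by rewrite /GRing.scale /= addrC mulrC.
Qed.

Lemma mder_cst m k (A : 'M[R]_(m, k)) t : mder (fun=> A) t 0.
Proof. by move=> i j; rewrite mxE; exact: is_derive_cst. Qed.

Lemma mder_tr m k (F : R -> 'M[R]_(m, k)) t D : mder F t D ->
  mder (fun s => (F s)^T) t D^T.
Proof.
move=> H i j; rewrite mxE.
have -> : (fun s => (F s)^T i j) = (fun s => F s j i) by apply/funext => s; rewrite mxE.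
exact: H.
Qed.

Lemma mder_mul m k l (F : R -> 'M[R]_(m, k)) (G : R -> 'M[R]_(k, l)) t D E :
  mder F t D -> mder G t E -> mder (fun s => F s *m G s) t (D *m G t + F t *m E).
Proof.
move=> HF HG i j; rewrite !mxE -big_split /=.
have -> : (fun s => (F s *m G s) i j) = (fun s => \sum_k0 F s i k0 * G s k0 j).
  by apply/funext => s; rewrite mxE.
by apply: is_derive_bigsum => r; apply: is_derive_mul.
Qed.

Lemma mder_add m k (F G : R -> 'M[R]_(m, k)) t D E :
  mder F t D -> mder G t E -> mder (fun s => F s + G s) t (D + E).
Proof.
move=> HF HG i j; rewrite mxE.
have -> : (fun s => (F s + G s) i j) = (fun s => F s i j) + (fun s => G s i j).
  by apply/funext => s; rewrite mxE.
exact: is_deriveD.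
Qed.

Lemma mder_scalel m k (f : R -> R) (A : 'M[R]_(m, k)) (t d : R) :
  is_derive t (1 : R) f d -> mder (fun s => f s *: A) t (d *: A).
Proof.
move=> H i j; rewrite mxE.
have -> : (fun s => (f s *: A) i j) = (fun s => f s * A i j).
  by apply/funext => s; rewrite mxE.
have := is_derive_mul H (is_derive_cst (A i j) t (1 : R)).
by rewrite mulr0 addr0.
Qed.

Lemma mder_comp m k (F : R -> 'M[R]_(m, k)) (g : R -> R) (t b : R) D :
  mder F (g t) D -> is_derive t (1 : R) g b -> mder (fun s => F (g s)) t (b *: D).
Proof.
move=> HF Hg i j; rewrite mxE mulrC.
exact: (is_derive1_comp (f := fun s => F s i j) (HF i j) Hg).
Qed.

(** A quadratic remainder bound treats the joints of piecewise quadratic functions like any other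
    point. *)
Lemma is_derive_quad (f : R -> R) (x d C : R) :
  (forall h, `|f (x + h) - f x - d * h| <= C * h ^+ 2) -> is_derive x (1 : R) f d.
Proof.
move=> H.
have L : (fun h : R => h^-1 *: (f (h *: (1 : R) + x) - f x)) @ (0 : R)^' --> d.
  apply/cvgrPdist_le => e e0.
  have C0 : 0 <= C.
    by have := H 1; rewrite expr1n !mulr1 => h1; apply: le_trans h1.
  near=> h.
  have h0 : h != 0 by near: h; exact: nbhs_dnbhs_neq.
  have he : `|h| < e / (C + 1).
    near: h; apply: dnbhs0_lt; rewrite divr_gt0 //; lra.
  rewrite /GRing.scale /= mulr1 (addrC h) distrC.
  have -> : h^-1 * (f (x + h) - f x) - d = h^-1 * (f (x + h) - f x - d * h).
    by move: (f (x + h)) (f x) => a b; field.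
  rewrite normrM normfV ler_pdivrMl ?normr_gt0 //.
  apply: le_trans (H h) _; rewrite -(real_normK (num_real h)).
  rewrite ltr_pdivlMr in he; last lra.
  move: he (normr_ge0 h); set a := `|h| => he a0.
  have := ler_wpM2l a0 (ltW he); nra.
by apply: DeriveDef; [exact: (cvgP _ L)|exact: (cvg_lim _ L)].
Unshelve. all: by end_near.
Qed.

Definition ppart (x : R) : R := Num.max 0 x.
Definition sqpos (x : R) : R := ppart x ^+ 2.

Lemma is_derive_sqpos (x : R) : is_derive x (1 : R) sqpos (2 * ppart x).
Proof.
apply: (@is_derive_quad _ _ _ 1) => h; rewrite /sqpos /ppart mul1r ler_norml.
by case: (leP 0 x) => ?; case: (leP 0 (x + h)) => ?; apply/andP; split; nra.
Qed.

Lemma continuous_ppart : continuous ppart.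
Proof.
move=> x; apply/cvgrPdist_le => e e0; near=> y.
apply: (@le_trans _ _ `|x - y|).
  have := ler_norm (x - y); have := ler_norm (y - x); rewrite distrC.
  by rewrite /ppart ler_norml; case: (leP 0 x) => ?; case: (leP 0 y) => ? ? ?;
    apply/andP; split; lra.
near: y; exact: cvgr_dist_le cvg_id _ e0.
Unshelve. all: by end_near.
Qed.

(** The triangle of height 1 over [0, 2]; [step] is a C^1 primitive of twice this triangle and rises
    from 0 to 2. *)
Definition hat (u : R) : R := ppart u - 2 * ppart (u - 1) + ppart (u - 2).
Definition step (u : R) : R := sqpos u - 2 * sqpos (u - 1) + sqpos (u - 2).

Ltac ppart_cases u :=
  rewrite /ppart; case: (leP 0 u) => ?; case: (leP 0 (u - 1)) => ?;
  case: (leP 0 (u - 2)) => ?.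

Lemma hat_bound u : 0 <= hat u <= 1.
Proof. by rewrite /hat; ppart_cases u; apply/andP; split; lra. Qed.

Lemma hat_out u : u <= 0 \/ 2 <= u -> hat u = 0.
Proof. by rewrite /hat; ppart_cases u => -[] ?; lra. Qed.

Lemma step_lo u : u <= 0 -> step u = 0.
Proof. by rewrite /step /sqpos; ppart_cases u => ?; nra. Qed.

Lemma step_hi u : 2 <= u -> step u = 2.
Proof. by rewrite /step /sqpos; ppart_cases u => ?; nra. Qed.

Lemma step_mid u : 0 < u < 2 -> 0 < step u < 2.
Proof.
by case/andP; rewrite /step /sqpos; ppart_cases u => ? ?; apply/andP; split; nra.
Qed.

Lemma step_bound u : 0 <= step u <= 2.
Proof.
have [u0|u0] := leP u 0; first by rewrite step_lo // lexx ler0n.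
have [u2|u2] := leP 2 u; first by rewrite step_hi // lexx ler0n.
have /andP [a b] : 0 < step u < 2 by apply: step_mid; rewrite u0.
by rewrite (ltW a) (ltW b).
Qed.

Lemma is_derive_shift (f : R -> R) (a x d : R) :
  is_derive (x - a) (1 : R) f d -> is_derive x (1 : R) (fun y => f (y - a)) d.
Proof.
move=> H; have G : is_derive x (1 : R) (fun y : R => y - a) 1.
  have -> : (fun y : R => y - a) = (fun y : R => y) - cst a by [].
  have := is_deriveB (is_derive_id x (1 : R)) (is_derive_cst a x (1 : R)).
  by rewrite subr0.
by have := is_derive1_comp (g := fun y => y - a) H G; rewrite mulr1.
Qed.

Lemma is_derive_affine (f g : R -> R) (a b c x d e : R) :
  is_derive x (1 : R) f d -> is_derive x (1 : R) g e ->
  is_derive x (1 : R) (fun y => a * f y + b * g y + c) (a * d + b * e).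
Proof.
move=> Hf Hg.
have H1 := is_derive_mul (is_derive_cst a x (1 : R)) Hf.
have H2 := is_derive_mul (is_derive_cst b x (1 : R)) Hg.
have := is_deriveD (is_deriveD H1 H2) (is_derive_cst c x (1 : R)).
by rewrite !mul0r !add0r addr0.
Qed.

Lemma is_derive_step (u : R) : is_derive u (1 : R) step (2 * hat u).
Proof.
have H0 := is_derive_sqpos u.
have H1 := is_derive_shift (is_derive_sqpos (u - 1)).
have H2 := is_derive_shift (is_derive_sqpos (u - 2)).
have H := is_derive_affine 1 (- 2) 0 H0 H1.
have H' := is_derive_affine 1 1 0 H H2.
have E : (fun y : R => 1 * (1 * sqpos y + - 2 * sqpos (y - 1) + 0)
      + 1 * sqpos (y - 2) + 0) = step by apply/funext => y; rewrite /step; ring.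
rewrite E in H'; apply: is_derive_eq H' _.
by rewrite /hat; ring.
Qed.

Lemma continuous_hat : continuous hat.
Proof.
move=> u; have c a : ppart (y - a) @[y --> u] --> ppart (u - a).
  apply: (@cvg_comp _ _ _ (fun y => y - a) ppart); last exact: continuous_ppart.
  by apply: cvgB; [exact: cvg_id|exact: cvg_cst].
rewrite /hat; apply: cvgD; last exact: c.
apply: cvgB; first exact: continuous_ppart.
by apply: cvgM; [exact: cvg_cst|exact: c].
Qed.

End MatrixDerivatives.

(** * Reparametrizations at rest at the end points *)

Section Reparametrization.
Variable R : realType.
Variable T : R.
Hypothesis T0 : 0 < T.

Definition clamp (t : R) : R := Num.max 0 (Num.min t T).

Lemma clamp_in t : 0 <= clamp t <= T.
Proof.
by rewrite /clamp le_max lexx ge_max (ltW T0) ge_min lexx orbT.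
Qed.

Lemma clamp_id t : 0 <= t <= T -> clamp t = t.
Proof. by case/andP => a b; rewrite /clamp min_l // max_r. Qed.

Lemma continuous_clamp : continuous clamp.
Proof.
have -> : clamp = (fun t => ppart t - ppart (t - T)).
  apply/funext => t; rewrite /clamp /ppart.
  case: (leP t T) => tT; first by rewrite [Num.max 0 (t - T)]max_l ?subr0 // subr_le0.
  have t0 := lt_trans T0 tT.
  rewrite (max_r (ltW T0)) (max_r (ltW t0)) max_r ?subr_ge0 ?(ltW tT) //.
  by rewrite subKr.
move=> x; apply: cvgB; first exact: continuous_ppart.
apply: (@cvg_comp _ _ _ (fun y => y - T) (@ppart R)); last exact: continuous_ppart.
by apply: cvgB; [exact: cvg_id|exact: cvg_cst].
Qed.

Lemma continuous_ext (f : R -> R) :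
  {within `[0, T], continuous f} -> continuous (fun t => f (clamp t)).
Proof.
move=> cf x; have xin : `[0, T]%classic (clamp x) by rewrite /= in_itv /= clamp_in.
have h := (subspace_continuousP _ _).1 cf (clamp x) xin.
have C : clamp y @[y --> x] --> within `[0, T] (nbhs (clamp x)).
  move=> A; rewrite /= nbhs_simpl /within /= => HA.
  have := continuous_clamp HA; rewrite nbhs_simpl /= => H.
  apply: filterS H => y /=; apply.
  by rewrite in_itv /= clamp_in.
exact: cvg_comp C h.
Qed.

Lemma is_derive_lip (f g : R -> R) (t C : R) : 0 <= C ->
  (forall s, `|f s - f t| <= C * `|g s - g t|) ->
  is_derive t (1 : R) g 0 -> is_derive t (1 : R) f 0.
Proof.
move=> C0 H gd.
have Lg : (fun h : R => h^-1 *: (g (h *: (1 : R) + t) - g t)) @ (0 : R)^' --> (0 : R).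
  have := @ex_derive _ _ _ _ _ _ _ gd; rewrite /derivable => /cvg_ex [l hl].
  have := @derive_val _ _ _ _ _ _ _ gd; rewrite /derive (cvg_lim _ hl) // => l0.
  by rewrite l0 in hl; exact: hl.
have Lf : (fun h : R => h^-1 *: (f (h *: (1 : R) + t) - f t)) @ (0 : R)^' --> (0 : R).
  have L0 : (fun h : R => C * `|h^-1 *: (g (h *: (1 : R) + t) - g t)|) @ (0 : R)^' --> (0 : R).
    have := cvgM (cvg_cst C) (cvg_norm Lg); rewrite normr0 mulr0; exact.
  apply: norm_cvg0; apply: (squeeze_cvgr _ (cvg_cst 0) L0).
  near=> h; rewrite normr_ge0 /= /GRing.scale /= !normrM mulrCA.
  by rewrite ler_wpM2l.
by apply: DeriveDef; [exact: (cvgP _ Lf)|exact: (cvg_lim _ Lf)].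
Unshelve. all: by end_near.
Qed.

Lemma lipschitz_of_derive (f df : R -> R) :
  {within `[0, T], continuous f} -> {within `[0, T], continuous df} ->
  (forall t, 0 < t < T -> is_derive t (1 : R) f (df t)) ->
  exists2 C, 0 <= C & forall x y, 0 <= x <= T -> 0 <= y <= T ->
    `|f y - f x| <= C * `|y - x|.
Proof.
move=> cf cdf Hd.
have c1 : {within `[0, T], continuous (fun t => `|df (clamp t)|)}.
  apply: continuous_subspaceT => x.
  apply: (@cvg_comp _ _ _ (fun t => df (clamp t)) (fun y : R => `|y|)).
    exact: continuous_ext.
  exact: norm_continuous.
have [c cin Hc] := EVT_max (ltW T0) c1.
exists `|df (clamp c)| => // .
have main x y : 0 <= x -> x < y -> y <= T -> `|f y - f x| <= `|df (clamp c)| * `|y - x|.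
  move=> x0 xy yT.
  have [||z zin ->] := @MVT_segment R f df x y (ltW xy).
  - move=> z; rewrite in_itv /= => /andP [a b]; apply: Hd.
    by rewrite (le_lt_trans x0 a) (lt_le_trans b yT).
  - apply: continuous_subspaceW cf => z /=; rewrite !in_itv /= => /andP [a b].
    by rewrite (le_trans x0 a) (le_trans b yT).
  rewrite normrM ler_wpM2r //; move: zin; rewrite in_itv /= => /andP [a b].
  have z0T : 0 <= z <= T by rewrite (le_trans x0 a) (le_trans b yT).
  by have := Hc z; rewrite clamp_id //; apply; rewrite in_itv.
move=> x y /andP [x0 xT] /andP [y0 yT].
have [xy|yx|<-] := ltgtP x y; first exact: main.
  by rewrite distrC (distrC y); exact: main.
by rewrite !subrr normr0 mulr0.
Qed.

Variables (m : nat) (phi K : R -> 'M[R]_m).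
Hypothesis cphi : forall i j, {within `[0, T], continuous (fun t => phi t i j)}.
Hypothesis cK : forall i j, {within `[0, T], continuous (fun t => K t i j)}.
Hypothesis dphi : forall t, 0 < t < T -> mder phi t (K t).

(** phi is differentiated only at interior times. When s reaches 0 or T its speed is zero, and since
    phi is Lipschitz the composite has derivative zero there. *)
Lemma mder_reparam (s ds : R -> R) (t : R) :
  (forall t, 0 <= s t <= T) -> (forall t, is_derive t (1 : R) s (ds t)) ->
  (s t = 0 \/ s t = T -> ds t = 0) ->
  mder (fun t => phi (s t)) t (ds t *: K (s t)).
Proof.
move=> s0T sd s0.
have [/andP [a b]|nin] := boolP (0 < s t < T).
  by apply: (mder_comp (F := phi) _ (sd t)); apply: dphi; rewrite a.
have ds0 : ds t = 0.
  apply: s0; have /andP [a b] := s0T t.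
  have [->|n0] := eqVneq (s t) 0; first by left.
  right; apply/eqP; rewrite eq_le b /= leNgt; apply: contra nin => ->.
  by rewrite andbT lt_neqAle eq_sym n0.
move=> i j; rewrite ds0 scale0r mxE.
have [C C0 HC] := lipschitz_of_derive (@cphi i j) (@cK i j) (fun t h => @dphi t h i j).
apply: (@is_derive_lip _ s t C) => //.
  by move=> s'; apply: HC.
by rewrite -ds0.
Qed.

End Reparametrization.

(** * Profiles of time and of the rotation angle *)

Section Profiles.
Variable R : realType.

(** In u = 6 t / T: the time runs to T / 2 on [0, 2], rests on [2, 4] and runs to T on [4, 6]. The
    factor is T / 4 because each [step] rises by 2. *)
Definition sigma (T t : R) : R := T / 4 * (step (6 / T * t) + step (6 / T * t - 4)).
Definition dsigma (T t : R) : R := 3 * (hat (6 / T * t) + hat (6 / T * t - 4)).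

Lemma is_derive_sigma T t : 0 < T -> is_derive t (1 : R) (sigma T) (dsigma T t).
Proof.
move=> T0.
have Hl : is_derive t (1 : R) (fun s : R => 6 / T * s) (6 / T).
  have := is_derive_mul (is_derive_cst (6 / T) t (1 : R)) (is_derive_id t (1 : R)).
  by rewrite mul0r add0r mulr1.
have H1 := is_derive1_comp (g := fun s => 6 / T * s) (is_derive_step (6 / T * t)) Hl.
have H2 := is_derive1_comp (g := fun s => 6 / T * s)
  (is_derive_shift (is_derive_step (6 / T * t - 4))) Hl.
have H := is_derive_affine (T / 4) (T / 4) 0 H1 H2.
have E : (fun y : R => T / 4 * (@step R \o (fun s => 6 / T * s)) y
   + T / 4 * ((fun y : R => step (y - 4)) \o (fun s => 6 / T * s)) y + 0) = sigma T.
  by apply/funext => y; rewrite /sigma /=; move: (step _) (step _) => a b; ring.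
rewrite E in H; apply: is_derive_eq H _.
by rewrite /dsigma; field; rewrite gt_eqF.
Qed.

Lemma sigma_in T t : 0 < T -> 0 <= sigma T t <= T.
Proof.
move=> T0; rewrite /sigma.
have := step_bound (6 / T * t); have := step_bound (6 / T * t - 4).
move: (step _) (step _) => a b /andP [a0 a2] /andP [b0 b2].
by apply/andP; split; nra.
Qed.

Lemma dsigma_eq0 T t : 0 < T -> sigma T t = 0 \/ sigma T t = T -> dsigma T t = 0.
Proof.
move=> T0; rewrite /sigma /dsigma; set u := 6 / T * t.
have [u0|u0] := leP u 0.
  rewrite (hat_out (or_introl u0)) (@hat_out _ (u - 4)); last by left; lra.
  by rewrite addr0 mulr0.
have [u2|u2] := ltP u 2.
  have /andP [a b] : 0 < step u < 2 by apply: step_mid; rewrite u0.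
  rewrite (@step_lo _ (u - 4)); last lra.
  by move: (step u) a b => x a b; case => H; exfalso; nra.
rewrite (step_hi u2) (hat_out (or_intror u2)).
have [u4|u4] := leP u 4.
  by rewrite (@hat_out _ (u - 4)); [rewrite addr0 mulr0|left; lra].
have [u6|u6] := leP 6 u.
  by rewrite (@hat_out _ (u - 4)); [rewrite addr0 mulr0|right; lra].
have /andP [a b] : 0 < step (u - 4) < 2 by apply: step_mid; apply/andP; split; lra.
by move: (step (u - 4)) a b => x a b; case => H; exfalso; nra.
Qed.

Lemma continuous_dsigma T : continuous (dsigma T).
Proof.
move=> t; have c1 : 6 / T * s @[s --> t] --> 6 / T * t.
  by apply: cvgM; [exact: cvg_cst|exact: cvg_id].
rewrite /dsigma; apply: cvgM; first exact: cvg_cst.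
apply: cvgD.
  by apply: (@cvg_comp _ _ _ (fun s => 6 / T * s) (@hat R)); [exact: c1|exact: continuous_hat].
apply: (@cvg_comp _ _ _ (fun s => 6 / T * s - 4) (@hat R)); last exact: continuous_hat.
by apply: cvgB; [exact: c1|exact: cvg_cst].
Qed.

Lemma dsigma_bound T t : 0 <= dsigma T t <= 6.
Proof.
rewrite /dsigma; have := hat_bound (6 / T * t); have := hat_bound (6 / T * t - 4).
by move: (hat _) (hat _) => a b /andP [? ?] /andP [? ?]; apply/andP; split; lra.
Qed.

Lemma sigma0 T : sigma T 0 = 0.
Proof. by rewrite /sigma mulr0 !step_lo; lra. Qed.

Lemma sigmaT T : 0 < T -> sigma T T = T.
Proof.
move=> T0; rewrite /sigma divfK ?gt_eqF // !step_hi; lra.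
Qed.

Lemma sigma_plateau T t : 0 < T -> T / 3 <= t <= 2 * T / 3 ->
  sigma T t = T / 2 /\ dsigma T t = 0.
Proof.
move=> T0 /andP [a b]; rewrite /sigma /dsigma.
have u2 : 2 <= 6 / T * t by rewrite mulrAC ler_pdivlMr //; lra.
have u4 : 6 / T * t <= 4 by rewrite mulrAC ler_pdivrMr //; lra.
rewrite (step_hi u2) (@step_lo _ (6 / T * t - 4)); last lra.
rewrite (hat_out (or_intror u2)) (@hat_out _ (6 / T * t - 4)); last by left; lra.
by split; lra.
Qed.

(** Slope k up to c - d, slope - k from c + d on, with a parabolic cap in between that makes it
    C^1. *)
Definition tent (k c d t : R) : R :=
  k * (t - (sqpos (t - (c - d)) - sqpos (t - (c + d))) / (2 * d)).
Definition dtent (k c d t : R) : R :=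
  k * (1 - (ppart (t - (c - d)) - ppart (t - (c + d))) / d).

Lemma is_derive_tent k c d t : 0 < d -> is_derive t (1 : R) (tent k c d) (dtent k c d t).
Proof.
move=> d0.
have H1 := is_derive_shift (is_derive_sqpos (t - (c - d))).
have H2 := is_derive_shift (is_derive_sqpos (t - (c + d))).
have H := is_derive_affine (- k / (2 * d)) (k / (2 * d)) 0 H1 H2.
have H' := is_derive_affine k 1 0 (is_derive_id t (1 : R)) H.
have E : (fun y : R => k * id y + 1 * (- k / (2 * d) * sqpos (y - (c - d))
    + k / (2 * d) * sqpos (y - (c + d)) + 0) + 0) = tent k c d.
  by apply/funext => y; rewrite /tent /=; field; rewrite gt_eqF.
rewrite E in H'; apply: is_derive_eq H' _.
by rewrite /dtent; field; rewrite gt_eqF.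
Qed.

Lemma continuous_dtent k c d : continuous (dtent k c d).
Proof.
move=> t; have cp a : ppart (y - a) @[y --> t] --> ppart (t - a).
  apply: (@cvg_comp _ _ _ (fun y => y - a) (@ppart R)); last exact: continuous_ppart.
  by apply: cvgB; [exact: cvg_id|exact: cvg_cst].
rewrite /dtent; apply: cvgM; first exact: cvg_cst.
apply: cvgB; first exact: cvg_cst.
by apply: cvgM; [apply: cvgB; exact: cp|exact: cvg_cst].
Qed.

Lemma ppart_le0 (x : R) : x <= 0 -> ppart x = 0.
Proof. by move=> x0; rewrite /ppart max_l. Qed.
Lemma ppart_ge0 (x : R) : 0 <= x -> ppart x = x.
Proof. by move=> x0; rewrite /ppart max_r. Qed.

Lemma tent0 k c d : 0 < d -> d <= c -> tent k c d 0 = 0.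
Proof.
move=> d0 dc; rewrite /tent /sqpos !ppart_le0; [by field; rewrite gt_eqF|lra|lra].
Qed.

Lemma tent2c k c d : 0 < d -> d <= c -> tent k c d (2 * c) = 0.
Proof.
move=> d0 dc; rewrite /tent /sqpos !ppart_ge0; [by field; rewrite gt_eqF|lra|lra].
Qed.

Lemma dtent_lo k c d t : 0 < d -> t <= c - d -> dtent k c d t = k.
Proof.
by move=> d0 dc; rewrite /dtent !ppart_le0; [rewrite subrr mul0r subr0 mulr1|lra|lra].
Qed.

Lemma dtent_hi k c d t : 0 < d -> c + d <= t -> dtent k c d t = - k.
Proof.
move=> d0 dc; rewrite /dtent !ppart_ge0; [by field; rewrite gt_eqF|lra|lra].
Qed.

Lemma tent_top k c d t : 0 <= k -> 0 < d -> c - d <= t <= c + d ->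
  k * (c - d) <= tent k c d t <= k * c.
Proof.
move=> k0 d0 /andP [a b]; rewrite /tent /sqpos ppart_ge0 ?subr_ge0 //.
rewrite (@ppart_le0 (t - (c + d))) ?subr_le0 // expr0n /= subr0.
set w := t - (c - d); have -> : t = c - d + w by rewrite /w; ring.
have w0 : 0 <= w by rewrite subr_ge0.
have w2 : w <= 2 * d by rewrite /w; lra.
have q : w ^+ 2 / (2 * d) <= w by rewrite ler_pdivrMr ?mulr_gt0 //; nra.
have q' : w - d <= w ^+ 2 / (2 * d) by rewrite ler_pdivlMr ?mulr_gt0 //; nra.
by apply/andP; split; apply: ler_wpM2l => //; lra.
Qed.

Variable n : nat.
Local Notation Om := (Om R n).

(** The exponential of th [Om]; it is both orthogonal and symplectic. *)
Definition rotm (th : R) : 'M[R]_(n + n) := cos th *: 1%:M + sin th *: Om.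

Lemma tr_rotm th : (rotm th)^T = cos th *: 1%:M - sin th *: Om.
Proof. by rewrite /rotm linearD !linearZ /= trmx1 tr_Om scalerN. Qed.

Lemma rotmM a b : rotm a *m rotm b = rotm (a + b).
Proof.
rewrite /rotm cosD sinD mulmxDl !mulmxDr -!scalemxAl -!scalemxAr !mul1mx !mulmx1 Om_Om.
by apply/matrixP => i j; rewrite !mxE; ring.
Qed.

Lemma rotm_Om th : rotm th *m Om = Om *m rotm th.
Proof.
by rewrite /rotm mulmxDl mulmxDr -!scalemxAl -!scalemxAr mul1mx mulmx1.
Qed.

Lemma rotmK th : rotm th *m (rotm th)^T = 1%:M.
Proof.
rewrite tr_rotm /rotm mulmxDl !mulmxBr -!scalemxAl -!scalemxAr !mul1mx !mulmx1 Om_Om.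
have E := cos2Dsin2 th.
apply/matrixP => i j; rewrite !mxE; move: E; move: (cos th) (sin th) => c s E.
transitivity ((c ^+ 2 + s ^+ 2) * (i == j)%:R); last by rewrite E mul1r.
by rewrite -[in RHS]mulr_natl; ring.
Qed.

Lemma rotm0 : rotm 0 = 1%:M.
Proof. by rewrite /rotm cos0 sin0 scale0r scale1r addr0. Qed.

Lemma mder_rotm th : mder rotm th (rotm th *m Om).
Proof.
have -> : rotm th *m Om = - sin th *: 1%:M + cos th *: Om.
  rewrite /rotm mulmxDl -!scalemxAl mul1mx Om_Om addrC scalerN scaleNr //.
by apply: mder_add; apply: mder_scalel.
Qed.

End Profiles.

(** * The rotated flow and its crossing form *)

Section FlowPath.
Variables (R : realType) (n : nat).
Local Notation frame := 'M[R]_(n, n + n).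
Local Notation Om := (Om R n).

Lemma J0E : J0 R n = - Om.
Proof. by rewrite /J0 /Om opp_block_mx !oppr0 opprK. Qed.

Lemma lagr_sp (F : frame) (S : 'M[R]_(n + n)) : lagr F -> S *m Om *m S^T = Om ->
  lagr (F *m S).
Proof.
move=> [fF oF] sS; have uS : S \in unitmx.
  have : S *m Om *m S^T \in unitmx by rewrite sS Om_unit.
  by rewrite -mulmxA unitmx_mul => /andP [].
split; first by rewrite /row_free mxrankMfree ?row_free_unit.
by rewrite trmx_mul mulmxA -2!(mulmxA F) sS.
Qed.

Lemma rotm_sp th : rotm n th *m Om *m (rotm n th)^T = Om.
Proof. by rewrite rotm_Om -mulmxA rotmK mulmx1. Qed.

Lemma qf_bound m (S : 'M[R]_m) (y : 'rV[R]_m) :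
  `|qf S y| <= (\sum_i \sum_j `|S i j|) * (y *m y^T) 0 0.
Proof.
have yy : (y *m y^T) 0 0 = \sum_i y 0 i ^+ 2.
  by rewrite mxE; apply: eq_bigr => i _; rewrite mxE expr2.
have yi i : y 0 i ^+ 2 <= (y *m y^T) 0 0.
  by rewrite yy (bigD1 i) //= lerDl sumr_ge0 // => j _; exact: sqr_ge0.
have -> : qf S y = \sum_j \sum_i y 0 i * S i j * y 0 j.
  rewrite /qf mxE; apply: eq_bigr => j _; rewrite !mxE mulr_suml.
  by apply: eq_bigr.
rewrite exchange_big mulr_suml; apply: le_trans (ler_norm_sum _ _ _) _.
apply: ler_sum => i _; rewrite mulr_suml.
apply: le_trans (ler_norm_sum _ _ _) _; apply: ler_sum => j _.
rewrite mulrAC normrM mulrC ler_wpM2l // normrM.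
have := yi i; have := yi j; move: ((y *m y^T) 0 0) => Y.
rewrite -(real_normK (num_real (y 0 i))) -(real_normK (num_real (y 0 j))).
by move: `|y 0 i| `|y 0 j| => a b; nra.
Qed.

Variables (T : R) (B phi : R -> 'M[R]_(n + n)).
Hypothesis T0 : 0 < T.
Hypothesis sB : forall t, 0 <= t <= T -> (B t)^T = B t.
Hypothesis cB : forall i j, {within `[0, T], continuous (fun t => B t i j)}.
Hypothesis cphi : forall i j, {within `[0, T], continuous (fun t => phi t i j)}.
Let K t := J0 R n *m B t *m phi t.
Hypothesis dphi : forall t, 0 < t < T -> mder phi t (K t).
Hypothesis phi0 : phi 0 = 1%:M.

Lemma within_mcvg m k (A : R -> 'M[R]_(m, k)) :
  (forall i j, {within `[0, T], continuous (fun t => A t i j)}) <->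
  (forall t, `[0, T]%classic t -> mcvg (within `[0, T] (nbhs t)) A (A t)).
Proof.
split=> H.
  by move=> t tT i j; exact: ((subspace_continuousP _ _).1 (H i j) t tT).
by move=> i j; apply/subspace_continuousP => t tT; exact: H.
Qed.

Lemma cK i j : {within `[0, T], continuous (fun t => K t i j)}.
Proof.
move: i j; apply/within_mcvg => t tT.
apply: mcvg_mul; last exact: (within_mcvg phi).1.
by apply: mcvg_mul; [exact: mcvg_cst|exact: (within_mcvg B).1].
Qed.

(** The two terms of the derivative of phi^T [Om] phi cancel because B is symmetric; the mean value
    theorem needs the equation only at interior times. *)
Lemma phi_sp t : 0 <= t <= T -> (phi t)^T *m Om *m phi t = Om.
Proof.
move=> /andP [t0 tT]; pose Q s := (phi s)^T *m Om *m phi s.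
suff : Q t = Q 0 by rewrite /Q phi0 trmx1 mul1mx mulmx1.
have cQ i j : {within `[0, T], continuous (fun s => Q s i j)}.
  move: i j; apply/within_mcvg => s sT.
  have h := (within_mcvg phi).1 cphi s sT.
  by apply: mcvg_mul => //; apply: mcvg_mul; [exact: mcvg_tr|exact: mcvg_cst].
have dQ s : 0 < s < T -> mder Q s 0.
  move=> s0T; have h := dphi s0T.
  have := mder_mul (mder_mul (mder_tr h) (mder_cst Om s)) h.
  suff -> : ((K s)^T *m Om + (phi s)^T *m 0) *m phi s + (phi s)^T *m Om *m K s = 0 by [].
  have /andP [a b] := s0T.
  have sBs : (B s)^T = B s by apply: sB; rewrite (ltW a) (ltW b).
  have E1 : (K s)^T *m Om *m phi s = - ((phi s)^T *m (B s *m phi s)).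
    rewrite /K J0E !trmx_mul sBs linearN /= tr_Om opprK -!mulmxA (mulmxA Om Om) Om_Om.
    by rewrite mulNmx mul1mx !mulmxN.
  have E2 : (phi s)^T *m Om *m K s = (phi s)^T *m (B s *m phi s).
    rewrite /K J0E !mulNmx mulmxN -!mulmxA (mulmxA Om Om) Om_Om.
    by rewrite mulNmx mul1mx mulmxN opprK.
  by rewrite mulmx0 addr0 E1 E2 addNr.
apply/matrixP => i j; move: t0; rewrite le_eqVlt => /orP [/eqP <- //|t0].
have [||z _ E] := @MVT_segment R (fun s => Q s i j) (fun=> 0) 0 t (ltW t0).
- move=> z; rewrite in_itv /= => /andP [a b].
  have := dQ z; rewrite a (lt_le_trans b tT) => /(_ isT) h.
  by have := h i j; rewrite mxE.
- apply: continuous_subspaceW (cQ i j) => z /=; rewrite !in_itv /= => /andP [-> b].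
  exact: le_trans b tT.
by apply/eqP; rewrite -subr_eq0 E mul0r.
Qed.

Variable (Lb : frame).
Hypothesis lLb : lagr Lb.

Definition flow_frame t : frame := Lb *m (phi t)^T.

Lemma flow_frame_lagr t : 0 <= t <= T -> lagr (flow_frame t).
Proof. by move=> tT; apply: lagr_sp => //; rewrite trmxK phi_sp. Qed.

Variables (k d : R).
Hypotheses (d0 : 0 < d) (dT : d <= T / 2).
Local Notation g := (tent k (T / 2) d).
Local Notation dg := (dtent k (T / 2) d).
Local Notation s := (sigma T).
Local Notation ds := (dsigma T).

(* Rotating the flow by an angle whose speed dominates B makes every crossing
   form definite; the parameter change s keeps the flow at rest near T / 2, where
   the rotation turns back. *)
Definition rot_path t : frame := flow_frame (s t) *m rotm n (g t).

Definition rot_path_der t : frame :=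
  ds t *: (Lb *m (K (s t))^T *m rotm n (g t)) +
  dg t *: (flow_frame (s t) *m rotm n (g t) *m Om).

Lemma rot_path_lagr t : lagr (rot_path t).
Proof. by apply: lagr_sp; [apply: flow_frame_lagr; exact: sigma_in|exact: rotm_sp]. Qed.

Lemma mder_rot_path t : mder rot_path t (rot_path_der t).
Proof.
have h1 := mder_reparam T0 cphi cK dphi (fun t => sigma_in t T0)
  (fun t => is_derive_sigma t T0) (@dsigma_eq0 _ T t T0).
have h2 := mder_mul (mder_cst Lb t) (mder_tr h1).
have h3 := mder_comp (@mder_rotm R n (g t)) (is_derive_tent k (T / 2) t d0).
have := mder_mul h2 h3.
rewrite mul0mx add0r linearZ /= -scalemxAr -scalemxAl -scalemxAr mulmxA.
exact.
Qed.

Lemma mcvg_comp_in m l (A : R -> 'M[R]_(m, l)) (a : R -> R) t :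
  (forall i j, {within `[0, T], continuous (fun t => A t i j)}) ->
  (forall t, 0 <= a t <= T) -> a @ t --> a t ->
  mcvg (nbhs t) (fun t => A (a t)) (A (a t)).
Proof.
move=> cA aT ca i j.
have E : (fun t => A (a t) i j) = (fun t => A (clamp T (a t)) i j).
  by apply/funext => y; rewrite clamp_id.
rewrite E -(clamp_id (aT t)).
have h : (fun t => A (clamp T t) i j) @ (a t) --> A (clamp T (a t)) i j.
  exact: (continuous_ext T0 (f := fun t => A t i j) (@cA i j)).
exact: cvg_comp ca h.
Qed.

Lemma is_derive_cvg (f : R -> R) (t e : R) : is_derive t (1 : R) f e -> f @ t --> f t.
Proof.
move=> H; apply: differentiable_continuous; apply/derivable1_diffP.
exact: ex_derive.
Qed.

Lemma mcvg_rotm (f : R -> R) t : f @ t --> f t ->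
  mcvg (nbhs t) (fun t => rotm n (f t)) (rotm n (f t)).
Proof.
move=> cf; apply: mcvg_add; apply: mcvg_scale; try exact: mcvg_cst.
  exact: cvg_comp cf (@continuous_cos R (f t)).
exact: cvg_comp cf (@continuous_sin R (f t)).
Qed.

Lemma rot_path_C1 : C1_lagr_frame rot_path.
Proof.
split=> [t|i j]; first exact/lagr_lagrangian/rot_path_lagr.
split=> [t|]; first exact: (@ex_derive _ _ _ _ _ _ _ (@mder_rot_path t i j)).
have -> : derive (fun t => rot_path t i j) ^~ (1 : R) = (fun t => rot_path_der t i j).
  by apply/funext => t; exact: (@derive_val _ _ _ _ _ _ _ (@mder_rot_path t i j)).
move=> t.
have cs := is_derive_cvg (is_derive_sigma t T0).
have cg := is_derive_cvg (is_derive_tent k (T / 2) t d0).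
have sT t' := @sigma_in R T t' T0.
have cr := mcvg_rotm cg.
have c1 := mcvg_comp_in cphi sT cs.
have c2 := mcvg_comp_in cK sT cs.
have cf : mcvg (nbhs t) (fun t => flow_frame (s t)) (flow_frame (s t)).
  by apply: mcvg_mul; [exact: mcvg_cst|exact: mcvg_tr].
suff : mcvg (nbhs t) rot_path_der (rot_path_der t) by apply.
apply: mcvg_add; apply: mcvg_scale.
- exact: continuous_dsigma.
- apply: mcvg_mul => //; apply: mcvg_mul; first exact: mcvg_cst.
  exact: mcvg_tr.
- exact: continuous_dtent.
- by apply: mcvg_mul; [apply: mcvg_mul|exact: mcvg_cst].
Qed.

(** The rotation drops out, in the first term because it is symplectic and in the second because it
    is orthogonal. The flow contributes B on the flow frame, the rotation the Euclidean Gram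
    matrix. *)
Lemma Gam_rot_path t : Gam rot_path t =
  ds t *: (flow_frame (s t) *m B (s t) *m (flow_frame (s t))^T) +
  dg t *: (flow_frame (s t) *m (flow_frame (s t))^T).
Proof.
have -> : Gam rot_path t = rot_path t *m Om *m (rot_path_der t)^T.
  congr (_ *m _^T); apply/matrixP => i j; rewrite mxE.
  exact: (@derive_val _ _ _ _ _ _ _ (@mder_rot_path t i j)).
rewrite /rot_path /rot_path_der; set Y := flow_frame (s t); set r := rotm n (g t).
have trD (X Z : frame) u v : (u *: X + v *: Z)^T = u *: X^T + v *: Z^T.
  by rewrite linearD !linearZ.
rewrite trD mulmxDr -!scalemxAr; congr (_ *: _ + _ *: _).
  rewrite !trmx_mul trmxK -(mulmxA Y) (mulmxA _ r^T) -(mulmxA Y) rotm_sp.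
  rewrite /K J0E !mulNmx !mulmxN -!mulmxA (mulmxA Om Om) Om_Om.
  by rewrite !(mulNmx, mulmxN) ?opprK mul1mx /Y /flow_frame ?trmx_mul ?trmxK !mulmxA.
rewrite !trmx_mul tr_Om mulmxA -(mulmxA _ Om) mulmxN Om_Om opprK mulmx1.
by rewrite mulmxA -(mulmxA Y) rotmK mulmx1.
Qed.

End FlowPath.

(** * Definiteness and the homotopy to the flow *)

Section Existence.
Variables (R : realType) (n : nat).
Local Notation frame := 'M[R]_(n, n + n).
Local Notation Om := (Om R n).

Lemma continuous_entry_bound (T : R) m l (A : R -> 'M[R]_(m, l)) : 0 < T ->
  (forall i j, {within `[0, T], continuous (fun t => A t i j)}) ->
  exists2 M, 0 <= M & forall t, 0 <= t <= T -> \sum_i \sum_j `|A t i j| <= M.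
Proof.
move=> T0 cA.
have c1 : {within `[0, T], continuous (fun t => \sum_i \sum_j `|A (clamp T t) i j|)}.
  apply: continuous_subspaceT => x; apply: cvg_bigsum => i; apply: cvg_bigsum => j.
  apply: (@cvg_comp _ _ _ (fun t => A (clamp T t) i j) (fun y : R => `|y|)).
    exact: (continuous_ext T0 (f := fun t => A t i j) (@cA i j)).
  exact: norm_continuous.
have [c cin Hc] := EVT_max (ltW T0) c1.
exists (\sum_i \sum_j `|A (clamp T c) i j|).
  by apply: sumr_ge0 => i _; apply: sumr_ge0.
by move=> t tT; have := Hc t; rewrite clamp_id //; apply; rewrite in_itv.
Qed.

Variables (T : R) (B phi : R -> 'M[R]_(n + n)).
Hypothesis T0 : 0 < T.
Hypothesis sB : forall t, 0 <= t <= T -> (B t)^T = B t.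
Hypothesis cB : forall i j, {within `[0, T], continuous (fun t => B t i j)}.
Hypothesis cphi : forall i j, {within `[0, T], continuous (fun t => phi t i j)}.
Hypothesis dphi : forall t, 0 < t < T -> mder phi t (J0 R n *m B t *m phi t).
Hypothesis phi0 : phi 0 = 1%:M.
Variable (Lb : frame).
Hypothesis lLb : lagr Lb.

Local Notation rp k d := (rot_path T phi Lb k d).

(** Away from the cap the rotation term is k or - k times the squared norm of y, while the flow term
    is at most 6 M times it: 6 bounds [dsigma] and M the entries of B. *)
Lemma Gam_definite k d M t (x : 'rV[R]_n) : 0 < d -> d <= T / 2 ->
  (forall u, 0 <= u <= T -> \sum_i \sum_j `|B u i j| <= M) -> 0 <= M -> 6 * M < k ->
  t <= T / 2 - d \/ T / 2 + d <= t -> x != 0 -> qf (Gam (rp k d) t) x != 0.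
Proof.
move=> d0 dT HM M0 kM ht x0.
rewrite (Gam_rot_path T0 cB cphi dphi Lb k d0).
have lY := flow_frame_lagr sB cphi dphi phi0 lLb (sigma_in t T0).
set Y := flow_frame _ _ _ in lY *; set y := x *m Y.
have y0 : y != 0 by rewrite mulmx_free_eq0 // lY.1.
rewrite qfDl.
have -> : qf (dsigma T t *: (Y *m B (sigma T t) *m Y^T)) x = dsigma T t * qf (B (sigma T t)) y.
  by rewrite -qf_conj /qf -scalemxAr -scalemxAl mxE.
have -> : qf (dtent k (T / 2) d t *: (Y *m Y^T)) x = dtent k (T / 2) d t * (y *m y^T) 0 0.
  by rewrite /qf -scalemxAr -scalemxAl mxE /y (trmx_mul x Y) (mulmxA (x *m Y)) -(mulmxA x).
have yp : 0 < (y *m y^T) 0 0.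
  rewrite lt_neqAle eq_sym; apply/andP; split.
    apply/negP => /eqP /row_sq_eq0 h; case/negP: y0; exact/eqP.
  rewrite mxE sumr_ge0 // => j _; rewrite [y^T _ _]mxE -expr2; exact: sqr_ge0.
have := qf_bound (B (sigma T t)) y; have := HM _ (sigma_in t T0).
have := dsigma_bound T t.
move: (dsigma T t) (qf _ y) (\sum_i _) => s q m' /andP [s0 s6] mM qm.
have qM : `|q| <= M * (y *m y^T) 0 0 by apply: le_trans qm _; rewrite ler_wpM2r // ltW.
move: yp qM; set w := (y *m y^T) 0 0 => yp qM.
have sq : `|s * q| <= 6 * (M * w).
  by rewrite normrM (ger0_norm s0) ler_pM.
have kw : 6 * (M * w) < k * w by rewrite mulrA ltr_pM2r.
move: sq; rewrite ler_norml => /andP [a b].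
case: ht => [/(dtent_lo k d0) ->|/(dtent_hi k d0) ->]; last rewrite mulNr.
  by rewrite gt_eqF //; lra.
by rewrite lt_eqF //; lra.
Qed.

(** Time is interpolated from t to [sigma T t] and the angle from 0 to [tent]. [sigma] fixes 0 and T
    and [tent] vanishes there, so the ends do not move. *)
Lemma rot_path_homotopic (L : 'M[R]_(n + n)) k d : 0 < d -> d <= T / 2 ->
  (Lb :=: L)%MS -> homotopic_rel 0 T (fun t => L *m (phi t)^T) (rp k d).
Proof.
move=> d0 dT LbL.
pose a (st : R * R) := (1 - st.1) * st.2 + st.1 * sigma T st.2.
pose b (st : R * R) := st.1 * tent k (T / 2) d st.2.
pose H s t := Lb *m (phi (clamp T (a (s, t))))^T *m rotm n (b (s, t)).
have s1 t : a (1, t) = sigma T t by rewrite /a /= subrr mul0r add0r mul1r.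
have s0 t : a (0, t) = t by rewrite /a /= subr0 mul1r mul0r addr0.
have T2 : T = 2 * (T / 2) by field.
exists H; split; [|split; [|split]].
- move=> s t _ _; apply: lagr_lagrangian; apply: lagr_sp; last exact: rotm_sp.
  exact: (flow_frame_lagr sB cphi dphi phi0 lLb (clamp_in T0 _)).
- move=> i j; apply: continuous_subspaceT => x.
  have c1 : (fun st : R * R => st.1) @ x --> x.1 by exact: cvg_fst.
  have c2 : (fun st : R * R => st.2) @ x --> x.2 by exact: cvg_snd.
  have cs : (fun st : R * R => sigma T st.2) @ x --> sigma T x.2.
    exact: cvg_comp c2 (is_derive_cvg (is_derive_sigma x.2 T0)).
  have cg : (fun st : R * R => tent k (T / 2) d st.2) @ x --> tent k (T / 2) d x.2.
    exact: cvg_comp c2 (is_derive_cvg (is_derive_tent k (T / 2) x.2 d0)).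
  have ca : a @ x --> a x.
    apply: cvgD; apply: cvgM => //.
    by apply: cvgB => //; exact: cvg_cst.
  have cb : b @ x --> b x by apply: cvgM.
  suff : mcvg (nbhs x) (fun st : R * R => H st.1 st.2) (H x.1 x.2) by apply.
  have E st : a (st.1, st.2) = a st by case: st.
  have E' st : b (st.1, st.2) = b st by case: st.
  rewrite /H E E'; under eq_fun do rewrite E E'.
  apply: mcvg_mul.
    apply: mcvg_mul; first exact: mcvg_cst.
    apply: mcvg_tr => i' j'.
    have h : (fun t => phi (clamp T t) i' j') @ (a x) --> phi (clamp T (a x)) i' j'.
      exact: (continuous_ext T0 (f := fun t => phi t i' j') (@cphi i' j')).
    exact: cvg_comp ca h.
  apply: mcvg_add; apply: mcvg_scale; try exact: mcvg_cst.
    exact: cvg_comp cb (@continuous_cos R (b x)).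
  exact: cvg_comp cb (@continuous_sin R (b x)).
- move=> t tT; split; apply/eqmxP.
    rewrite /H s0 clamp_id // /b /= mul0r rotm0 mulmx1; exact: eqmxMr.
  by rewrite /H s1 clamp_id ?sigma_in // /b /= mul1r.
- move=> s _; split; apply/eqmxP.
    have as0 : a (s, 0) = 0 by rewrite /a /= sigma0 !mulr0 addr0.
    rewrite /H as0 /b /= tent0 // mulr0 rotm0 mulmx1 clamp_id ?lexx ?ltW //; exact: eqmxMr.
  have asT : a (s, T) = T by rewrite /a /= sigmaT // -mulrDl subrK mul1r.
  have gT : tent k (T / 2) d T = 0 by rewrite {2}T2 tent2c.
  rewrite /H asT /b /= gT mulr0 rotm0 mulmx1 clamp_id ?lexx ?ltW //.
  exact: eqmxMr.
Qed.

End Existence.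

(** * Regular representatives and the index of the flow path *)

Section RegularPaths.
Variables (R : realType) (n : nat).
Local Notation frame := 'M[R]_(n, n + n).
Local Notation Om := (Om R n).

(** 1 + tau [Om] is, up to the factor cos (atan tau), the rotation by atan tau, so [rot_trans]
    yields angles just above th1. *)
Lemma rotm_trans (Y0 G : frame) (th1 : R) : lagr Y0 -> lagr G ->
  exists2 th, th1 < th & trans (Y0 *m rotm n th) G.
Proof.
move=> lY lG; pose Lam := Y0 *m rotm n th1.
have lLam : lagr Lam by apply: lagr_sp => //; exact: rotm_sp.
have [tau [Htau tau0]] := filter_ex
  (filterI (rot_trans lLam lG) (nbhs_right_gt (0 : R))).
exists (th1 + atan tau); first by rewrite ltrDl -(@atan0 R); exact: lt_atan.
have c0 : 0 < cos (atan tau) by rewrite cos_atan invr_gt0 sqrtr_gt0 ltr_pwDl // sqr_ge0.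
have -> : Y0 *m rotm n (th1 + atan tau) = cos (atan tau) *: (Lam + tau *: (Lam *m Om)).
  rewrite -rotmM mulmxA -/Lam /rotm mulmxDr -!scalemxAr mulmx1 scalerDr scalerA.
  congr (_ + _ *: _); have := atanK tau; rewrite /tan => h.
  by rewrite -{3}h mulrC divfK // gt_eqF.
by rewrite /trans -!scalemxAl unitmxZ // unitfE gt_eqF.
Qed.

(** Regular crossings are isolated by [jump_one_side]; chaining intervals without interior crossings
    adds one junction point at a time. *)
Lemma finite_crossings (F : R -> frame) (L0 : 'M[R]_(n + n)) (G : frame) (T : R) :
  0 < T -> C1_lagr_frame F -> lagr G -> (G :=: L0)%MS ->
  (forall t, 0 <= t <= T -> regular F L0 t) ->
  exists s : seq R, forall t, 0 < t < T -> crossing F L0 t -> t \in s.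
Proof.
move=> T0 [lF' dF'] lG GL reg.
have lF t : lagr (F t) by exact: lagrangian_lagr.
have dF i j t : derivable (fun s => F s i j) t 1 by have [h _] := dF' i j; exact: h.
apply: (@interval_chain _ (fun x y => exists s : seq R,
  forall t, x < t < y -> crossing F L0 t -> t \in s)) => //.
  move=> x y z _ xy yz _ [s1 H1] [s2 H2]; exists (y :: s1 ++ s2) => t /andP [xt tz] ct.
  rewrite inE mem_cat; have [ty|yt|->] := ltgtP t y; last by [].
    by rewrite H1 ?xt ?ty ?orbT.
  by rewrite H2 ?yt ?tz ?orbT.
move=> t tT; have rt := reg t tT.
have [|Y [lY HY]] := @common_trans R n [:: F t; G].
  by move=> A; rewrite !inE => /orP [] /eqP ->.
have ut : trans (F t) Y by apply: HY; rewrite !inE eqxx.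
have uG : trans G Y by apply: HY; rewrite !inE eqxx orbT.
have Hr := jump_one_side lF dF lG GL (or_introl (erefl (1 : R))) lY ut uG rt.
have Hl := jump_one_side lF dF lG GL (or_intror (erefl (-1 : R))) lY ut uG rt.
move/nbhs_ballP: Hr => [e1 /= e10 H1]; move/nbhs_ballP: Hl => [e2 /= e20 H2].
exists (Num.min e1 e2); first by rewrite lt_min e10.
split=> [x _ xt1 xt2|y _ ty1 ty2]; exists [::] => u /andP [u1 u2] cu.
  have := H2 (t - u); rewrite mulN1r opprB subrKC => h.
  have [||_] := h; last by rewrite cu.
    rewrite /ball /= sub0r normrN gtr0_norm ?subr_gt0 // ltrBlDl -ltrBlDr.
    by apply: le_lt_trans (lt_trans xt1 u1); rewrite lerD2l lerN2 ge_min lexx orbT.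
  by rewrite subr_gt0.
have := H1 (u - t); rewrite mul1r subrKC => h.
have [||_] := h; last by rewrite cu.
  rewrite /ball /= sub0r normrN gtr0_norm ?subr_gt0 // ltrBlDl.
  by apply: lt_le_trans (lt_trans u2 ty2) _; rewrite lerD2l ge_min lexx.
by rewrite subr_gt0.
Qed.

Lemma clm_sum_exists (F : R -> frame) (L0 : 'M[R]_(n + n)) (G : frame) (T : R) :
  0 < T -> C1_lagr_frame F -> lagr G -> (G :=: L0)%MS ->
  (forall t, 0 <= t <= T -> regular F L0 t) -> exists k, clm_sum L0 0 T F k.
Proof.
move=> T0 cF lG GL reg; have [s Hs] := finite_crossings T0 cF lG GL reg.
eexists; exists (undup [seq t <- s | (0 < t < T) && crossing F L0 t]).
split; first exact: undup_uniq.
split; last by split; [exact: reg|reflexivity].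
move=> t; rewrite mem_undup mem_filter; split.
  by move=> /andP [/andP [-> ->] _].
by move=> [tT ct]; rewrite tT ct Hs.
Qed.

Lemma regular_definite (F : R -> frame) (L0 : 'M[R]_(n + n)) t :
  (forall t, lagr (F t)) -> (forall i j t, derivable (fun s => F s i j) t 1) ->
  (forall x : 'rV[R]_n, x != 0 -> qf (Gam F t) x != 0) -> regular F L0 t.
Proof.
move=> lF dF H _ u uS Hu.
have /submxP [x ux] : (u <= F t)%MS by apply: submx_trans uS (capmxSl _ _).
(* Testing with v = u gives Q(2 u) - 2 Q(u) = 2 Q(u) = 0. *)
have := Hu u uS; rewrite ux -mulmxDl !crossing_formE //.
have -> : x + x = 2 *: x by rewrite scaler_nat mulr2n.
rewrite qfZ => h; have [->|/H] := eqVneq x 0; first by rewrite mul0mx.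
by move: (qf _ _) h => q h; case/negP; apply/eqP; lra.
Qed.

Lemma regular_trans (F : R -> frame) (L0 : 'M[R]_(n + n)) (G : frame) t :
  (forall t, lagr (F t)) -> lagr G -> (G :=: L0)%MS -> trans (F t) G -> regular F L0 t.
Proof.
move=> lF lG GL u; rewrite /regular (crossingE F GL).
by rewrite (trans_capP (lF t) lG u).
Qed.

Variables (T : R) (B phi : R -> 'M[R]_(n + n)).
Hypothesis T0 : 0 < T.
Hypothesis sB : forall t, 0 <= t <= T -> (B t)^T = B t.
Hypothesis cB : forall i j, {within `[0, T], continuous (fun t => B t i j)}.
Hypothesis cphi : forall i j, {within `[0, T], continuous (fun t => phi t i j)}.
Hypothesis dphi : forall t, 0 < t < T -> mder phi t (J0 R n *m B t *m phi t).
Hypothesis phi0 : phi 0 = 1%:M.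
Variable (Lb : frame).
Hypothesis lLb : lagr Lb.

(** Away from the cap all crossing forms are definite. On the cap the path is the resting frame [Y0]
    turned by an angle close to th, hence transversal to G, and there are no crossings. *)
Lemma regular_path_exists (L L0 : 'M[R]_(n + n)) (G : frame) :
  (Lb :=: L)%MS -> lagr G -> (G :=: L0)%MS -> exists F k,
  [/\ C1_lagr_frame F, homotopic_rel 0 T (fun t => L *m (phi t)^T) F &
      clm_sum L0 0 T F k].
Proof.
move=> LbL lG GL; have [M M0 HM] := continuous_entry_bound T0 cB.
have T_gt0 := T0.
pose c := T / 2; have c0 : 0 < c by rewrite divr_gt0.
have cT : 0 <= c <= T by rewrite /c; apply/andP; split; lra.
pose Y0 := flow_frame phi Lb c.
have lY0 : lagr Y0 := flow_frame_lagr sB cphi dphi phi0 lLb cT.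
(* With k = th / c, a peak angle above (6 M + 1) c is a slope above 6 M + 1, enough for
   [Gam_definite]. *)
have [th th1 uth] := rotm_trans ((6 * M + 1) * c) lY0 lG.
pose k := th / c.
have kM : 6 * M + 1 < k by rewrite /k ltr_pdivlMr.
have k0 : 0 < k by lra.
have kc : k * c = th by rewrite /k divfK // gt_eqF.
have cr : mcvg (nbhs th) (fun t => Y0 *m rotm n t) (Y0 *m rotm n th).
  apply: mcvg_mul; first exact: mcvg_cst.
  exact: (mcvg_rotm (f := id) cvg_id).
have /nbhs_ballP [e /= e0 He] : nbhs th (fun t => trans (Y0 *m rotm n t) G).
  exact: (trans_near (F := nbhs th) cr uth).
(* T / 6 puts the cap inside the middle third, where the flow rests; e / (2 k) keeps the angle on
   the cap within e of its nominal peak k c = th. *)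
pose d := Num.min (T / 6) (e / (2 * k)).
have d0 : 0 < d by rewrite lt_min !divr_gt0 // mulr_gt0.
have d6 : d <= T / 6 by rewrite ge_min lexx.
have de : k * d < e.
  have k2 : 0 < 2 * k by rewrite mulr_gt0.
  have kd : 0 < k * d by rewrite mulr_gt0.
  have : d * (2 * k) <= e by rewrite -ler_pdivlMr // ge_min lexx orbT.
  by move: kd; clearbody d; nra.
have dT : d <= T / 2 by lra.
pose F := rot_path T phi Lb k d.
have lF : forall t, lagr (F t) := rot_path_lagr T0 sB cphi dphi phi0 lLb k d.
have C1F : C1_lagr_frame F := rot_path_C1 T0 sB cB cphi dphi phi0 lLb k d0.
have dF i j t : derivable (fun s => F s i j) t 1 by have [h _] := C1F.2 i j; exact: h.
have reg t : 0 <= t <= T -> regular F L0 t.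
  move=> tT.
  have D : t <= T / 2 - d \/ T / 2 + d <= t -> regular F L0 t.
    move=> ht; apply: regular_definite => // x x0.
    by apply: (Gam_definite T0 sB cB cphi dphi phi0 lLb d0 dT HM M0) => //; lra.
  have [h1|h1] := leP t (T / 2 - d); first by apply: D; left.
  have [h2|h2] := leP (T / 2 + d) t; first by apply: D; right.
  apply: (regular_trans lF lG GL).
  have tm : T / 3 <= t <= 2 * T / 3 by apply/andP; split; lra.
  rewrite /F /rot_path (sigma_plateau T0 tm).1; apply: He.
  have td : T / 2 - d <= t <= T / 2 + d by apply/andP; split; lra.
  have /andP [a b] := tent_top (ltW k0) d0 td.
  rewrite -/c in a b *; rewrite mulrBr kc in a; rewrite kc in b.
  by rewrite /ball /= ger0_norm ?subr_ge0 //; lra.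
have [m Hm] := clm_sum_exists T0 C1F lG GL reg.
by exists F, m; split => //; exact: (rot_path_homotopic T0 sB cphi dphi phi0 lLb k d0 dT LbL).
Qed.

(** A regular representative exists, so [xget] returns the crossing sum of some representative
    instead of its default 0. *)
Lemma clm_spec (L L0 : 'M[R]_(n + n)) : (Lb :=: L)%MS -> lagrangian L0 ->
  exists F, [/\ C1_lagr_frame F, homotopic_rel 0 T (fun t => L *m (phi t)^T) F &
      clm_sum L0 0 T F (clm L0 0 T (fun t => L *m (phi t)^T))].
Proof.
move=> LbL /lagrangian_frame [G [lG GL]].
have [F [k [c h s]]] := regular_path_exists LbL lG GL.
rewrite /clm; case: xgetP => [k' _ [F' [c' [h' s']]]|none]; first by exists F'.
by exfalso; apply: (none k); exists F.
Qed.

End RegularPaths.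

(** Vectors are rows, so the flow acts on the right through its transpose; the differential equation
    is imposed at interior times, with continuity up to the end points. *)
Theorem theorem2p10 (R : realType) (n : nat) (T : R)
    (B phi : R -> 'M[R]_(n + n)) (L L1 L2 : 'M[R]_(n + n)) :
  0 < T ->
  (forall t, 0 <= t <= T -> (B t)^T = B t) ->
  (forall i j, {within `[0, T], continuous (fun t => B t i j)}) ->
  (forall i j, {within `[0, T], continuous (fun t => phi t i j)}) ->
  (forall t, 0 < t < T -> forall i j,
      is_derive t (1 : R) (fun s => phi s i j) ((J0 R n *m B t *m phi t) i j)) ->
  phi 0 = 1%:M ->
  lagrangian L -> lagrangian L1 -> lagrangian L2 ->
  let ell := fun t => L *m (phi t)^T in
  let eps1 := \rank (L :&: ell T + ell T :&: L1)%MS in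
  let eps2 := \rank (L :&: ell T + ell T :&: L2)%MS in
  let del1 := \rank (L :&: L1 + L1 :&: L2)%MS in
  let del2 := \rank (ell T :&: L1 + L1 :&: L2)%MS in
  let k := maxn (minn eps1 eps2) (minn del1 del2) in
  `| clm L2 0 T ell - clm L1 0 T ell | <= n%:Z - k%:Z.
Proof.
move=> T0 sB cB cphi dphi phi0 /lagrangian_frame [A [lA AL]] lL1 lL2.
have dphi' t : 0 < t < T -> mder phi t (J0 R n *m B t *m phi t) by exact: dphi.
cbv zeta; set ell := fun t => L *m (phi t)^T.
have [F1 [c1 h1 s1]] := clm_spec T0 sB cB cphi dphi' phi0 lA AL lL1.
have [F2 [c2 h2 s2]] := clm_spec T0 sB cB cphi dphi' phi0 lA AL lL2.
have [G1 [l1 GL1]] := lagrangian_frame lL1; have [G2 [l2 GL2]] := lagrangian_frame lL2.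
pose C := flow_frame phi A T.
have TT : 0 <= T <= T by rewrite lexx ltW.
have lC : lagr C := flow_frame_lagr sB cphi dphi' phi0 lA TT.
have CE : (C :=: ell T)%MS by exact: eqmxMr.
have A0 : (A :=: ell 0)%MS by rewrite /ell phi0 trmx1 mulmx1.
have [|W [lW HW]] := @common_trans R n [:: A; C; G1; G2].
  by move=> X; rewrite !inE => /or4P [] /eqP ->.
have [uA uC u1 u2] : [/\ trans A W, trans C W, trans G1 W & trans G2 W].
  by split; apply: HW; rewrite !inE eqxx ?orbT.
rewrite (clm_sum_diff T0 l1 l2 GL1 GL2 c1 h1 s1 c2 h2 s2 A0 CE lA lC lW uA uC u1 u2).
have E (X Y Z : 'M[R]_(n, n + n)) (X' Y' Z' : 'M[R]_(n + n)) :
    (X :=: X')%MS -> (Y :=: Y')%MS -> (Z :=: Z')%MS ->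
    \rank (X' :&: Y' + Y' :&: Z')%MS = \rank (X :&: Y + Y :&: Z)%MS.
  move=> eX eY eZ; apply: eqmx_rank; apply/eqmxP; apply: eqmx_sym.
  by apply: adds_eqmx; apply: cap_eqmx.
rewrite (E _ _ _ _ _ _ AL CE GL1) (E _ _ _ _ _ _ AL CE GL2).
rewrite (E _ _ _ _ _ _ AL GL1 GL2) (E _ _ _ _ _ _ CE GL1 GL2).
exact: dh_bound.
Qed.
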